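(* There exist absolute constants $C,\tilde C>0$ such that the following holds. Let $D\in\mathcal{D}^{n,d}_{\mathrm{rch}_{\min}}(f_{\min},f_{\max},L)$ with support $M$, $\tau>0$, $\eta\ge0$, and assume $$\frac{\tau}{\omega_d f_{\max}\mathrm{rch}_{\min}^d}\le\left(\frac{1}{8\sqrt d}\right)^{d+1}\quad\text{and}\quad\eta\le\frac{\mathrm{rch}_{\min}}{64d}.$$ Then for every $x_0\in\mathbb{R}^n$ with $\mathrm{d}(x_0,M)\le\eta$ there exists a deterministic SQ algorithm making at most $Cdn\log^6(n)$ queries to $\mathrm{STAT}(\tau)$ that, for every valid $\mathrm{STAT}(\tau)$ oracle for $D$, outputs a $d$-dimensional linear subspace $\hat T(x_0)$ of $\mathbb{R}^n$ with $$\|\pi_{\hat T(x_0)}-\pi_{T_{\pi_M(x_0)}M}\|_{\mathrm{op}}\le\tilde C^d\frac{f_{\max}}{f_{\min}}\max\left\{\sqrt{\frac{\eta}{\mathrm{rch}_{\min}}},\ \left(\frac{\tau}{\omega_d f_{\max}\mathrm{rch}_{\min}^d}\right)^{\frac{1}{d+1}}\right\}.$$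
   Context: Notation: $\omega_d$ is the volume of the unit ball of $\mathbb{R}^d$. $\mathrm{d}(z,K)=\inf_{p\in K}\|p-z\|$. The reach $\mathrm{rch}_K$ of a closed $K$ is the infimum of $\mathrm{d}(z,K)$ over the medial axis (points with at least two distinct nearest points in $K$); $\pi_M$ is the nearest-point projection onto $M$; $T_pM$ is the tangent space of $M$ at $p$; for a linear subspace $T$, $\pi_T$ is the orthogonal projection matrix onto $T$ and $\|\cdot\|_{\mathrm{op}}$ is the operator norm. $\mathcal{M}^{n,d}_{\rho}$ is the set of compact connected $d$-dimensional $C^2$ submanifolds of $\mathbb{R}^n$ without boundary with reach $\ge\rho$. $\mathcal{D}^{n,d}_{\mathrm{rch}_{\min}}(f_{\min},f_{\max},L)$ is the set of Borel probability distributions on $\mathbb{R}^n$ with support $M\in\mathcal{M}^{n,d}_{\mathrm{rch}_{\min}}$ having a density $f$ w.r.t. the $d$-dimensional Hausdorff measure restricted to $M$ with $0<f_{\min}\le f\le f_{\max}$ and $f$ $L$-Lipschitz on $M$. SQ framework: a $\mathrm{STAT}(\tau)$ oracle for $D$ answers each measurable query $r:\mathbb{R}^n\to[-1,1]$ with an arbitrary adversarial real $a$ with $|a-\mathbb{E}_D[r]|\le\tau$; a deterministic SQ algorithm chooses its queries adaptively as functions of previous answers and outputs a function of all answers. *)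

(* Defs.v *)
From HB Require Import structures.
From mathcomp Require Import all_boot all_order all_algebra.
From mathcomp Require Import all_classical all_reals all_analysis.
Set Implicit Arguments. Unset Strict Implicit. Unset Printing Implicit Defensive.
Import Order.TTheory GRing.Theory Num.Theory.
Import numFieldNormedType.Exports.
Local Open Scope classical_set_scope.
Local Open Scope ring_scope.

Section Defs.
Variable R : realType.

Definition enorm (n : nat) (v : 'rV[R]_n) : R := Num.sqrt (\sum_i v ord0 i ^+ 2).

Definition eucl_dist (n : nat) (z : 'rV[R]_n) (K : set 'rV[R]_n) : R :=
  inf [set enorm (p - z) | p in K].

Definition medial_axis (n : nat) (K : set 'rV[R]_n) : set 'rV[R]_n :=
  [set z | exists p q, [/\ K p, K q, p <> q,
      enorm (p - z) = eucl_dist z K & enorm (q - z) = eucl_dist z K]].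

Definition reach_ge (n : nat) (K : set 'rV[R]_n) (rho : R) : Prop :=
  forall z, medial_axis K z -> rho <= eucl_dist z K.

Definition nearest_point (n : nat) (K : set 'rV[R]_n) (z p : 'rV[R]_n) : Prop :=
  K p /\ enorm (p - z) = eucl_dist z K.

(** volume of the unit ball of R^d: omega_0 = 1, omega_1 = 2,
    omega_{d+2} = 2 pi/(d+2) omega_d. *)
Fixpoint omega (d : nat) : R :=
  match d with
  | 0 => 1
  | 1 => 2
  | (k.+1 as d').+1 => (2 * pi) / (d'.+1)%:R * omega k
  end.

Definition ebasis (d : nat) (i : 'I_d) : 'rV[R]_d := delta_mx ord0 i.

(** phi : R^d -> R^n is C^2 on the open set V (all first and second partial
    derivatives exist on V, second ones continuous on V; this gives C^2). *)
Definition C2_on (d n : nat) (V : set 'rV[R]_d) (phi : 'rV[R]_d -> 'rV[R]_n) : Prop :=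
  (forall x i, V x -> derivable phi x (ebasis i)) /\
  (forall x i j, V x -> derivable ('D_(ebasis i) phi) x (ebasis j)) /\
  (forall i j, {within V, continuous ('D_(ebasis j) ('D_(ebasis i) phi))}).

Definition jacobian (d n : nat) (phi : 'rV[R]_d -> 'rV[R]_n) (x : 'rV[R]_d)
  : 'M[R]_(d, n) := \matrix_(i < d) ('D_(ebasis i) phi x).

Definition chart (d n : nat) (M : set 'rV[R]_n) (p : 'rV[R]_n)
  (U : set 'rV[R]_n) (V : set 'rV[R]_d)
  (phi : 'rV[R]_d -> 'rV[R]_n) (psi : 'rV[R]_n -> 'rV[R]_d) : Prop :=
  [/\ open U, U p, open V & C2_on V phi] /\
  [/\ (forall x, V x -> (M `&` U) (phi x) /\ psi (phi x) = x),
      (forall y, (M `&` U) y -> V (psi y) /\ phi (psi y) = y),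
      {within M `&` U, continuous psi} &
      (forall x, V x -> row_free (jacobian phi x))].

Definition C2_submanifold (d n : nat) (M : set 'rV[R]_n) : Prop :=
  forall p, M p -> exists U V phi psi, @chart d n M p U V phi psi.

Definition tangent_space (d n : nat) (M : set 'rV[R]_n) (p : 'rV[R]_n)
  (T : 'M[R]_n) : Prop :=
  M p /\ exists U V phi psi, @chart d n M p U V phi psi /\
                             (T == jacobian phi (psi p))%MS.

Definition manifold_class (n d : nat) (rho : R) (M : set 'rV[R]_n) : Prop :=
  [/\ compact M, connected M, M !=set0, C2_submanifold d M & reach_ge M rho].

Definition orth_proj (n : nat) (T P : 'M[R]_n) : Prop :=
  P^T = P /\ P *m P = P /\ (P == T)%MS.

Definition opnorm (n : nat) (A : 'M[R]_n) : R :=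
  sup [set enorm (v *m A) | v in [set v : 'rV[R]_n | enorm v <= 1]].

Definition bounded_by (n : nat) (C : set 'rV[R]_n) (r : R) : Prop :=
  forall x y, C x -> C y -> enorm (x - y) <= r.

Definition diam (n : nat) (C : set 'rV[R]_n) : R :=
  sup [set enorm (x - y) | x in C & y in C].

Definition hausdorff_delta (d n : nat) (delta : R) (A : set 'rV[R]_n) : \bar R :=
  ereal_inf [set s | exists Cs : nat -> set 'rV[R]_n,
     [/\ A `<=` \bigcup_i Cs i,
         (forall i, exists2 r, r < delta & bounded_by (Cs i) r) &
         s = (\sum_(0 <= i <oo) (omega d * (diam (Cs i) / 2) ^+ d)%:E)%E]].

Definition hausdorff (d n : nat) (A : set 'rV[R]_n) : \bar R :=
  ereal_sup [set hausdorff_delta d delta A | delta in [set delta : R | 0 < delta]].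

End Defs.

Definition BorelRn (R : realType) (n : nat) := g_sigma_algebraType (@open 'rV[R]_n).

Section Model.
Variable R : realType.
Local Open Scope ereal_scope.

Definition model (n d : nat) (rchmin fmin fmax L : R)
  (D : probability (BorelRn R n) R) (M : set 'rV[R]_n)
  (mu : {measure set (BorelRn R n) -> \bar R}) (f : 'rV[R]_n -> R) : Prop :=
  [/\ @manifold_class R n d rchmin M,
      (forall A : set (BorelRn R n), measurable A -> mu A = hausdorff d A) &
      measurable_fun (M : set (BorelRn R n)) (f : BorelRn R n -> R)] /\
  [/\ (forall A : set (BorelRn R n), measurable A ->
          D A = \int[mu]_(x in A `&` M) (f x)%:E),
      (forall x, M x -> (fmin <= f x <= fmax)%R) &
      (forall x y, M x -> M y -> (`|f x - f y| <= L * enorm (x - y))%R)].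

(** Deterministic adaptive SQ algorithm making nq queries: the i-th query is
    chosen from the previous answers, output is a function of all answers. *)
Record SQalg (n : nat) := { nq : nat;
  query : seq R -> BorelRn R n -> R;
  output : seq R -> 'M[R]_n }.

Definition SQvalid (n : nat) (A : SQalg n) : Prop :=
  forall h, measurable_fun setT (query A h) /\
            forall x, (-1 <= query A h x <= 1)%R.

Definition STAT_transcript (n : nat) (D : probability (BorelRn R n) R) (tau : R)
  (A : SQalg n) (a : seq R) : Prop :=
  size a = nq A /\ forall i, (i < nq A)%N ->
    ((nth 0%R a i - tau)%:E <= \int[D]_x (query A (take i a) x)%:E
       <= (nth 0%R a i + tau)%:E).
End Model.

(* Main.v *)
Require Import Defs.
From HB Require Import structures.
From mathcomp Require Import all_boot all_order all_algebra.
From mathcomp Require Import all_classical all_reals all_analysis.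
From mathcomp Require Import measurable_realfun.
From mathcomp Require Import ring lra.
Set Implicit Arguments. Unset Strict Implicit. Unset Printing Implicit Defensive.
Import Order.TTheory GRing.Theory Num.Theory.
Import numFieldNormedType.Exports.
Local Open Scope classical_set_scope.
Local Open Scope ring_scope.

(**
  Put h = rho * delta, where delta is the maximum in the claimed bound.  In the
  ball B(x0, h) the support is within O(h delta) of the affine tangent space at
  p, so the local second moment matrix of D is, up to an error
  O(delta) f_max h^d, a matrix of rank d supported on the tangent space, and
  its smallest eigenvalue there is of order f_min h^d because the projection of
  M to the tangent space covers a ball of radius of order h.  A matrix of rank
  d is determined by m ~ n d log n random-looking linear measurements (restricted
  isometry); to learn this vector of R^m with the same accuracy tau in Euclidean
  norm, and not merely coordinatewise, every vector of the unit ball is expanded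
  in a Kashin frame of size ~ m log m with coefficients O(1 / m log m), and the
  coefficients are the expectations that are queried.  Any rank d solution that
  is consistent with the answers has, by a Davis-Kahan argument, its range close
  to the tangent space.  If delta is not small the bound exceeds 2 and is trivial.

  The frame and the measurements are built without probability, by choosing
  signs greedily against an exponential potential, and Hausdorff measures of
  pieces of M are compared by Lipschitz maps with that of the unit ball of R^d,
  whose Hausdorff measure only has to be known up to a factor c^d.
*)

(** The two terms of delta are two balances: the offset of x0 from M contributes eta / h to the
    angle, against h / rho from curvature, and a query error tau is weighed against a local mass of
    order omega_d f_max h^d. With h = rho * delta both ratios are at most delta.

    The algorithm is fixed before D and M, so it may use only x0, the parameters and [kap], the
    Hausdorff measure of the unit ball of R^d. The number [kap] enters the upper bound on the local
    mass and the lower bound on the eigenvalues, and cancels in their ratio; only tau is measured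
    against omega_d, through omega_d <= kap E^d. That [kap] is finite is read off from the model.

    The moment matrix about x0 may have full rank, so restricted isometry says nothing about it as a
    whole; it is handled as a nonnegative combination of rank-one matrices. Points are rounded to a
    finite net of cells: queries become step functions, expectations finite sums, and Kashin
    coefficients have to be chosen for finitely many vectors only. The queries are nonadaptive. *)

Definition dot (R : realType) n (u v : 'rV[R]_n) : R := \sum_i u ord0 i * v ord0 i.

(** * Euclidean inner product, norm and topology of row vectors *)

Section Euclid.
Variable R : realType.
Implicit Types n : nat.

Lemma dotC n (u v : 'rV[R]_n) : dot u v = dot v u.
Proof. by apply: eq_bigr => i _; rewrite mulrC. Qed.

Lemma dotDl n (u v w : 'rV[R]_n) : dot (u + v) w = dot u w + dot v w.
Proof. by rewrite /dot -big_split; apply: eq_bigr => i _; rewrite mxE mulrDl. Qed.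

Lemma dotZl n (a : R) (u v : 'rV[R]_n) : dot (a *: u) v = a * dot u v.
Proof. by rewrite /dot mulr_sumr; apply: eq_bigr => i _; rewrite mxE mulrA. Qed.

Lemma dotDr n (u v w : 'rV[R]_n) : dot w (u + v) = dot w u + dot w v.
Proof. by rewrite dotC dotDl !(dotC w). Qed.

Lemma dotZr n (a : R) (u v : 'rV[R]_n) : dot u (a *: v) = a * dot u v.
Proof. by rewrite dotC dotZl dotC. Qed.

Lemma dotNl n (u v : 'rV[R]_n) : dot (- u) v = - dot u v.
Proof. by rewrite -scaleN1r dotZl mulN1r. Qed.

Lemma dotNr n (u v : 'rV[R]_n) : dot u (- v) = - dot u v.
Proof. by rewrite dotC dotNl dotC. Qed.

Lemma dotBl n (u v w : 'rV[R]_n) : dot (u - v) w = dot u w - dot v w.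
Proof. by rewrite dotDl dotNl. Qed.

Lemma dotBr n (u v w : 'rV[R]_n) : dot w (u - v) = dot w u - dot w v.
Proof. by rewrite dotDr dotNr. Qed.

Lemma dot0l n (u : 'rV[R]_n) : dot 0 u = 0.
Proof. by rewrite -(scale0r u) dotZl mul0r. Qed.

Lemma dot0r n (u : 'rV[R]_n) : dot u 0 = 0.
Proof. by rewrite dotC dot0l. Qed.

Lemma dot_suml n (I : Type) (r : seq I) (P : pred I) (F : I -> 'rV[R]_n) v :
  dot (\sum_(i <- r | P i) F i) v = \sum_(i <- r | P i) dot (F i) v.
Proof.
elim/big_rec2: _ => [|i a b _ <-]; first by rewrite dot0l.
by rewrite dotDl.
Qed.

Lemma dotE n (u v : 'rV[R]_n) : dot u v = (u *m v^T) ord0 ord0.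
Proof. by rewrite mxE; apply: eq_bigr => i _; rewrite mxE. Qed.

Lemma dot_mull n m (u : 'rV[R]_n) (A : 'M[R]_(n, m)) (v : 'rV[R]_m) :
  dot (u *m A) v = dot u (v *m A^T).
Proof. by rewrite !dotE trmx_mul trmxK mulmxA. Qed.

Lemma dot_delta n (i : 'I_n) (v : 'rV[R]_n) : dot (delta_mx ord0 i) v = v ord0 i.
Proof.
rewrite /dot (bigD1 i)//= mxE !eqxx mul1r big1 ?addr0// => j ji.
by rewrite mxE (negbTE ji) andbF mul0r.
Qed.

Lemma enorm_ge0 n (u : 'rV[R]_n) : 0 <= enorm u.
Proof. exact: sqrtr_ge0. Qed.

Lemma dotvv_ge0 n (u : 'rV[R]_n) : 0 <= dot u u.
Proof. by apply: sumr_ge0 => i _; rewrite -expr2 sqr_ge0. Qed.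

Lemma enormE n (u : 'rV[R]_n) : enorm u = Num.sqrt (dot u u).
Proof. by congr Num.sqrt; apply: eq_bigr => i _; rewrite expr2. Qed.

Lemma enorm_sq n (u : 'rV[R]_n) : enorm u ^+ 2 = dot u u.
Proof. by rewrite enormE sqr_sqrtr// dotvv_ge0. Qed.

Lemma enorm_sum_sq n (u : 'rV[R]_n) : enorm u ^+ 2 = \sum_i u ord0 i ^+ 2.
Proof. by rewrite enorm_sq; apply: eq_bigr => i _; rewrite expr2. Qed.

Lemma enorm_le n (u : 'rV[R]_n) (c : R) : 0 <= c -> dot u u <= c ^+ 2 -> enorm u <= c.
Proof.
by move=> c0 h; rewrite -(ler_pXn2r (n := 2))// ?nnegrE ?enorm_ge0// enorm_sq.
Qed.

Lemma enorm_coord n (u : 'rV[R]_n) i : `|u ord0 i| <= enorm u.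
Proof.
rewrite -(ler_pXn2r (n := 2))// ?nnegrE ?enorm_ge0// enorm_sum_sq real_normK ?num_real//.
by rewrite (bigD1 i)//= lerDl sumr_ge0// => j _; rewrite sqr_ge0.
Qed.

Lemma enorm_eq0 n (u : 'rV[R]_n) : enorm u = 0 -> u = 0.
Proof.
move=> h; apply/rowP => i; rewrite mxE; apply/eqP.
by rewrite -normr_le0 -h enorm_coord.
Qed.

Lemma enorm0 n : enorm (0 : 'rV[R]_n) = 0.
Proof. by rewrite enormE dot0l sqrtr0. Qed.

Lemma enorm_gt0 n (u : 'rV[R]_n) : u != 0 -> 0 < enorm u.
Proof.
move=> u0; rewrite lt_def enorm_ge0 andbT; apply: contra u0 => /eqP h.
by apply/eqP/enorm_eq0.
Qed.

Lemma enormZ n (a : R) (u : 'rV[R]_n) : enorm (a *: u) = `|a| * enorm u.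
Proof.
by rewrite !enormE dotZl dotZr mulrA -expr2 sqrtrM ?sqr_ge0// sqrtr_sqr.
Qed.

Lemma enormN n (u : 'rV[R]_n) : enorm (- u) = enorm u.
Proof. by rewrite -scaleN1r enormZ normrN1 mul1r. Qed.

Lemma enormBC n (u v : 'rV[R]_n) : enorm (u - v) = enorm (v - u).
Proof. by rewrite -enormN opprB. Qed.

Lemma dot_sqB n (u v : 'rV[R]_n) : dot (u - v) (u - v) = dot u u - 2 * dot u v + dot v v.
Proof. by rewrite dotBl !dotBr (dotC v u); ring. Qed.

Lemma dot_sqD n (u v : 'rV[R]_n) : dot (u + v) (u + v) = dot u u + 2 * dot u v + dot v v.
Proof. by rewrite dotDl !dotDr (dotC v u); ring. Qed.

Lemma dot_le n (u v : 'rV[R]_n) : dot u v <= enorm u * enorm v.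
Proof.
have [->|u0] := eqVneq u 0; first by rewrite dot0l enorm0 mul0r.
have [->|v0] := eqVneq v 0; first by rewrite dot0r enorm0 mulr0.
have nu := enorm_gt0 u0; have nv := enorm_gt0 v0.
have := dotvv_ge0 (enorm v *: u - enorm u *: v).
rewrite dot_sqB !(dotZl, dotZr) -!enorm_sq.
have -> : enorm v * (enorm v * enorm u ^+ 2) - 2 * (enorm v * (enorm u * dot u v)) +
  enorm u * (enorm u * enorm v ^+ 2) =
  2 * (enorm u * enorm v) * (enorm u * enorm v - dot u v) by ring.
by rewrite pmulr_rge0 ?subr_ge0// !mulr_gt0.
Qed.

Lemma dot_norm_le n (u v : 'rV[R]_n) : `|dot u v| <= enorm u * enorm v.
Proof.
by rewrite ler_norml dot_le andbT lerNl -dotNl -(enormN u) dot_le.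
Qed.

Lemma enormD n (u v : 'rV[R]_n) : enorm (u + v) <= enorm u + enorm v.
Proof.
apply: enorm_le; first by rewrite addr_ge0 ?enorm_ge0.
rewrite dot_sqD -!enorm_sq sqrrD mulr2n; have := dot_le u v; lra.
Qed.

Lemma enormB n (u v : 'rV[R]_n) : enorm (u - v) <= enorm u + enorm v.
Proof. by rewrite (le_trans (enormD _ _))// enormN. Qed.

Lemma enorm_triB n (u v w : 'rV[R]_n) : enorm (u - w) <= enorm (u - v) + enorm (v - w).
Proof. by rewrite (le_trans _ (enormD _ _))// addrA subrK. Qed.

Lemma enormB_ge n (u v : 'rV[R]_n) : enorm u - enorm v <= enorm (u - v).
Proof. by rewrite lerBlDr (le_trans _ (enormD _ _))// subrK. Qed.

Lemma enorm_bigsum n (I : Type) (r : seq I) (P : pred I) (F : I -> 'rV[R]_n) :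
  enorm (\sum_(i <- r | P i) F i) <= \sum_(i <- r | P i) enorm (F i).
Proof.
elim/big_rec2: _ => [|i a b _ h]; first by rewrite enorm0.
by rewrite (le_trans (enormD _ _))// lerD2l.
Qed.

Lemma enorm_mxnorm n (u : 'rV[R]_n) : `|u| <= enorm u.
Proof.
rewrite [`|u|]mx_normrE bigmax_le// ?enorm_ge0// => -[i j] _ /=.
by rewrite (ord1 i) enorm_coord.
Qed.

Lemma mxnorm_coord n (u : 'rV[R]_n) i : `|u ord0 i| <= `|u|.
Proof.
rewrite [X in _ <= X]mx_normrE.
exact: (le_bigmax _ (fun ij : 'I_1 * 'I_n => `|u ij.1 ij.2|) (ord0, i)).
Qed.

Lemma enorm_le_mxnorm n (u : 'rV[R]_n) : enorm u <= n%:R * `|u|.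
Proof.
case: n u => [|n] u.
  by rewrite enormE /dot big_ord0 sqrtr0 mul0r.
apply: enorm_le; first by rewrite mulr_ge0.
apply: (@le_trans _ _ (\sum_(i < n.+1) `|u| ^+ 2)).
  apply: ler_sum => i _; rewrite -expr2 -real_normK ?num_real//.
  by rewrite ler_pXn2r ?nnegrE ?normr_ge0// mxnorm_coord.
rewrite sumr_const card_ord -[leLHS]mulr_natl exprMn; apply: ler_wpM2r; first by rewrite sqr_ge0.
by rewrite -natrX ler_nat expnS expn1 leq_pmulr.
Qed.

Lemma enorm_Lip n (u v : 'rV[R]_n) : `|enorm u - enorm v| <= enorm (u - v).
Proof.
by rewrite ler_norml enormB_ge andbT lerNl opprB enormBC enormB_ge.
Qed.

Lemma nbhs_enormP n (x : 'rV[R]_n) (A : set 'rV[R]_n) :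
  nbhs x A <-> exists2 e : R, 0 < e & forall y, enorm (x - y) < e -> A y.
Proof.
split.
  move=> /nbhs_normP[e /= e0 h]; exists e => // y xy; apply: h => /=.
  exact: le_lt_trans (enorm_mxnorm _) xy.
move=> [e e0 h]; apply/(@nbhs_normP _ 'rV[R]_n); exists (e / n.+1%:R) => /=; first by rewrite divr_gt0.
move=> y /= xy; apply: h; apply: le_lt_trans (enorm_le_mxnorm _) _.
rewrite (@le_lt_trans _ _ (n.+1%:R * `|x - y|))//; last by rewrite mulrC -ltr_pdivlMr.
by rewrite ler_wpM2r// ler_nat.
Qed.

Lemma enorm_lip_continuous n (T : 'rV[R]_n -> R) (k : R) :
  (forall x y, `|T x - T y| <= k * enorm (x - y)) -> continuous T.
Proof.
move=> h x; apply/(@cvgrPdist_lt _ _ _ _ (nbhs_filter x)) => e e0.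
have k0 : 0 < `|k| + 1 by rewrite ltr_wpDl.
apply/nbhs_enormP; exists (e / (`|k| + 1)); first by rewrite divr_gt0.
move=> y; rewrite ltr_pdivlMr// => xy; apply: le_lt_trans (h _ _) _.
apply: le_lt_trans xy; rewrite mulrC ler_wpM2l ?enorm_ge0//.
by rewrite (le_trans (ler_norm _))// lerDl.
Qed.

Lemma enormB_continuous n (x0 : 'rV[R]_n) : continuous (fun x : 'rV[R]_n => enorm (x - x0)).
Proof.
apply: (@enorm_lip_continuous _ _ 1) => x y; rewrite mul1r.
by rewrite (le_trans (enorm_Lip _ _))// opprB addrA subrK.
Qed.

Lemma dot_continuous n (w x0 : 'rV[R]_n) : continuous (fun x : 'rV[R]_n => dot w (x - x0)).
Proof.
apply: (@enorm_lip_continuous _ _ (enorm w)) => x y.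
by rewrite -dotBr opprB addrA subrK dot_norm_le.
Qed.

Lemma closed_eball n (x0 : 'rV[R]_n) r : closed [set x | enorm (x - x0) <= r].
Proof. by apply: closed_comp (@closed_le _ r) => x _; exact: enormB_continuous. Qed.

Lemma compact_eball n (x0 : 'rV[R]_n) r : compact [set x | enorm (x - x0) <= r].
Proof.
apply: bounded_closed_compact; last exact: closed_eball.
exists (`|x0| + r); split; first exact: num_real.
move=> M hM x /= xr; apply: ltW; apply: le_lt_trans hM.
rewrite -[x in `|x|](subrK x0) addrC (le_trans (ler_normD _ _))// lerD2l.
exact: le_trans (enorm_mxnorm _) _.
Qed.

Lemma open_eball n (x0 : 'rV[R]_n) r : open [set x | enorm (x - x0) < r].
Proof. by apply: open_comp (@open_lt _ r) => x _; exact: enormB_continuous. Qed.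

End Euclid.

(** * Orthogonal projections and perturbation of ranges *)

Section OrthProj.
Variable R : realType.
Implicit Types n : nat.

Lemma orth_proj_sub n (T P : 'M[R]_n) m (A : 'M[R]_(m, n)) :
  orth_proj T P -> (A <= T)%MS -> A *m P = A.
Proof.
move=> [_ [PP /andP[_ TP]]] AT.
have /submxP[X ->] := submx_trans AT TP.
by rewrite -mulmxA PP.
Qed.

Lemma orth_proj_uniq n (T P Q : 'M[R]_n) : orth_proj T P -> orth_proj T Q -> P = Q.
Proof.
move=> hP hQ; have [sP [PP /andP[PT _]]] := hP; have [sQ [QQ /andP[QT _]]] := hQ.
have e1 : P *m Q = P by apply: orth_proj_sub hQ PT.
have e2 : Q *m P = Q by apply: orth_proj_sub hP QT.
by rewrite -e1 -[LHS]trmxK trmx_mul sP sQ e2 sQ.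
Qed.

Lemma orth_proj_dot n (T P : 'M[R]_n) (u v : 'rV[R]_n) :
  orth_proj T P -> dot (u *m P) v = dot u (v *m P).
Proof. by move=> [sP _]; rewrite dot_mull sP. Qed.

Lemma orth_proj_idem n (T P : 'M[R]_n) (u : 'rV[R]_n) :
  orth_proj T P -> u *m P *m P = u *m P.
Proof. by move=> [_ [PP _]]; rewrite -mulmxA PP. Qed.

Lemma orth_proj_le n (T P : 'M[R]_n) (u : 'rV[R]_n) :
  orth_proj T P -> enorm (u *m P) <= enorm u.
Proof.
move=> hP; have [->|u0] := eqVneq (u *m P) 0; first by rewrite enorm0 enorm_ge0.
rewrite -(ler_pM2l (enorm_gt0 u0)) -expr2 enorm_sq.
by rewrite (orth_proj_dot _ _ hP) (orth_proj_idem _ hP) dotC dot_le.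
Qed.

Lemma orth_compl_dot n (T P : 'M[R]_n) (u v : 'rV[R]_n) :
  orth_proj T P -> dot (u - u *m P) v = dot u (v - v *m P).
Proof. by move=> hP; rewrite dotBl dotBr (orth_proj_dot _ _ hP). Qed.

Lemma orth_compl_proj n (T P : 'M[R]_n) (u : 'rV[R]_n) :
  orth_proj T P -> (u - u *m P) *m P = 0.
Proof. by move=> hP; rewrite mulmxBl (orth_proj_idem _ hP) subrr. Qed.

Lemma orth_compl_sq n (T P : 'M[R]_n) (u : 'rV[R]_n) :
  orth_proj T P -> dot u (u - u *m P) = enorm (u - u *m P) ^+ 2.
Proof.
move=> hP; rewrite enorm_sq (orth_compl_dot u _ hP).
by rewrite (orth_compl_proj u hP) subr0.
Qed.

Lemma pythagoras n (T P : 'M[R]_n) (u : 'rV[R]_n) :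
  orth_proj T P -> enorm u ^+ 2 = enorm (u *m P) ^+ 2 + enorm (u - u *m P) ^+ 2.
Proof.
move=> hP; rewrite -(orth_compl_sq u hP) !enorm_sq.
by rewrite (orth_proj_dot _ _ hP) (orth_proj_idem _ hP) dotBr addrC subrK.
Qed.

Lemma orth_compl_le n (T P : 'M[R]_n) (u : 'rV[R]_n) :
  orth_proj T P -> enorm (u - u *m P) <= enorm u.
Proof.
move=> hP; apply: enorm_le; first exact: enorm_ge0.
by rewrite (pythagoras u hP) -enorm_sq lerDr sqr_ge0.
Qed.


Lemma gram_schmidt n m (A : 'M[R]_(m, n)) : row_free A ->
  exists U : 'M[R]_(m, n), U *m U^T = 1%:M /\ (U :=: A)%MS.
Proof.
elim: m A => [|m IH] A fA.
  by exists A; split => //; rewrite flatmx0 [RHS]flatmx0.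
have [a [B eA]] : exists (a : 'rV[R]_n) (B : 'M[R]_(m, n)), A = col_mx a B.
  by exists (usubmx (A : 'M[R]_(1 + m, n))), (dsubmx (A : 'M[R]_(1 + m, n))); rewrite vsubmxK.
rewrite {A}eA in fA *.
have rab : \rank (col_mx a B) = m.+1 by apply/eqP.
have fB : row_free B.
  rewrite /row_free eqn_leq rank_leq_row /= -ltnS -rab -addsmxE.
  by rewrite (leq_trans (mxrank_adds_leqif _ _))// -[X in (_ <= X)%N]add1n leq_add2r rank_leq_row.
have aB : ~~ (a <= B)%MS.
  apply/negP => aB; move: rab; rewrite -addsmxE (addsmx_idPr aB) => rB.
  by have := rank_leq_row B; rewrite rB ltnn.
have [U [UU eU]] := IH _ fB.
set v := a - a *m U^T *m U.
have v0 : v != 0.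
  apply: contra aB; rewrite subr_eq0 => /eqP ->.
  by rewrite -eU submxMl.
have nv := enorm_gt0 v0.
have vU : v *m U^T = 0 by rewrite mulmxBl -(mulmxA _ U) UU mulmx1 subrr.
pose u := (enorm v)^-1 *: v.
have uu : u *m u^T = 1%:M.
  apply/matrixP => i j; rewrite !ord1 -dotE dotZl dotZr -enorm_sq.
  by rewrite mxE mulrA -expr2 -exprMn mulVf ?expr1n// gt_eqF.
have uU : u *m U^T = 0 by rewrite -scalemxAl vU scaler0.
exists (col_mx u U); split.
  have -> : (col_mx u U)^T = row_mx u^T U^T := tr_col_mx u U.
  have -> := mul_col_row u U u^T U^T.
  rewrite uu uU UU -[U *m u^T]trmxK trmx_mul trmxK uU trmx0.
  exact/esym/(scalar_mx_block 1 m 1).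
apply: eqmx_trans (eqmx_sym (addsmxE u U)) (eqmx_trans _ (addsmxE a B)).
apply/eqmxP/andP; split.
  rewrite addsmx_sub scalemx_sub/=; last first.
    rewrite addmx_sub ?addsmxSl// eqmx_opp (submx_trans (submxMl _ _))//.
    by rewrite eU addsmxSr.
  by rewrite eU addsmxSr.
rewrite addsmx_sub; apply/andP; split; last by rewrite -eU addsmxSr.
have -> : a = enorm v *: u + a *m U^T *m U.
  by rewrite scalerA mulfV ?gt_eqF// scale1r subrK.
apply: addmx_sub; first exact: scalemx_sub (addsmxSl _ _).
exact: submx_trans (submxMl _ _) (addsmxSr _ _).
Qed.

Lemma orthobasis n m (A : 'M[R]_(m, n)) :
  exists U : 'M[R]_(\rank A, n), U *m U^T = 1%:M /\ (U :=: A)%MS.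
Proof.
have [U [UU eU]] := gram_schmidt (row_base_free A).
by exists U; split => //; apply: eqmx_trans eU (eq_row_base A).
Qed.

Lemma orthobasis_proj n m (U : 'M[R]_(m, n)) (T : 'M[R]_n) :
  U *m U^T = 1%:M -> (U :=: T)%MS -> orth_proj T (U^T *m U).
Proof.
move=> UU eU; split; first by rewrite trmx_mul trmxK.
split; first by rewrite mulmxA -(mulmxA U^T) UU mulmx1.
apply/andP; split; first by rewrite -eU submxMl.
by rewrite -eU -{1}[U]mul1mx -UU -mulmxA submxMl.
Qed.

Lemma orth_proj_exists n (T : 'M[R]_n) : exists P, orth_proj T P.
Proof.
by have [U [UU eU]] := orthobasis T; exists (U^T *m U); apply: orthobasis_proj.
Qed.

Lemma orthobasis_norm n m (U : 'M[R]_(m, n)) (u : 'rV[R]_m) :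
  U *m U^T = 1%:M -> enorm (u *m U) = enorm u.
Proof. by move=> UU; rewrite !enormE dot_mull -mulmxA UU mulmx1. Qed.

Lemma opnorm_le n (A : 'M[R]_n) c :
  (forall v : 'rV[R]_n, enorm v <= 1 -> enorm (v *m A) <= c) -> opnorm A <= c.
Proof.
move=> h; apply: ge_sup; first by exists (enorm (0 *m A)), 0; rewrite //= enorm0.
by move=> _ [v /= v1 <-]; apply: h.
Qed.

Lemma proj_diff_le n (S T P Q : 'M[R]_n) e : 0 <= e -> orth_proj S P -> orth_proj T Q ->
  (forall u : 'rV[R]_n, enorm (u *m P - u *m P *m Q) <= e * enorm u) ->
  (forall u : 'rV[R]_n, enorm (u *m Q - u *m Q *m P) <= e * enorm u) ->
  opnorm (P - Q) <= 2 * e.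
Proof.
move=> e0 hP hQ h h'; apply: opnorm_le => v v1.
have -> : v *m (P - Q) = (v *m P - v *m P *m Q) - (v - v *m P) *m Q.
  by rewrite mulmxBl mulmxBr opprB addrA subrK.
rewrite (le_trans (enormB _ _))// mulr2n mulrDl mul1r lerD//.
  by rewrite (le_trans (h _))// ler_piMr.
(* Duality: z is fixed by Q, so its squared norm is [dot (v - v *m P) z = dot v (z - z *m P)], and
   the second hypothesis applies to z. *)
set z := (v - v *m P) *m Q.
have [->|z0] := eqVneq z 0; first by rewrite enorm0.
have nz := enorm_gt0 z0.
have zQ : z *m Q = z by rewrite (orth_proj_idem _ hQ).
rewrite -(ler_pM2r nz) -expr2 enorm_sq {1}/z (orth_proj_dot _ _ hQ) zQ.
rewrite (orth_compl_dot _ _ hP).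
rewrite (le_trans (dot_le _ _))//.
rewrite (le_trans (ler_wpM2r (enorm_ge0 _) v1))// mul1r.
by rewrite -{1 2}zQ h'.
Qed.

(* Two matrices that are close and bounded below on the ranges of their projections have close ranges. *)
Lemma davis_kahan n (P Q X Y : 'M[R]_n) (S T : 'M[R]_n) (lam e : R) :
  0 < lam -> 0 <= e -> orth_proj S P -> orth_proj T Q -> P *m X = X -> Q *m Y = Y ->
  (forall u, lam * enorm (u *m P) <= enorm (u *m P *m X)) ->
  (forall u : 'rV[R]_n, enorm (u *m (X - Y)) <= e * enorm u) ->
  forall u : 'rV[R]_n, enorm (u *m P - u *m P *m Q) <= e / lam * enorm u.
Proof.
move=> lam0 e0 hP hQ PX QY low close u; set z := u *m P - _.
have [->|z0] := eqVneq z 0.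
  by rewrite enorm0 mulr_ge0 ?enorm_ge0// divr_ge0// ltW.
have nz := enorm_gt0 z0.
have zQ : z *m Q = 0 by rewrite (orth_compl_proj _ hQ).
have zP : enorm (z *m P) <= e / lam * enorm z.
  rewrite mulrAC ler_pdivlMr// mulrC (le_trans (low z))//.
  rewrite -mulmxA PX; have -> : z *m X = z *m (X - Y) by rewrite mulmxBr -QY (mulmxA z) zQ mul0mx subr0.
  exact: close.
rewrite -(ler_pM2r nz) -expr2 -(orth_compl_sq (u *m P) hQ) -/z.
rewrite (orth_proj_dot _ _ hP) (le_trans (dot_le _ _))//.
by rewrite [leRHS]mulrAC mulrC ler_wpM2r// enorm_ge0.
Qed.

End OrthProj.

(** * Sign matrices, restricted isometry and Kashin frames *)

Section Signs.
Variable R : realType.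

(** The sharp exponent is x^2 / 2; with 2 x^2 the bound needs only 1 + x <= e^x: for x <= 1/2 it
    gives (p + q)(1 - x^2) <= 2, and 1 / (1 - x^2) <= 1 + 2 x^2. Beyond 1/2, x <= 2 x^2. *)
Lemma cosh_le (x : R) : expR x + expR (- x) <= 2 * expR (2 * x ^+ 2).
Proof.
wlog x0 : x / 0 <= x => [hw|].
  have [/hw//|/ltW x0] := leP 0 x.
  by have := hw (- x); rewrite opprK sqrrN addrC; apply; rewrite oppr_ge0.
have [x1|x1] := leP x (1/2); last first.
  have h1 : expR x <= expR (2 * x ^+ 2) by rewrite ler_expR; nra.
  have h2 : expR (- x) <= expR (2 * x ^+ 2) by rewrite ler_expR; nra.
  lra.
have a1 := expR_ge1Dx x; have a2 := expR_ge1Dx (- x).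
have a3 := expR_ge1Dx (2 * x ^+ 2).
have e : expR x * expR (- x) = 1 by rewrite -expRD subrr expR0.
set p := expR x in a1 e *; set q := expR (- x) in a2 e *.
have p2 : p * (1 - x) <= 1 by nra.
have q2 : q * (1 + x) <= 1 by nra.
have hp : (p + q) * (1 - x ^+ 2) <= 2 by nra.
nra.
Qed.

(** Averaging over one sign: the cross term 2 L a y is handled by [cosh_le] at a cost 8 L^2 a^2 y^2,
    which is at most y^2 a^2 / 32 as |L| <= 1/16. The coefficient of a^2 thus grows by y^2 / 32, and
    L y^2 is absorbed by c y^2. *)
Lemma cosh_sq_le (L c Y a y : R) : -1/16 <= L -> L <= 1/16 -> L <= c ->
  expR (c * Y + L * (a + y) ^+ 2) + expR (c * Y + L * (a - y) ^+ 2) <=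
  2 * expR (c * (Y + y ^+ 2) + (L + y ^+ 2 / 32) * a ^+ 2).
Proof.
move=> L1 L2 Lc; pose x := 2 * L * a * y.
have -> : c * Y + L * (a + y) ^+ 2 = (c * Y + L * a ^+ 2 + L * y ^+ 2) + x by rewrite /x; ring.
have -> : c * Y + L * (a - y) ^+ 2 = (c * Y + L * a ^+ 2 + L * y ^+ 2) + - x by rewrite /x; ring.
rewrite (expRD _ x) (expRD _ (- x)) -mulrDr.
apply: (le_trans (ler_wpM2l (expR_ge0 _) (cosh_le x))).
rewrite mulrCA -expRD ler_pM2l// ler_expR /x.
have LL : L ^+ 2 <= 1/256 by nra.
have h1 : L * y ^+ 2 <= c * y ^+ 2 by rewrite ler_wpM2r ?sqr_ge0.
have h2 : L ^+ 2 * (a ^+ 2 * y ^+ 2) <= 1/256 * (a ^+ 2 * y ^+ 2).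
  by apply: ler_wpM2r => //; apply: mulr_ge0; exact: sqr_ge0.
rewrite [2 * (2 * _ * _ * _) ^+ 2](_ : _ = 8 * (L ^+ 2 * (a ^+ 2 * y ^+ 2))); last by ring.
by lra.
Qed.

(** Method of conditional expectations: the right side averages out the undecided coordinates, so
    one of the two values of the next sign does not increase it. Negative [lam] penalises small
    sums, positive [lam] large ones; [c] dominates every coefficient met on the way. *)
Lemma signs_greedy (T : finType) k (y : T -> 'I_k -> R) (w lam c a : T -> R) :
  (forall t, 0 <= w t) ->
  (forall t, [/\ -1/16 <= lam t, lam t + (\sum_i y t i ^+ 2) / 32 <= 1/16 &
                 lam t + (\sum_i y t i ^+ 2) / 32 <= c t]) ->
  exists s : 'I_k -> R, (forall i, s i = 1 \/ s i = -1) /\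
   \sum_t w t * expR (lam t * (a t + \sum_i s i * y t i) ^+ 2) <=
   \sum_t w t * expR (c t * (\sum_i y t i ^+ 2) + (lam t + (\sum_i y t i ^+ 2) / 32) * a t ^+ 2).
Proof.
move=> w0; elim: k y a => [|k IH] y a h.
  exists (fun=> 1); split; first by left.
  by apply: ler_sum => t _; rewrite !big_ord0 addr0 mulr0 mul0r addr0 add0r.
pose y' t (i : 'I_k) := y t (lift ord0 i).
have eY t : \sum_i y t i ^+ 2 = \sum_i y' t i ^+ 2 + y t ord0 ^+ 2.
  by rewrite big_ord_recl addrC.
have Y0 t : 0 <= y t ord0 ^+ 2 by rewrite sqr_ge0.
have Y1 t : 0 <= \sum_i y' t i ^+ 2 by apply: sumr_ge0 => i _; rewrite sqr_ge0.
have h' t : [/\ -1/16 <= lam t, lam t + (\sum_i y' t i ^+ 2) / 32 <= 1/16 &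
                 lam t + (\sum_i y' t i ^+ 2) / 32 <= c t].
  by have [h1 h2 h3] := h t; have := Y0 t; move: h2 h3; rewrite eY => h2 h3 ?; split; lra.
pose B e := \sum_t w t * expR (c t * (\sum_i y' t i ^+ 2) +
   (lam t + (\sum_i y' t i ^+ 2) / 32) * (a t + e * y t ord0) ^+ 2).
pose RHS := \sum_t w t * expR (c t * (\sum_i y t i ^+ 2) +
  (lam t + (\sum_i y t i ^+ 2) / 32) * a t ^+ 2).
have hB : B 1 + B (-1) <= 2 * RHS.
  rewrite /B -big_split /= /RHS mulr_sumr; apply: ler_sum => t _.
  rewrite -mulrDr [leRHS]mulrCA; apply: ler_wpM2l => //; rewrite mul1r mulN1r eY.
  have [h1 h2 h3] := h' t; have := Y1 t => Y1t.
  rewrite [lam t + (_ + _) / 32](_ : _ = lam t + (\sum_i y' t i ^+ 2) / 32 + y t ord0 ^+ 2 / 32); last by ring.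
  by apply: cosh_sq_le => //; lra.
have [e [he Be]] : exists e : R, (e = 1 \/ e = -1) /\ B e <= RHS.
  have [h1|h1] := leP (B 1) RHS; first by exists 1; split; [left|].
  by exists (-1); split; [right|lra].
have [s [hs Hs]] := IH y' (fun t => a t + e * y t ord0) h'.
exists (fun i => if unlift ord0 i is Some j then s j else e); split.
  by move=> i; case: unliftP => [j _|_].
apply: le_trans Be; apply: le_trans Hs; apply: ler_sum => t _.
rewrite big_ord_recl unlift_none addrA.
by under eq_bigr do rewrite liftK.
Qed.

(* 1 - e^{-t^2/16} is at most |t|, and e^{-u} <= 1 - u/2 for u in [0,1]: the potential (1 + e^{-t^2/16})/2 controls lower tails of the sum of |t|. *)
Lemma potential_ge (t : R) : expR (- `|t|) <= (1 + expR (-1/16 * t ^+ 2)) / 2.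
Proof.
pose u := 1 - expR (-1/16 * t ^+ 2).
have u0 : 0 <= u by rewrite subr_ge0 -[leRHS]expR0 ler_expR; have := sqr_ge0 t; lra.
have u1 : u <= 1 by rewrite gerBl expR_ge0.
have ut : u <= `|t|.
  have [h|h] := leP 1 `|t|; first lra.
  have := expR_ge1Dx (-1/16 * t ^+ 2); rewrite /u.
  have := normr_ge0 t; have : t ^+ 2 = `|t| ^+ 2 by rewrite real_normK ?num_real.
  nra.
have -> : (1 + expR (-1/16 * t ^+ 2)) / 2 = 1 - u / 2 by rewrite /u; field.
apply: (@le_trans _ _ (expR (- u))); first by rewrite ler_expR; lra.
have a1 := expR_ge1Dx u; have e : expR u * expR (- u) = 1 by rewrite -expRD subrr expR0.
have p0 := expR_ge0 (- u).
nra.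
Qed.

(** The exponent -1/128 is -1/32 * |y|^2 at the smallest allowed value |y|^2 = 1/4. Of the decay
    e^(-2 c0) of one averaged row, half is spent on the factor [expR c0] in [G] and half remains. *)
Let q1 : R := (1 + expR (-1/128)) / 2.
Let c0 : R := - ln q1 / 2.

Let q1_gt0 : 0 < q1. Proof. by rewrite divr_gt0// addr_gt0// expR_gt0. Qed.

Let q1_lt1 : q1 < 1.
Proof.
have : expR (-1/128) < 1 :> R by rewrite -[ltRHS]expR0 ltr_expR; lra.
by rewrite /q1; lra.
Qed.

Let c0_gt0 : 0 < c0.
Proof. by rewrite divr_gt0// oppr_gt0 ln_lt0// q1_gt0. Qed.

Let q1E : q1 = expR (- (2 * c0)).
Proof.
rewrite /c0 [2 * _]mulrC divfK// opprK lnK// posrE; exact: q1_gt0.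
Qed.

(** Potentials of one row: by [potential_ge], a product of [G] over the rows that is at most 1
    forces the sum of |<s, y>| to be large; a product of [H] that is at most 1 forces the sum of <s,
    y>^2 to be small. *)
Let G k (y s : 'I_k -> R) : R :=
  expR c0 * ((1 + expR (-1/16 * (\sum_i s i * y i) ^+ 2)) / 2).
Let H k (y s : 'I_k -> R) : R :=
  expR (- (1/16 + c0)) * expR (1/32 * (\sum_i s i * y i) ^+ 2).

Let signs_row (T : finType) k (y : T -> 'I_k -> R) (u v : T -> R) :
  (forall t, 0 <= u t) -> (forall t, 0 <= v t) ->
  (forall t, 1/4 <= \sum_i y t i ^+ 2 <= 1) ->
  exists s : 'I_k -> R, (forall i, s i = 1 \/ s i = -1) /\
    \sum_t (u t * G (y t) s + v t * H (y t) s) <= expR (- c0) * \sum_t (u t + v t).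
Proof.
move=> u0 v0 hy.
pose y2 (bt : bool * T) := y bt.2.
pose w2 (bt : bool * T) : R := if bt.1 then expR c0 * u bt.2 / 2 else expR (- (1/16 + c0)) * v bt.2.
(* The Boolean index merges both tails into one greedy run. The coefficients fit since -1/16 + 1/32
   = -1/32 and 1/32 + 1/32 = 1/16. *)
pose lam2 (bt : bool * T) : R := if bt.1 then -1/16 else 1/32.
pose c2 (bt : bool * T) : R := if bt.1 then -1/32 else 1/16.
have [||s [hs Hs]] := @signs_greedy _ k y2 w2 lam2 c2 (fun=> 0).
- by move=> [[] t]; rewrite /w2/= ?mulr_ge0 ?expR_ge0 ?invr_ge0.
- move=> [[] t]; rewrite /lam2 /c2 /y2 /=; have /andP[h1 h2] := hy t; split; lra.
exists s; split => //.
have split2 (F : bool * T -> R) : \sum_p F p = \sum_t (F (true, t) + F (false, t)).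
  rewrite (eq_bigr (fun p => F (p.1, p.2))); last by move=> [].
  by rewrite -(pair_bigA _ (fun b t => F (b, t))) /= big_bool /= -big_split.
move: Hs; rewrite !split2 /w2 /lam2 /c2 /y2 /= => Hs.
have -> : \sum_t (u t * G (y t) s + v t * H (y t) s) =
  \sum_t (expR c0 * u t / 2) +
  \sum_t (expR c0 * u t / 2 * expR (-1/16 * (0 + \sum_i s i * y t i) ^+ 2) +
          expR (- (1/16 + c0)) * v t * expR (1/32 * (0 + \sum_i s i * y t i) ^+ 2)).
  rewrite -big_split; apply: eq_bigr => t _; by rewrite /G /H add0r /=; field.
apply: (le_trans (lerD (lexx _) Hs)).
rewrite -big_split mulr_sumr; apply: ler_sum => t _ /=.
have /andP[h1 h2] := hy t.
rewrite expr0n/= !mulr0 !addr0 mulrDr addrA lerD//.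
  rewrite [leRHS](_ : _ = u t * (expR c0 * q1)); last first.
    by rewrite mulrC q1E -expRD; congr (_ * expR _); ring.
  have : expR (-1/32 * \sum_i y t i ^+ 2) <= expR (-1/128) by rewrite ler_expR; lra.
  have : 0 <= expR c0 * u t by rewrite mulr_ge0 ?expR_ge0.
  rewrite /q1; set e := expR (_ * _); set e' := expR (-1/128); move=> ? ?.
  have : expR c0 * u t * e <= expR c0 * u t * e' by rewrite ler_wpM2l.
  lra.
rewrite mulrAC ler_wpM2r// -expRD ler_expR.
have : 1/16 * \sum_i y t i ^+ 2 <= 1/16 by lra.
lra.
Qed.

Let signs_rows (T : finType) k m (y : T -> 'I_k -> R) (u v : T -> R) :
  (forall t, 0 <= u t) -> (forall t, 0 <= v t) ->
  (forall t, 1/4 <= \sum_i y t i ^+ 2 <= 1) ->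
  exists S : 'I_m -> 'I_k -> R, (forall j i, S j i = 1 \/ S j i = -1) /\
    \sum_t (u t * \prod_j G (y t) (S j) + v t * \prod_j H (y t) (S j)) <=
     expR (- (c0 * m%:R)) * \sum_t (u t + v t).
Proof.
move=> + + hy; elim: m u v => [|m IH] u v u0 v0.
  exists (fun _ _ => 1); split; first by left.
  rewrite mulr0 oppr0 expR0 mul1r; apply: ler_sum => t _.
  by rewrite !big_ord0 !mulr1.
have [s [hs Hs]] := signs_row u0 v0 hy.
have G0 t s' : 0 <= G (y t) s' by rewrite mulr_ge0 ?expR_ge0// divr_ge0// addr_ge0// expR_ge0.
have H0 t s' : 0 <= H (y t) s' by rewrite mulr_ge0 ?expR_ge0.
have [|| S [hS HS]] := IH (fun t => u t * G (y t) s) (fun t => v t * H (y t) s).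
- by move=> t; rewrite mulr_ge0.
- by move=> t; rewrite mulr_ge0.
exists (fun j => if unlift ord0 j is Some j' then S j' else s); split.
  by move=> j; case: unliftP.
apply: le_trans (le_trans HS _).
  apply: ler_sum => t _; rewrite !big_ord_recl unlift_none (mulrA (u t)) (mulrA (v t)).
  by rewrite le_eqVlt; apply/orP; left; apply/eqP; congr (_ * _ + _ * _); apply: eq_bigr => i _; rewrite liftK.
apply: (le_trans (ler_wpM2l (expR_ge0 _) Hs)).
by rewrite mulrA -expRD -natr1 mulrDr mulr1 opprD.
Qed.

(** A union bound without probability: the total potential starts at 2 #|T| and shrinks by e^(-c0)
    per row, so it ends at most 1. Each product is then at most 1, and logarithms give both
    bounds. *)
Lemma sign_matrix : exists2 e0 : R, 0 < e0 &
  forall (T : finType) k m (y : T -> 'rV[R]_k),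
  (forall t, 1/4 <= enorm (y t) ^+ 2 <= 1) -> 2 * #|T|%:R <= expR (e0 * m%:R) ->
  exists S : 'I_m -> 'rV[R]_k, (forall j i, S j ord0 i = 1 \/ S j ord0 i = -1) /\
    forall t, e0 * m%:R <= \sum_j `|dot (S j) (y t)| /\
      \sum_j dot (S j) (y t) ^+ 2 <= (2 + 32 * e0) * m%:R.
Proof.
exists c0 => // T k m y hy hT.
have [||| S [hS HS]] := @signs_rows T k m (fun t i => y t ord0 i) (fun=> 1) (fun=> 1) => //.
  by move=> t; rewrite -enorm_sum_sq.
exists (fun j => \row_i S j i); split; first by move=> j i; rewrite mxE.
have tot : \sum_t (1 * \prod_j G (fun i => y t ord0 i) (S j) + 1 * \prod_j H (fun i => y t ord0 i) (S j)) <= 1.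
  apply: le_trans HS _; rewrite expRN sumr_const ler_pdivrMl ?expR_gt0// mulr1.
  by rewrite -[leLHS]mulr_natr.
move=> t.
have dE j : dot (\row_i S j i) (y t) = \sum_i S j i * y t ord0 i.
  by apply: eq_bigr => i _; rewrite mxE.
have G0 t' j : 0 <= G (fun i => y t' ord0 i) (S j).
  by rewrite mulr_ge0 ?expR_ge0// divr_ge0// addr_ge0// expR_ge0.
have H0 t' j : 0 <= H (fun i => y t' ord0 i) (S j) by rewrite mulr_ge0 ?expR_ge0.
have pG t' : 0 <= \prod_j G (fun i => y t' ord0 i) (S j) by apply: prodr_ge0.
have pH t' : 0 <= \prod_j H (fun i => y t' ord0 i) (S j) by apply: prodr_ge0.
have {tot} : \prod_j G (fun i => y t ord0 i) (S j) + \prod_j H (fun i => y t ord0 i) (S j) <= 1.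
  apply: le_trans tot; rewrite (bigD1 t)//= !mul1r lerDl sumr_ge0// => t' _.
  by rewrite !mul1r addr_ge0.
move=> tot; split.
  have : expR (\sum_j (c0 - `|dot (\row_i S j i) (y t)|)) <= 1.
    have := pH t => pHt; apply: (@le_trans _ _ (\prod_j G (fun i => y t ord0 i) (S j))); last lra.
    rewrite expR_sum; apply: ler_prod => j _; rewrite expR_ge0/= expRD.
    by rewrite ler_wpM2l ?expR_ge0// dE potential_ge.
  rewrite -[leRHS]expR0 ler_expR big_split /= sumr_const card_ord sumrN -mulr_natr.
  lra.
have : expR (\sum_j (- (1/16 + c0) + 1/32 * dot (\row_i S j i) (y t) ^+ 2)) <= 1.
  have := pG t => pGt; apply: (@le_trans _ _ (\prod_j H (fun i => y t ord0 i) (S j))); last lra.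
  rewrite expR_sum; apply: ler_prod => j _; rewrite expR_ge0/= expRD.
  by rewrite ler_wpM2l ?expR_ge0// dE.
rewrite -[leRHS]expR0 ler_expR big_split /= sumr_const card_ord -mulr_sumr -mulr_natr.
lra.
Qed.
End Signs.

(** * Grid nets and frames of sign vectors *)

Section Nets.
Variable R : realType.

Lemma enorm_le_sum n (u : 'rV[R]_n) : enorm u <= \sum_i `|u ord0 i|.
Proof.
rewrite {1}[u]row_sum_delta (le_trans (enorm_bigsum _ _ _))//; apply: ler_sum => i _.
by rewrite enormZ enormE dot_delta mxE !eqxx sqrtr1 mulr1.
Qed.

Lemma natr_le_exp2 l : ((2 ^ l)%N%:R : R) <= expR l%:R.
Proof.
elim: l => [|l IH]; first by rewrite expR0.
have -> : l.+1%:R = 1 + l%:R :> R by rewrite -natr1 addrC.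
rewrite expnS natrM expRD ler_pM//.
by have := expR_ge1Dx (1 : R); lra.
Qed.

(* Perturbing a net: a vector y of norm 3/4 is replaced by a net point of norm in [1/2,1], which changes each <s,y> by at most k |y-t|. *)
Lemma net_signs : exists e1 C0 : R, [/\ 0 < e1, 0 < C0 &
  forall (T : finType) k m (f : T -> 'rV[R]_k) (Y : set 'rV[R]_k),
  (forall y, Y y -> enorm y = 3/4 /\
     exists t, enorm (y - f t) <= 1/4 /\ k%:R * enorm (y - f t) <= e1) ->
  2 * #|T|%:R <= expR (e1 * m%:R) ->
  exists S : 'I_m -> 'rV[R]_k, (forall j i, S j ord0 i = 1 \/ S j ord0 i = -1) /\
    forall y, Y y -> e1 * m%:R <= \sum_j `|dot (S j) y| /\
      \sum_j dot (S j) y ^+ 2 <= C0 * m%:R].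
Proof.
have [e0 e0_gt0 H] := sign_matrix R.
exists (e0 / 2), (2 * (2 + 32 * e0) + 2 * (e0 / 2) ^+ 2); split; first by rewrite divr_gt0.
  by have := sqr_ge0 (e0 / 2); lra.
move=> T k m f Y hY hT.
(* Net points outside this shell are discarded; one within 1/4 of a vector of norm 3/4 has norm in
   [1/2, 1] and survives. *)
pose P t := 1/4 <= enorm (f t) ^+ 2 <= 1.
have [||S [hS HS]] := H {t : T | P t} k m (fun t => f (val t)).
- by move=> [t].
- apply: le_trans (le_trans hT _); last by rewrite ler_expR ler_wpM2r//; lra.
  by rewrite ler_wpM2l// ler_nat card_sig max_card.
exists S; split => // y /hY[ny [t [t1 t2]]].
have Pt : P t.
  have a1 := enormB_ge y (f t); have a2 := enormB_ge (f t) y; rewrite enormBC in a2.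
  have a3 := enorm_ge0 (f t); rewrite /P; apply/andP; split; nra.
have [L U] := HS (exist _ t Pt); rewrite /= in L U.
have d j : `|dot (S j) y - dot (S j) (f t)| <= e0 / 2.
  rewrite -dotBr (le_trans _ t2)// (le_trans (dot_norm_le _ _))//.
  rewrite ler_wpM2r ?enorm_ge0//; apply: enorm_le => //.
  rewrite [X in X <= _](_ : _ = k%:R); last first.
    rewrite -enorm_sq enorm_sum_sq (eq_bigr (fun=> 1)) ?sumr_const ?card_ord//.
    by move=> i _; case: (hS j i) => ->; rewrite ?sqrrN expr1n.
  by case: (k) => [|k']; rewrite ?expr0n// expr2 ler_peMl// ler1n.
split.
  apply: (@le_trans _ _ (\sum_j (`|dot (S j) (f t)| - e0 / 2))).
    by rewrite sumrB sumr_const card_ord -mulr_natr; lra.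
  apply: ler_sum => j _.
  have := lerB_dist (dot (S j) (f t)) (dot (S j) y).
  by rewrite distrC; have := d j; lra.
apply: (@le_trans _ _ (\sum_j (2 * dot (S j) (f t) ^+ 2 + 2 * (e0 / 2) ^+ 2))).
  apply: ler_sum => j _; have := d j.
  set a := dot _ y; set b := dot _ (f t); rewrite ler_norml => /andP[h1 h2].
  have : (a - b) ^+ 2 <= (e0 / 2) ^+ 2 by nra.
  have := sqr_ge0 (a - 2 * b); nra.
rewrite big_split /= sumr_const card_ord -mulr_sumr -mulr_natr; lra.
Qed.

Definition gridv (I : finType) q (g : {ffun I -> 'I_(2 * q).+1}) (i : I) : R :=
  ((g i : nat)%:R - q%:R) / q%:R.

Lemma gridv_norm (I : finType) q (g : {ffun I -> 'I_(2 * q).+1}) i : `|gridv g i| <= 1.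
Proof.
rewrite /gridv; case: q g => [|q] g; first by rewrite invr0 mulr0 normr0.
have q0 : 0 < q.+1%:R :> R by [].
rewrite normrM normfV [X in _ / X]ger0_norm// ler_pdivrMr// mul1r.
have := ltn_ord (g i); rewrite ltnS => h.
have : (g i : nat)%:R <= 2 * q.+1%:R :> R by rewrite -natrM ler_nat.
by rewrite ler_norml => ?; apply/andP; split; [have := ler0n R (g i); lra|lra].
Qed.

Lemma grid_approx (I : finType) q (y : I -> R) : (0 < q)%N -> (forall i, `|y i| <= 1) ->
  exists g : {ffun I -> 'I_(2 * q).+1}, forall i, `|y i - gridv g i| <= q%:R^-1.
Proof.
move=> q0 hy; have q0' : 0 < q%:R :> R by rewrite ltr0n.
pose z i := (y i + 1) * q%:R.
have z0 i : 0 <= z i.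
  by rewrite mulr_ge0// -lerBlDr sub0r; have := hy i; rewrite ler_norml => /andP[].
have hz i : (Num.truncn (z i) < (2 * q).+1)%N.
  rewrite ltnS -(ler_nat R) (le_trans (proj1 (andP (truncn_itv (z0 i)))))//.
  rewrite natrM ler_wpM2r//; have := hy i; rewrite ler_norml => /andP[_ ?]; lra.
exists [ffun i => Ordinal (hz i)] => i; rewrite /gridv ffunE /=.
have /andP[h1 h2] := truncn_itv (z0 i).
rewrite -natr1 in h2.
have -> : y i - ((Num.truncn (z i))%:R - q%:R) / q%:R = (z i - (Num.truncn (z i))%:R) / q%:R.
  by rewrite /z; field; rewrite gt_eqF.
rewrite normrM normfV [X in _ / X]ger0_norm ?ler_pdivrMr ?ltW// mulVf ?gt_eqF//.
by rewrite ger0_norm ?subr_ge0//; lra.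
Qed.

(** Exponent per coordinate: c l for Q, p l for m^p, and l to spare for the leading factor 2. A net
    with E coordinates and polynomial mesh thus has logarithmic size O(l E), the source of the
    logarithms in the query count. *)
Lemma grid_card Q c p m l E : (2 * Q + 1 <= 2 ^ c)%N -> (0 < m)%N -> (0 < l)%N ->
  (m <= 2 ^ l)%N -> (0 < E)%N ->
  (2 * (2 * (Q * m ^ p)).+1 ^ E <= 2 ^ ((c + p + 1) * l * E))%N.
Proof.
move=> hc m0 l0 ml E0.
have h1 : ((2 * (Q * m ^ p)).+1 <= 2 ^ ((c + p) * l))%N.
  apply: (@leq_trans ((2 * Q + 1) * m ^ p)).
    by rewrite mulnDl mul1n mulnA -addn1 leq_add2l expn_gt0 m0.
  rewrite (mulnDl c) expnD leq_mul//; first by rewrite (leq_trans hc)// leq_exp2l// leq_pmulr.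
  rewrite mulnC expnM; case: (p) => [//|p']; by rewrite leq_exp2r.
apply: (@leq_trans (2 * (2 ^ ((c + p) * l)) ^ E)); first by rewrite leq_mul2l /= leq_exp2r.
rewrite -expnM (_ : (c + p + 1) * l * E = l * E + (c + p) * l * E)%N; last by ring.
rewrite expnD leq_mul2r; apply/orP; right.
by rewrite -{1}[2%N]expn1 leq_exp2l// muln_gt0 l0.
Qed.

(** With mesh 1 / (Q m^2) the Euclidean error is at most m / q; [net_signs] multiplies it by the
    dimension m, which leaves 1 / Q <= e1. By homogeneity norm 3/4 suffices, and 16/9 is
    (3/4)^-2. *)
Lemma frame_exists : exists (e1 C0 : R) (K : nat), [/\ 0 < e1, 0 < C0, (0 < K)%N &
  forall m l, (0 < m)%N -> (0 < l)%N -> (m <= 2 ^ l)%N ->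
  exists S : 'I_(K * m * l) -> 'rV[R]_m, (forall j i, S j ord0 i = 1 \/ S j ord0 i = -1) /\
    forall y, e1 * (K * m * l)%:R * enorm y <= \sum_j `|dot (S j) y| /\
      \sum_j dot (S j) y ^+ 2 <= C0 * (K * m * l)%:R * enorm y ^+ 2].
Proof.
have [e1 [C0 [e10 C00 H]]] := net_signs.
have [Q0 hQ0] : exists Q0, e1^-1 <= Q0%:R :> R.
  by exists (Num.truncn e1^-1).+1; rewrite ltW// truncnS_gt// invr_ge0 ltW.
pose Q := (Q0 + 4)%N.
have [c hc] : exists c, (2 * Q + 1 <= 2 ^ c)%N.
  by exists (2 * Q + 1)%N; rewrite ltnW// ltn_expl.
have [K hK] : exists K, e1^-1 * (c + 3)%:R <= K%:R :> R.
  by exists (Num.truncn (e1^-1 * (c + 3)%:R)).+1; rewrite ltW// truncnS_gt// mulr_ge0// invr_ge0 ltW.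
exists e1, (16 / 9 * C0), K.+1; split => //; first by rewrite mulr_gt0.
move=> m l m0 l0 ml; set N := (K.+1 * m * l)%N.
pose q := (Q * m ^ 2)%N.
have q0 : (0 < q)%N by rewrite muln_gt0 /Q addnS expn_gt0 m0.
have q0' : 0 < q%:R :> R by rewrite ltr0n.
pose T := {ffun 'I_m -> 'I_(2 * q).+1}.
pose f (g : T) : 'rV[R]_m := \row_i gridv g i.
have [||S [hS HS]] := H T m N f [set y | enorm y = 3/4].
- move=> y /= ny; split => //.
  have [i|g hg] := @grid_approx _ q (fun i => y ord0 i) q0.
    by rewrite (le_trans (enorm_coord _ _))// ny; lra.
  exists g.
  have b : enorm (y - f g) <= m%:R / q%:R.
    rewrite (le_trans (enorm_le_sum _))// (le_trans (ler_sum _ (fun i _ => _ : _ <= q%:R^-1)))//.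
      by move=> i _; rewrite !mxE hg.
    by rewrite sumr_const card_ord mulr_natl.
  have m1 : 1 <= m%:R :> R by rewrite ler1n.
  have qE : q%:R = (Q0%:R + 4) * m%:R ^+ 2 :> R by rewrite natrM natrX natrD.
  have Q00 : 0 <= Q0%:R :> R by [].
  split.
    rewrite (le_trans b)// ler_pdivrMr// qE; nra.
  rewrite (le_trans (ler_wpM2l _ b))// mulrA ler_pdivrMr// qE.
  have : 1 <= e1 * (Q0%:R + 4).
    rewrite -ler_pdivrMl// mulr1; lra.
  set a := e1 * _; rewrite mulrA -/a -expr2 => a1; rewrite ler_peMl// sqr_ge0.
- rewrite card_ffun !card_ord.
  apply: (@le_trans _ _ ((2 ^ ((c + 2 + 1) * l * m))%N%:R)).
    by rewrite -natrM ler_nat; exact: grid_card.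
  rewrite (le_trans (natr_le_exp2 _))// ler_expR.
  rewrite -ler_pdivrMl// /N !natrM !mulrA -addnA.
  rewrite [_ * l%:R * m%:R]mulrAC !ler_wpM2r//.
  by rewrite (le_trans hK)// ler_nat.
exists S; split => // y.
have [->|y0] := eqVneq y 0.
  by rewrite enorm0 expr0n !mulr0; split; [apply: sumr_ge0 => *|
    rewrite big1// => j _; rewrite dot0r expr0n].
have ny := enorm_gt0 y0.
pose a := 3/4 / enorm y; have a0 : 0 < a by rewrite divr_gt0.
have := HS (a *: y); case; first by rewrite /= enormZ gtr0_norm// divfK ?gt_eqF.
have ea : a * enorm y = 3/4 by rewrite divfK ?gt_eqF.
under eq_bigr do rewrite dotZr normrM gtr0_norm//.
under [X in _ -> X <= _ -> _]eq_bigr do rewrite dotZr exprMn.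
rewrite -!mulr_sumr => h1 h2; split.
  rewrite -(ler_pM2l a0) (le_trans _ h1)// mulrCA ea.
  have : 0 <= e1 * N%:R by rewrite mulr_ge0// ltW.
  by lra.
rewrite -(ler_pM2l (exprn_gt0 2 a0)) (le_trans h2)// mulrCA -exprMn ea.
by have : 0 <= C0 * N%:R by [rewrite mulr_ge0// ltW]; lra.
Qed.
End Nets.

(** * Frobenius norm and restricted isometry on low-rank matrices *)

Definition fnorm (R : realType) n (A : 'M[R]_n) : R := enorm (mxvec A).

Section Rip.
Variable R : realType.

Lemma sum_mxvec n (F : 'I_(n * n) -> R) :
  \sum_k F k = \sum_i \sum_j F (mxvec_index i j).
Proof.
rewrite pair_bigA /= (reindex (uncurry (@mxvec_index n n))) /=; last first.
  exact: curry_mxvec_bij.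
by apply: eq_bigr => -[i j].
Qed.

Lemma fnorm_sq n (A : 'M[R]_n) : fnorm A ^+ 2 = \sum_i \sum_j A i j ^+ 2.
Proof.
rewrite /fnorm enorm_sum_sq sum_mxvec.
by apply: eq_bigr => i _; apply: eq_bigr => j _; rewrite mxvecE.
Qed.

Lemma fnorm_rows n (A : 'M[R]_n) : fnorm A ^+ 2 = \sum_i enorm (row i A) ^+ 2.
Proof.
rewrite fnorm_sq; apply: eq_bigr => i _; rewrite enorm_sum_sq.
by apply: eq_bigr => j _; rewrite mxE.
Qed.

Lemma fnorm_ge0 n (A : 'M[R]_n) : 0 <= fnorm A. Proof. exact: enorm_ge0. Qed.

Lemma row_le_fnorm n (A : 'M[R]_n) i : enorm (row i A) <= fnorm A.
Proof.
rewrite -(ler_pXn2r (n := 2))// ?nnegrE ?enorm_ge0 ?fnorm_ge0// fnorm_rows.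
by rewrite (bigD1 i)//= lerDl sumr_ge0// => j _; rewrite sqr_ge0.
Qed.

Lemma fnorm_mulr n (u : 'rV[R]_n) (A : 'M[R]_n) : enorm (u *m A) <= fnorm A * enorm u.
Proof.
have [->|nz] := eqVneq (u *m A) 0.
  by rewrite enorm0 mulr_ge0 ?fnorm_ge0 ?enorm_ge0.
have gz := enorm_gt0 nz.
pose a : 'rV[R]_n := \row_i enorm (row i A).
have ea : enorm a = fnorm A.
  apply/eqP; rewrite -(eqrXn2 (n := 2))// ?enorm_ge0 ?fnorm_ge0// fnorm_rows enorm_sum_sq.
  by apply/eqP/eq_bigr => i _; rewrite mxE.
pose b : 'rV[R]_n := \row_i `|u ord0 i|.
have eb : enorm b = enorm u.
  apply/eqP; rewrite -(eqrXn2 (n := 2))// ?enorm_ge0// !enorm_sum_sq.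
  by apply/eqP/eq_bigr => i _; rewrite mxE real_normK ?num_real.
rewrite -ea -eb (le_trans _ (dot_le _ _))//.
rewrite mulmx_sum_row (le_trans (enorm_bigsum _ _ _))//.
by apply: ler_sum => i _; rewrite enormZ !mxE mulrC.
Qed.

Lemma mulmx_trE n m p (A : 'M[R]_(n, m)) (B : 'M[R]_(p, m)) i j :
  (A *m B^T) i j = dot (row i A) (row j B).
Proof. by rewrite mxE; apply: eq_bigr => l _; rewrite !mxE. Qed.

Lemma mul_pid_bound n m r k (A : 'M[R]_(n, m)) c : 0 <= c -> (forall i j, `|A i j| <= c) ->
  forall i j, `|(A *m (pid_mx k : 'M[R]_(m, r))) i j| <= c.
Proof.
move=> c0 hA i j; rewrite mxE.
have [jm|jm] := ltnP j m; last first.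
  rewrite big1 ?normr0// => l _; rewrite mxE.
  by rewrite (_ : (l == j :> nat) = false) ?mulr0// ltn_eqF// (leq_trans (ltn_ord l)).
rewrite (bigD1 (Ordinal jm))//= big1 => [|l lj]; last first.
  rewrite mxE; have -> : (l == j :> nat) = false by apply: contraNF lj => /eqP e; apply/eqP/val_inj.
  by rewrite mulr0.
rewrite addr0 mxE normrM (le_trans _ (hA i (Ordinal jm)))// ler_piMr//.
by case: (_ && _); rewrite ?normr1 ?normr0.
Qed.

(** The two factors have 2 n r entries instead of n^2, which keeps a net of low-rank matrices small,
    and the entry bounds let grids approximate them. U is an orthonormal basis of the row space,
    padded by [pid_mx] up to r rows. *)
Lemma low_rank_factor n r (X : 'M[R]_n) : (\rank X <= r)%N ->
  exists (B : 'M[R]_(n, r)) (U : 'M[R]_(r, n)), [/\ X = B *m U,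
    (forall i j, `|B i j| <= fnorm X) & (forall i j, `|U i j| <= 1)].
Proof.
move=> rX; have [U [UU eU]] := orthobasis X.
have hP := orthobasis_proj UU eU.
have eX : X = X *m U^T *m U by rewrite -mulmxA (orth_proj_sub hP).
have rU j : enorm (row j U) = 1.
  by rewrite rowE orthobasis_norm// enormE dot_delta mxE !eqxx sqrtr1.
exists (X *m U^T *m pid_mx (\rank X)), (pid_mx (\rank X) *m U); split.
- rewrite mulmxA -(mulmxA (X *m U^T)) mul_pid_mx minnn (minn_idPr rX) pid_mx_1 mulmx1.
  exact: eX.
- apply: mul_pid_bound => [|i j]; first exact: fnorm_ge0.
  rewrite mulmx_trE (le_trans (dot_norm_le _ _))// rU mulr1; exact: row_le_fnorm.
- move=> i j; rewrite -[U]trmxK -[pid_mx _]trmxK -trmx_mul mxE tr_pid_mx.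
  apply: mul_pid_bound => // i' j'; rewrite mxE.
  have := enorm_coord (row j' U) i'; by rewrite rU mxE.
Qed.

(** An entrywise error 1 / q in the factors becomes a matrix error 4 n^3 / q, which [net_signs]
    multiplies by the dimension n^2; hence the mesh of order n^-5. The lower bound of [net_signs] is
    in l1; Cauchy-Schwarz against the all-ones vector makes it l2 and squares e1. *)
Lemma rip_exists : exists (e1 C0 : R) (K : nat), [/\ 0 < e1, 0 < C0, (0 < K)%N &
  forall n r l, (0 < n)%N -> (0 < r)%N -> (r <= 2 * n)%N -> (0 < l)%N -> (n <= 2 ^ l)%N ->
  exists S : 'I_(K * (n * r) * l) -> 'rV[R]_(n * n),
    forall X : 'M[R]_n, (\rank X <= r)%N ->
      e1 * (K * (n * r) * l)%:R * fnorm X ^+ 2 <= \sum_j dot (S j) (mxvec X) ^+ 2 /\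
      \sum_j dot (S j) (mxvec X) ^+ 2 <= C0 * (K * (n * r) * l)%:R * fnorm X ^+ 2].
Proof.
have [e1 [C0 [e10 C00 H]]] := net_signs R.
have [Q0 hQ0] : exists Q0, e1^-1 <= Q0%:R :> R.
  by exists (Num.truncn e1^-1).+1; rewrite ltW// truncnS_gt// invr_ge0 ltW.
pose Q := (4 * (Q0 + 4))%N.
have [c hc] : exists c, (2 * Q + 1 <= 2 ^ c)%N.
  by exists (2 * Q + 1)%N; rewrite ltnW// ltn_expl.
have [K hK] : exists K, e1^-1 * ((c + 5 + 1) * 2)%:R <= K%:R :> R.
  by exists (Num.truncn (e1^-1 * ((c + 5 + 1) * 2)%:R)).+1; rewrite ltW// truncnS_gt// mulr_ge0// invr_ge0 ltW.
exists (16/9 * e1 ^+ 2), (16 / 9 * C0), K.+1; split => //; first by rewrite mulr_gt0// exprn_gt0.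
  by rewrite mulr_gt0.
move=> n r l n0 r0 rn l0 nl; set N := (K.+1 * (n * r) * l)%N.
pose q := (Q * n ^ 5)%N.
have q0 : (0 < q)%N by rewrite muln_gt0 /Q !addnS expn_gt0 n0.
have q0' : 0 < q%:R :> R by rewrite ltr0n.
pose T1 := {ffun 'I_n * 'I_r -> 'I_(2 * q).+1}.
pose T2 := {ffun 'I_r * 'I_n -> 'I_(2 * q).+1}.
pose f (g : T1 * T2) : 'rV[R]_(n * n) :=
  mxvec ((\matrix_(i < n, j < r) gridv R g.1 (i, j)) *m (\matrix_(i < r, j < n) gridv R g.2 (i, j))).
have n1 : 1 <= n%:R :> R by rewrite ler1n.
have [||S [_ HS]] := H (T1 * T2)%type (n * n)%N N f
    [set y | exists2 X : 'M[R]_n, (\rank X <= r)%N & y = mxvec X /\ fnorm X = 3/4].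
- move=> _ [X rX [-> nX]]; split; first exact: nX.
  have [B [U [eX hB hU]]] := low_rank_factor rX.
  have [ij|g1 hg1] := @grid_approx _ _ q (fun ij : 'I_n * 'I_r => B ij.1 ij.2) q0.
    by rewrite (le_trans (hB _ _))// nX; lra.
  have [ij|g2 hg2] := @grid_approx _ _ q (fun ij : 'I_r * 'I_n => U ij.1 ij.2) q0.
    exact: hU.
  exists (g1, g2).
  have b : enorm (mxvec X - f (g1, g2)) <= 4 * n%:R ^+ 3 / q%:R.
    rewrite -linearB (le_trans (enorm_le_sum _))// sum_mxvec.
    apply: (@le_trans _ _ (\sum_(i < n) \sum_(j < n) (r%:R * (2 / q%:R)))).
      apply: ler_sum => i _; apply: ler_sum => j _; rewrite mxvecE eX !mxE -sumrB.
      rewrite (le_trans (ler_norm_sum _ _ _))//.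
      apply: (@le_trans _ _ (\sum_(k < r) (2 / q%:R))); last first.
        by rewrite sumr_const card_ord [leRHS]mulr_natl.
      apply: ler_sum => k _; rewrite !mxE.
      have h1 := hg1 (i, k); have h2 := hg2 (k, j); rewrite /= in h1 h2.
      rewrite (_ : _ - _ = (B i k - gridv R g1 (i, k)) * U k j + gridv R g1 (i, k) * (U k j - gridv R g2 (k, j))); last by ring.
      rewrite (le_trans (ler_normD _ _))// (normrM (B i k - _)) (normrM (gridv R g1 _)).
      have -> : 2 / q%:R = q%:R^-1 * 1 + 1 * q%:R^-1 :> R by ring.
      by apply: lerD; apply: ler_pM => //; exact: gridv_norm.
    rewrite !sumr_const !card_ord -mulrnA -[leLHS]mulr_natr natrM.
    rewrite [leLHS](_ : _ = (2 * n%:R ^+ 2 / q%:R) * r%:R); last by field; rewrite gt_eqF.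
    rewrite [leRHS](_ : _ = (2 * n%:R ^+ 2 / q%:R) * (2 * n%:R)); last by field; rewrite gt_eqF.
    by rewrite ler_wpM2l ?divr_ge0 ?mulr_ge0 ?sqr_ge0// -natrM ler_nat.
  have qE : q%:R = 4 * (Q0%:R + 4) * n%:R ^+ 5 :> R by rewrite /q /Q natrM natrX natrM natrD.
  have Q00 : 0 <= Q0%:R :> R by [].
  have n30 : 0 <= n%:R ^+ 3 :> R by rewrite exprn_ge0.
  have n53 : n%:R ^+ 3 <= n%:R ^+ 5 :> R by rewrite ler_weXn2l.
  split.
    rewrite (le_trans b)// ler_pdivrMr// qE; nra.
  rewrite (le_trans (ler_wpM2l _ b))// mulrA ler_pdivrMr// qE.
  have : 1 <= e1 * (Q0%:R + 4).
    rewrite -ler_pdivrMl// mulr1; lra.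
  set a := e1 * _ => a1.
  rewrite [leRHS](_ : _ = a * (4 * n%:R ^+ 5)); last by rewrite /a; ring.
  rewrite [leLHS](_ : _ = 4 * n%:R ^+ 5); last by rewrite natrM; ring.
  by rewrite ler_peMl// mulr_ge0// exprn_ge0.
- rewrite card_prod !card_ffun !card_prod !card_ord -expnD.
  apply: (@le_trans _ _ ((2 ^ ((c + 5 + 1) * l * (n * r + r * n)))%N%:R)).
    by rewrite -natrM ler_nat; apply: grid_card => //; rewrite addn_gt0 muln_gt0 n0 r0.
  rewrite (le_trans (natr_le_exp2 _ _))// ler_expR.
  rewrite -ler_pdivrMl// /N [(r * n)%N]mulnC addnn -mul2n.
  rewrite (_ : (c + 5 + 1) * l * (2 * (n * r)) = ((c + 5 + 1) * 2) * ((n * r) * l))%N; last by ring.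
  rewrite natrM mulrA -[(K.+1 * _ * _)%N]mulnA [leRHS]natrM ler_wpM2r//.
  by rewrite (le_trans hK)// ler_nat.
exists S => X rX.
have [->|X0] := eqVneq X 0.
  rewrite /fnorm linear0 enorm0 expr0n !mulr0; split; first by apply: sumr_ge0 => *; rewrite sqr_ge0.
  by rewrite big1// => j _; rewrite dot0r expr0n.
have nX : 0 < fnorm X by rewrite enorm_gt0// mxvec_eq0.
pose a := 3/4 / fnorm X; have a0 : 0 < a by rewrite divr_gt0.
have := HS (mxvec (a *: X)); case.
  exists (a *: X); first by rewrite mxrank_scale_nz ?gt_eqF.
  by rewrite /fnorm linearZ /= enormZ gtr0_norm// divfK ?gt_eqF.
have ea : a * fnorm X = 3/4 by rewrite divfK ?gt_eqF.
rewrite linearZ /=.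
under eq_bigr do rewrite dotZr normrM gtr0_norm//.
under [X in _ -> X <= _ -> _]eq_bigr do rewrite dotZr exprMn.
rewrite -!mulr_sumr => h1 h2; split; last first.
  rewrite -(ler_pM2l (exprn_gt0 2 a0)) (le_trans h2)// mulrCA -exprMn ea.
  by have : 0 <= C0 * N%:R by [rewrite mulr_ge0// ltW]; lra.
have N0 : 0 < N%:R :> R by rewrite ltr0n !muln_gt0 n0 r0 l0.
pose z : 'rV[R]_N := \row_j `|dot (S j) (mxvec X)|.
have ez : \sum_j `|dot (S j) (mxvec X)| = dot z (const_mx 1).
  by apply: eq_bigr => j _; rewrite !mxE mulr1.
have ez2 : \sum_j dot (S j) (mxvec X) ^+ 2 = enorm z ^+ 2.
  by rewrite enorm_sum_sq; apply: eq_bigr => j _; rewrite mxE real_normK ?num_real.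
have e1N : enorm (const_mx 1 : 'rV[R]_N) ^+ 2 = N%:R.
  by rewrite enorm_sum_sq (eq_bigr (fun=> 1)) ?sumr_const ?card_ord// => j _; rewrite mxE expr1n.
rewrite ez2 -(ler_pM2l N0) -e1N -exprMn mulrC.
have h3 : 4/3 * e1 * N%:R * fnorm X <= enorm z * enorm (const_mx 1 : 'rV[R]_N).
  apply: le_trans (dot_le _ _); rewrite -ez -(ler_pM2l a0) (le_trans _ h1)//.
  rewrite [leLHS](_ : _ = (a * fnorm X) * (4/3 * (e1 * N%:R))); last by ring.
  by rewrite ea; lra.
rewrite [enorm _ * _]mulrC in h3.
have h4 : 0 <= 4/3 * e1 * N%:R * fnorm X by rewrite !mulr_ge0// ltW.
apply: (@le_trans _ _ ((4/3 * e1 * N%:R * fnorm X) ^+ 2)).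
  by rewrite e1N; nra.
by rewrite ler_pXn2r// ?nnegrE// mulr_ge0 ?enorm_ge0.
Qed.

End Rip.

(** * Expansions with uniformly small coefficients *)

Section Kashin.
Variable R : realType.

Lemma expr_small (g e : R) : 0 <= g -> g < 1 -> 0 < e -> exists T, g ^+ T <= e.
Proof.
move=> g0 g1 e0.
have /cvgrPdist_lt/(_ e e0)[T _ /(_ T (leqnn T))] := @cvg_expr R g ltac:(by rewrite ger0_norm).
rewrite /= sub0r normrN ger0_norm ?exprn_ge0// => /ltW h; by exists T.
Qed.

(** Duality: the frame bound controls y -> (<S_j, y>)_j, hence also its adjoint. For the sum v, N
    |v|^2 is the inner product of (e_j) with (<S_j, v>), and Cauchy-Schwarz applies. *)
Lemma frame_sum_le m N (S : 'I_N -> 'rV[R]_m) (C0 t : R) (e : 'I_N -> R) : 0 <= t -> 0 < C0 ->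
  (forall y, \sum_j dot (S j) y ^+ 2 <= C0 * N%:R * enorm y ^+ 2) -> (forall j, `|e j| <= t) ->
  enorm (N%:R^-1 *: \sum_j e j *: S j) ^+ 2 <= C0 * t ^+ 2.
Proof.
move=> t0 C00 hS he; set v := N%:R^-1 *: _.
have [v0|/eqP/eqP v0] := eqVneq v 0; first by rewrite v0 enorm0 expr0n mulr_ge0 ?sqr_ge0// ltW.
have nv := enorm_gt0 v0.
have [N0|N0] := posnP N.
  have eN : N%:R^-1 = 0 :> R by rewrite N0 invr0.
  by move: v0; rewrite /v eN scale0r eqxx.
have N0' : 0 < N%:R :> R by rewrite ltr0n.
pose E : 'rV[R]_N := \row_j e j; pose Z : 'rV[R]_N := \row_j dot (S j) v.
have h1 : N%:R * enorm v ^+ 2 = dot E Z.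
  rewrite enorm_sq {1}/v dotZl mulrA mulfV ?gt_eqF// mul1r dot_suml.
  by apply: eq_bigr => j _; rewrite dotZl !mxE.
have h2 : enorm E ^+ 2 <= N%:R * t ^+ 2.
  rewrite enorm_sum_sq (le_trans (ler_sum _ (fun j _ => _ : _ <= t ^+ 2)))//.
    by move=> j _; rewrite mxE -[e j ^+ 2]real_normK ?num_real// ler_pXn2r ?nnegrE.
  by rewrite sumr_const card_ord [leRHS]mulr_natl.
have h3 : enorm Z ^+ 2 <= C0 * N%:R * enorm v ^+ 2.
  by rewrite enorm_sum_sq (eq_bigr (fun j => dot (S j) v ^+ 2))// => j _; rewrite mxE.
have h4 : (N%:R * enorm v ^+ 2) ^+ 2 <= (N%:R * t ^+ 2) * (C0 * N%:R * enorm v ^+ 2).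
  rewrite h1; apply: (@le_trans _ _ ((enorm E * enorm Z) ^+ 2)).
    by rewrite ler_pXn2r ?nnegrE ?mulr_ge0 ?enorm_ge0 ?dot_le// -h1 mulr_ge0// sqr_ge0.
  by rewrite exprMn ler_pM ?sqr_ge0.
have p : 0 < N%:R ^+ 2 * enorm v ^+ 2 by rewrite mulr_gt0 ?exprn_gt0.
rewrite -(ler_pM2l p) (_ : _ * (C0 * _) = N%:R * t ^+ 2 * (C0 * N%:R * enorm v ^+ 2)); last by ring.
by rewrite (le_trans _ h4)// le_eqVlt; apply/orP; left; apply/eqP; ring.
Qed.

(* Greedy expansion: subtracting a multiple of sum_j sgn<S_j,y> S_j shrinks the residual by a fixed factor because the l1 norm of (<S_j,y>)_j is large. *)
Lemma kashin m N (S : 'I_N -> 'rV[R]_m) (e1 C0 : R) : 0 < e1 -> 0 < C0 -> (0 < N)%N ->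
  (forall y, e1 * N%:R * enorm y <= \sum_j `|dot (S j) y| /\
      \sum_j dot (S j) y ^+ 2 <= C0 * N%:R * enorm y ^+ 2) ->
  forall y e, enorm y <= 1 -> 0 < e -> exists a : 'I_N -> R,
    (forall j, `|a j| <= 2 / e1) /\ enorm (y - N%:R^-1 *: \sum_j a j *: S j) <= e.
Proof.
move=> e10 C00 N0 hS y e y1 e0.
have N0' : 0 < N%:R :> R by rewrite ltr0n.
(* Here [b] is the relative step length and [g] the contraction factor. Enlarging C0 to C1 gives b
   e1 <= 1/2. A coefficient accumulates at most b (1 + g + g^2 + ...) = 2 / e1. *)
pose C1 := C0 + 2 * e1 ^+ 2; have e12 : 0 < e1 ^+ 2 by rewrite exprn_gt0.
have C10 : 0 < C1 by rewrite /C1; lra.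
have C01 : C0 <= C1 by rewrite /C1; lra.
pose b := e1 / C1; have b0 : 0 < b by rewrite divr_gt0.
have be : 2 * (b * e1) <= 1.
  rewrite /b mulrAC -expr2 mulrA ler_pdivrMr// /C1; lra.
have be0 : 0 < b * e1 by rewrite mulr_gt0.
have bC : b ^+ 2 * C1 = b * e1 by rewrite /b; field; rewrite gt_eqF.
pose g := 1 - b * e1 / 2.
have g0 : 0 <= g by rewrite /g; lra.
have g1 : g < 1 by rewrite /g; lra.
suff H T : exists a : 'I_N -> R, (forall j, `|a j| <= 2 / e1 * (1 - g ^+ T)) /\
    enorm (y - N%:R^-1 *: \sum_j a j *: S j) <= g ^+ T.
  have [T hT] := expr_small g0 g1 e0; have [a [ha1 ha2]] := H T.
  exists a; split; last exact: le_trans hT.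
  move=> j; rewrite (le_trans (ha1 j))//; apply: ler_piMr; first by rewrite divr_ge0// ltW.
  by rewrite lerBlDr lerDl exprn_ge0.
elim: T => [|T [a [ha hy]]].
  exists (fun=> 0); split; first by move=> j; rewrite subrr mulr0 normr0.
  by rewrite big1 => [|j _]; rewrite ?scale0r// scaler0 subr0 expr0.
set z := y - _ in hy; set r := g ^+ T in ha hy.
have r0 : 0 <= r by rewrite exprn_ge0.
have nz := enorm_ge0 z.
have br0 : 0 <= b * r := mulr_ge0 (ltW b0) r0.
pose sg j := Num.sg (dot (S j) z).
exists (fun j => a j + b * r * sg j); split.
  move=> j; rewrite (le_trans (ler_normD _ _))// (le_trans (lerD (ha j) (_ : _ <= b * r)))//.
    rewrite normrM [X in X * _](ger0_norm br0); apply: ler_piMr => //.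
    by rewrite /sg normr_sg; case: (_ != 0).
  rewrite exprS -/r le_eqVlt; apply/orP; left; apply/eqP; rewrite /g; field; rewrite gt_eqF//.
set s := N%:R^-1 *: \sum_j sg j *: S j.
have -> : y - N%:R^-1 *: \sum_j (a j + b * r * sg j) *: S j = z - (b * r) *: s.
  rewrite /z -addrA -opprD; congr (_ - _); rewrite /s [in RHS]scalerA (mulrC (b * r)) -[in RHS]scalerA -scalerDr; congr (_ *: _).
  by rewrite scaler_sumr -big_split /=; apply: eq_bigr => j _; rewrite scalerDl scalerA.
have sS : enorm s ^+ 2 <= C0.
  rewrite -[leRHS]mulr1 -(expr1n _ 2); apply: frame_sum_le => //; first by move=> v; case: (hS v).
  by move=> j; rewrite /sg normr_sg; case: (_ != 0).
have zs : e1 * enorm z <= dot z s.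
  rewrite dotC /s dotZl dot_suml ler_pdivlMl// mulrA (mulrC N%:R).
  have [h _] := hS z; rewrite (le_trans h)//; apply: ler_sum => j _.
  by rewrite dotZl /sg -normrEsg.
clearbody s; apply: enorm_le; first by rewrite exprn_ge0.
have -> : g ^+ T.+1 = g * r by rewrite exprS.
rewrite exprMn dot_sqB dotZl !dotZr -!enorm_sq.
set t := enorm z in hy nz zs *.
apply: (@le_trans _ _ (t ^+ 2 - 2 * (b * r * (e1 * t)) + b ^+ 2 * r ^+ 2 * C1)).
  apply: lerD; first by rewrite lerD2l lerN2 ler_pM2l// ler_wpM2l// mulr_ge0// ltW.
  rewrite (_ : b * r * _ = (b * r) ^+ 2 * enorm s ^+ 2); last by ring.
  rewrite (_ : b ^+ 2 * r ^+ 2 * C1 = (b * r) ^+ 2 * C1); last by ring.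
  apply: ler_wpM2l; first exact: sqr_ge0.
  exact: le_trans C01.
have -> : b ^+ 2 * r ^+ 2 * C1 = b * e1 * r ^+ 2 by rewrite mulrAC bC.
have h : t ^+ 2 - 2 * (b * r * (e1 * t)) <= r ^+ 2 * (1 - 2 * (b * e1)).
  set x := b * e1 in be be0 *.
  rewrite (_ : b * r * (e1 * t) = x * r * t); last by rewrite /x; ring.
  (* As 2 x <= 1, t^2 - 2 x r t is largest on [0, r] at t = r; the difference of the two values
     factors like this. *)
  have : 0 <= (r - t) * (r + t - 2 * x * r) by rewrite mulr_ge0//; nra.
  by nra.
apply: (le_trans (lerD h (lexx _))).
rewrite /g; set x := b * e1; have := sqr_ge0 x; have := sqr_ge0 r; nra.
Qed.

End Kashin.

(** * Sets of positive reach *)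

Section Reach.
Variable R : realType.
Variable n : nat.
Implicit Types (M : set 'rV[R]_n) (p q z w x : 'rV[R]_n).

Lemma eucl_dist_le M z p : M p -> eucl_dist z M <= enorm (p - z).
Proof.
move=> Mp; apply: ge_inf; last by exists p.
by exists 0 => _ [q _ <-]; exact: enorm_ge0.
Qed.

Lemma eucl_dist_ge M z c : M !=set0 -> (forall q, M q -> c <= enorm (q - z)) ->
  c <= eucl_dist z M.
Proof.
move=> [p Mp] h; apply: lb_le_inf; first by exists (enorm (p - z)), p.
by move=> _ [q Mq <-]; exact: h.
Qed.

Lemma nearest_exists M z : compact M -> M !=set0 -> exists p, nearest_point M z p.
Proof.
move=> cM M0.
have [|p pM hp] := @EVT_min_rV R n (fun x => enorm (x - z)) M M0 cM.
  by apply: continuous_subspaceT => x; exact: enormB_continuous.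
rewrite inE in pM; exists p; split => //; apply/eqP; rewrite eq_le eucl_dist_le// andbT.
by apply: eucl_dist_ge => // q Mq; apply: hp; rewrite inE.
Qed.

Lemma eucl_dist_Lip M z z' : M !=set0 -> eucl_dist z M <= eucl_dist z' M + enorm (z - z').
Proof.
move=> M0; rewrite -lerBlDr; apply: eucl_dist_ge => // q Mq; rewrite lerBlDr.
rewrite (le_trans (eucl_dist_le z Mq))// (le_trans (enorm_triB q z' z))//.
by rewrite lerD2l enormBC.
Qed.

(** On the compact part of M at distance at least e from p, the distance to z exceeds d(z, M) by a
    positive gap; moving z by less than half of it cannot make such a point nearest. *)
Lemma nearest_perturb M z p e : compact M -> M !=set0 -> nearest_point M z p ->
  (forall q, nearest_point M z q -> q = p) -> 0 < e ->
  exists2 d, 0 < d & forall z' q, enorm (z' - z) < d -> nearest_point M z' q -> enorm (q - p) < e.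
Proof.
move=> cM M0 [Mp np] up e0.
pose K := M `&` [set q | e <= enorm (q - p)].
have cK : compact K.
  apply: compact_closedI => //; apply: closed_comp (@closed_ge _ e) => x _; exact: enormB_continuous.
have [K0|/set0P K0] := eqVneq K set0.
  exists 1 => // z' q _ [Mq _]; rewrite ltNge; apply/negP => h.
  by have : K q by []; rewrite K0.
have [|k kK hk] := @EVT_min_rV R n (fun x => enorm (x - z)) K K0 cK.
  by apply: continuous_subspaceT => x; exact: enormB_continuous.
rewrite inE in kK; case: kK => Mk ek.
have gap : eucl_dist z M < enorm (k - z).
  rewrite lt_neqAle eucl_dist_le// andbT; apply/eqP => h.
  have kp : k = p by apply: up.
  by move: ek; rewrite /= kp subrr enorm0 leNgt e0.
exists ((enorm (k - z) - eucl_dist z M) / 2); first by rewrite divr_gt0// subr_gt0.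
move=> z' q zz' [Mq nq]; rewrite ltNge; apply/negP => h.
have : enorm (k - z) <= enorm (q - z) by apply: hk; rewrite inE.
have := enorm_triB q z' z; rewrite nq.
have := eucl_dist_Lip z' z M0; lra.
Qed.

(** The direction u points away from the unique nearest point p. The nearest point q of the moved
    point stays close to p, so u remains almost aligned with z - q and the distance grows at nearly
    unit speed. *)
Lemma eucl_dist_ascent M z p e : compact M -> M !=set0 -> nearest_point M z p ->
  (forall q, nearest_point M z q -> q = p) -> 0 < eucl_dist z M -> 0 < e -> e <= 1 ->
  exists u : 'rV[R]_n, enorm u = 1 /\ exists2 d0, 0 < d0 &
    forall d, 0 < d -> d < d0 -> eucl_dist z M + d * (1 - e) <= eucl_dist (z + d *: u) M.
Proof.
move=> cM M0 np up dz e0 e1; set r := eucl_dist z M in dz *.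
have pz : enorm (p - z) = r by case: np.
pose u := r^-1 *: (z - p); have nu : enorm u = 1.
  by rewrite enormZ enormBC pz ger0_norm ?invr_ge0 ?ltW// mulVf ?gt_eqF.
exists u; split=> //.
have [d0 d00 hd0] := nearest_perturb cM M0 np up (mulr_gt0 e0 dz).
exists d0 => // d d_gt0 dd0.
have [q nq] := nearest_exists (z + d *: u) cM M0.
have qp : enorm (q - p) < e * r.
  apply: hd0 nq; rewrite addrAC subrr add0r enormZ nu mulr1 ger0_norm//; exact: ltW.
have [Mq eq] := nq.
have q1 : r <= enorm (q - z) by rewrite eucl_dist_le.
have uz : dot u (z - q) >= r * (1 - e).
  have -> : z - q = (z - p) - (q - p) by rewrite opprB addrA subrK.
  rewrite dotBr; have := dot_le u (q - p); rewrite nu mul1r => h.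
  have -> : dot u (z - p) = r.
    by rewrite dotZl -enorm_sq enormBC pz expr2 mulrA mulVf ?mul1r// gt_eqF.
  by move: qp; lra.
clearbody u; rewrite -(ler_pXn2r (n := 2))// ?nnegrE ?addr_ge0 ?mulr_ge0 ?subr_ge0 ?(ltW dz) ?(ltW d_gt0)//; last first.
  by rewrite -eq enorm_ge0.
rewrite -eq enormBC enorm_sq addrAC dot_sqD dotZr dotZr dotZl -!enorm_sq nu.
rewrite (dotC (z - q) u).
have : r ^+ 2 <= enorm (z - q) ^+ 2.
  by rewrite ler_pXn2r// ?nnegrE ?enorm_ge0 ?(ltW dz)// enormBC.
have : d * (r * (1 - e)) <= d * dot u (z - q) by rewrite ler_wpM2l// ltW.
have : (d * (1 - e)) ^+ 2 <= d ^+ 2.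
  rewrite exprMn ler_piMr ?sqr_ge0//; rewrite expr_le1//; lra.
nra.
Qed.

Lemma reach_unique M rho z p q : reach_ge M rho -> eucl_dist z M < rho ->
  nearest_point M z p -> nearest_point M z q -> q = p.
Proof.
move=> hr dz [Mp np] [Mq nq]; apply: contrapT => qp.
by have := hr z; rewrite leNgt dz => /(_ _)/negP; case => //; exists q, p.
Qed.

(* Maximise d(z, M) - (1-e)|z - z0| on the ball of radius s about z0: below the reach the distance function has slope one somewhere, so the maximum is on the boundary sphere. *)
Lemma reach_ascent M rho z0 s e : compact M -> M !=set0 -> reach_ge M rho ->
  0 < eucl_dist z0 M -> 0 <= s -> eucl_dist z0 M + s < rho -> 0 < e -> e <= 1 ->
  exists2 z, enorm (z - z0) = s & eucl_dist z0 M + (1 - e) * s <= eucl_dist z M.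
Proof.
move=> cM M0 hr d0 s0 ds e0 e1.
pose g z := eucl_dist z M - (1 - e) * enorm (z - z0).
have B0 : [set z | enorm (z - z0) <= s] !=set0 by exists z0; rewrite /= subrr enorm0.
have cg : continuous g.
  apply: (@enorm_lip_continuous _ _ _ 2) => x y; rewrite /g.
  have h1 := eucl_dist_Lip x y M0; have h2 := eucl_dist_Lip y x M0; rewrite (enormBC y x) in h2.
  have := enorm_Lip (x - z0) (y - z0); rewrite opprB addrA subrK ler_norml => /andP[h3 h4].
  have := enorm_ge0 (x - y); rewrite ler_norml => h5; apply/andP; split; nra.
have [|z zB hz] := @EVT_max_rV R n g _ B0 (@compact_eball R n z0 s).
  exact: continuous_subspaceT.
rewrite inE /= in zB.
have gz0 : eucl_dist z0 M <= g z.
  have := hz z0; rewrite inE /= subrr enorm0 /g subrr enorm0 mulr0 subr0; exact.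
have [zs|zs] := leP s (enorm (z - z0)).
  have es : enorm (z - z0) = s by apply/eqP; rewrite eq_le zB zs.
  by exists z => //; move: gz0; rewrite /g es; lra.
exfalso; have nz := enorm_ge0 (z - z0).
have dz : 0 < eucl_dist z M by move: gz0; rewrite /g; nra.
have dzr : eucl_dist z M < rho by have := eucl_dist_Lip z z0 M0; lra.
have [p np] := nearest_exists z cM M0.
have [||u [nu [d1 d10 hd]]] := eucl_dist_ascent (e := e / 2) cM M0 np (fun q => reach_unique hr dzr np) dz.
- by rewrite divr_gt0.
- lra.
pose d := Num.min (d1 / 2) (s - enorm (z - z0)).
have dp : 0 < d by rewrite lt_min divr_gt0//= subr_gt0.
have dd1 : d < d1 by rewrite gt_min; apply/orP; left; lra.
have dds : d <= s - enorm (z - z0) by rewrite ge_min lexx orbT.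
have h1 := hd d dp dd1.
have h2 : enorm (z + d *: u - z0) <= enorm (z - z0) + d.
  by rewrite addrAC (le_trans (enormD _ _))// enormZ nu mulr1 ger0_norm// ltW.
have : g (z + d *: u) <= g z by apply: hz; rewrite inE /=; lra.
have : (1 - e) * enorm (z + d *: u - z0) <= (1 - e) * (enorm (z - z0) + d) by rewrite ler_wpM2l// subr_ge0.
rewrite /g; nra.
Qed.

(** An ascent of length s from z0 gains almost s, so |z - p| is almost t, which is possible only if
    the displacement v is nearly s w. The end z is then close to y, so d(y, M) is almost t, against
    the deficit c of a point x inside the ball. *)
Lemma reach_extend M rho p w t0 t : compact M -> reach_ge M rho -> M p ->
  enorm w = 1 -> 0 < t0 -> nearest_point M (p + t0 *: w) p -> t0 <= t -> t < rho ->
  forall x, M x -> t <= enorm (x - (p + t *: w)).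
Proof.
move=> cM hr Mp nw t00 [_ np] tt tr x Mx.
have M0 : M !=set0 by exists p.
set z0 := p + t0 *: w in np *.
have dz0 : eucl_dist z0 M = t0.
  by rewrite -np opprD addrA subrr add0r enormN enormZ nw mulr1 ger0_norm// ltW.
rewrite leNgt; apply/negP => hx; set y := p + t *: w in hx.
pose s := t - t0; have s0 : 0 <= s by rewrite subr_ge0.
have t_gt0 : 0 < t by lra.
pose c := t - enorm (x - y); have c0 : 0 < c by rewrite subr_gt0.
(* The second entry gives e s <= c / 4, the third |v - s w| <= c / 2; together they stay below the
   deficit c. *)
pose e := Num.min 1 (Num.min (c / (4 * (s + 1))) (c ^+ 2 * t0 / (8 * (s + 1) ^+ 2 * t))).
have s1 : 0 < s + 1 by lra.
have e0 : 0 < e by rewrite !lt_min ltr01 !divr_gt0 ?mulr_gt0 ?exprn_gt0.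
have e1 : e <= 1 by rewrite ge_min lexx.
have e2 : e <= c / (4 * (s + 1)) by rewrite /e !ge_min lexx orTb orbT.
have e3 : e <= c ^+ 2 * t0 / (8 * (s + 1) ^+ 2 * t) by rewrite /e !ge_min lexx !orbT.
have [z zs hz] : exists2 z, enorm (z - z0) = s & t0 + (1 - e) * s <= eucl_dist z M.
  by rewrite -dz0; apply: (reach_ascent cM M0 hr) => //; rewrite dz0 // /s; lra.
have zp : t - e * s <= enorm (z - p).
  rewrite enormBC (le_trans _ (eucl_dist_le z Mp))// (le_trans _ hz)// /s; lra.
set v := z - z0 in zs.
have ezp : z - p = v + t0 *: w by rewrite /v /z0 opprD addrA subrK.
have es : e * s <= c / 4.
  move: e2; rewrite ler_pdivlMr ?mulr_gt0// => e2; nra.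
have ct : c <= t by rewrite /c; have := enorm_ge0 (x - y); lra.
have h1 : (t - e * s) ^+ 2 <= s ^+ 2 + 2 * (t0 * dot v w) + t0 ^+ 2.
  have : (t - e * s) ^+ 2 <= enorm (z - p) ^+ 2 by rewrite ler_pXn2r// ?nnegrE ?enorm_ge0//; lra.
  by rewrite ezp enorm_sq dot_sqD !dotZr dotZl -!enorm_sq zs nw; lra.
have h2 : t0 * (s - dot v w) <= t * e * s.
  by have := sqr_ge0 (e * s); rewrite /s in h1 *; nra.
have h3 : enorm (v - s *: w) <= c / 2.
  apply: enorm_le; first lra.
  rewrite dot_sqB !dotZr dotZl -!enorm_sq zs nw.
  have : 2 * s * (t0 * (s - dot v w)) <= (c / 2) ^+ 2 * t0.
    apply: (@le_trans _ _ (2 * s * (t * e * s))); first by rewrite ler_wpM2l// mulr_ge0.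
    move: e3; rewrite ler_pdivlMr ?mulr_gt0 ?exprn_gt0// => e3.
    have : s ^+ 2 * (e * t) <= (s + 1) ^+ 2 * (e * t).
      by rewrite ler_wpM2r// ?mulr_ge0 ?(ltW e0) ?(ltW t_gt0)//; nra.
    nra.
  move=> h; rewrite -(ler_pM2r t00); nra.
have h4 : y - z = - (v - s *: w).
  rewrite /y /v /z0 /s scalerBl; apply/rowP => i; rewrite !mxE; ring.
have := eucl_dist_Lip z y M0; rewrite enormBC h4 enormN.
have : eucl_dist y M <= enorm (x - y) by rewrite eucl_dist_le.
have hz2 : t - e * s <= eucl_dist z M by apply: le_trans hz; rewrite /s; lra.
have hc : enorm (x - y) = t - c by rewrite /c; lra.
rewrite hc; clear - es h3 hz2 c0; lra.
Qed.

(** Federer's inequality: the open ball of radius t about p + t w misses M, which reads 2 t <x - p,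
    w> <= |x - p|^2, and by [reach_extend] t may be taken up to rho. *)
Lemma reach_normal M rho p w t0 x : compact M -> 0 < rho -> reach_ge M rho -> M p ->
  enorm w = 1 -> 0 < t0 -> nearest_point M (p + t0 *: w) p -> M x ->
  dot (x - p) w <= enorm (x - p) ^+ 2 / (2 * rho).
Proof.
move=> cM r0 hr Mp nw t00 np Mx.
have H t : 0 < t -> t <= enorm (x - (p + t *: w)) -> 2 * t * dot (x - p) w <= enorm (x - p) ^+ 2.
  move=> tp h; have : t ^+ 2 <= enorm (x - (p + t *: w)) ^+ 2.
    by rewrite ler_pXn2r// ?nnegrE ?enorm_ge0// ltW.
  by rewrite opprD addrA (enorm_sq (_ - _ - _)) dot_sqB !dotZr dotZl -!enorm_sq nw; lra.
rewrite ler_pdivlMr ?mulr_gt0//; set a := dot _ _ in H *; set b := enorm _ ^+ 2 in H *.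
have b0 : 0 <= b by rewrite sqr_ge0.
have [a0|a0] := leP a 0; first by nra.
have [t0r|t0r] := leP rho t0.
  have : 2 * t0 * a <= b.
    apply: H => //; case: np => _ np; rewrite -[leLHS](_ : enorm (p - (p + t0 *: w)) = t0).
      by rewrite np eucl_dist_le.
    by rewrite opprD addrA subrr add0r enormN enormZ nw mulr1 ger0_norm// ltW.
  nra.
rewrite leNgt; apply/negP => h.
pose t := Num.max t0 ((b / (2 * a) + rho) / 2).
have t1 : b / (2 * a) < rho by rewrite ltr_pdivrMr ?mulr_gt0//; lra.
have tr : t < rho by rewrite gt_max t0r/=; lra.
have tt : t0 <= t by rewrite le_max lexx.
have t2 : b / (2 * a) < t by rewrite lt_max; apply/orP; right; lra.
have := H t (lt_le_trans t00 tt) (reach_extend cM hr Mp nw t00 np tt tr Mx).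
rewrite ltr_pdivrMr ?mulr_gt0// in t2; lra.
Qed.

End Reach.

(** * Second-order Taylor bound from partial derivatives *)

Section Taylor.
Variable R : realType.

Lemma line_is_derive (V : normedModType R) (F : V -> R) (x v : V) (s l : R) :
  is_derive (x + s *: v) v F l -> is_derive s 1 (fun t : R => F (x + t *: v)) l.
Proof.
have e : (fun h : R => h^-1 *: (((fun t : R => F (x + t *: v)) \o shift s) (h *: 1) - F (x + s *: v))) =
  (fun h : R => h^-1 *: ((F \o shift (x + s *: v)) (h *: v) - F (x + s *: v))).
  apply/funext => h /=; congr (_ *: (F _ - _)).
  by rewrite [h *: 1]mulr1 scalerDl addrCA.
move=> [d1 d2]; apply: DeriveDef.
  by rewrite /derivable e.
by rewrite /derive e.
Qed.

(** The conditions [0 <= t * a] and [|t| <= |a|] say that t lies between 0 and a for either sign of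
    a; negative a is treated by reversing the segment. *)
Lemma segment_mvt (V : normedModType R) (F : V -> R) (x v : V) (a c K r : R) :
  `|a| <= r -> 0 <= K ->
  (forall t, 0 <= t * a -> `|t| <= `|a| -> derivable F (x + t *: v) v /\ `|'D_v F (x + t *: v) - c| <= K) ->
  `|F (x + a *: v) - F x - a * c| <= K * r.
Proof.
wlog a0 : x a / 0 <= a => [hw|ar K0 h].
  have [a0|a0] := leP 0 a; first exact: hw.
  move=> ar K0 h; have := hw (x + a *: v) (- a); rewrite oppr_ge0 normrN => /(_ (ltW a0) ar K0).
  rewrite scaleNr addrK -[`|_ - _|]normrN mulNr !opprD !opprK => hh.
  rewrite [X in `|X| <= _](_ : _ = - F x + F (x + a *: v) - a * c); last by ring.
  apply: hh => t; rewrite pmulr_lge0 ?oppr_gt0// (ltr0_norm a0) => t0; rewrite (ger0_norm t0) => ta.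
  rewrite -addrA -scalerDl; apply: h; first by nra.
  by rewrite (ltr0_norm a0) ler0_norm; lra.
pose g t := F (x + t *: v).
have hg t : t \in `[0, a] -> is_derive t 1 g ('D_v F (x + t *: v)).
  rewrite in_itv/= => /andP[t0 ta]; apply: line_is_derive; apply: derivableP.
  by apply: (h t _ _).1; rewrite ?mulr_ge0// !ger0_norm.
have hg1 t : t \in `]0, a[ -> is_derive t 1 g ('D_v F (x + t *: v)).
  by move=> tin; apply: hg; exact: subset_itvW tin.
have hg2 : {within `[0, a], continuous g}.
  by apply: derivable_within_continuous => t tin; case: (hg t tin).
have [b bin] := @MVT_segment R g (fun t => 'D_v F (x + t *: v)) 0 a a0 hg1 hg2.
rewrite /g scale0r addr0 subr0 => ->.
move: bin; rewrite in_itv/= => /andP[b0 ba].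
rewrite [a * c]mulrC -mulrBl normrM ler_pM//.
by apply: (h b _ _).2; rewrite ?mulr_ge0// !ger0_norm.
Qed.

(** [C2_on] speaks of partial derivatives only, so u0 is joined to u by changing one coordinate at a
    time; the path stays in the box around u0. *)
Lemma path_mvt d (F : 'rV[R]_d -> R) (u0 u : 'rV[R]_d) (c : 'I_d -> R) (K r : R) : 0 <= K ->
  (forall (u : 'rV[R]_d) i, (forall j, `|u ord0 j - u0 ord0 j| <= r) ->
     derivable F u (ebasis R i) /\ `|'D_(ebasis R i) F u - c i| <= K) ->
  (forall j, `|u ord0 j - u0 ord0 j| <= r) ->
  `|F u - F u0 - \sum_i (u ord0 i - u0 ord0 i) * c i| <= d%:R * (K * r).
Proof.
move=> K0 hF hu.
pose U k : 'rV[R]_d := \row_(i < d) if (i < k)%N then u ord0 i else u0 ord0 i.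
have r0 (i : 'I_d) : 0 <= r by rewrite (le_trans _ (hu i)).
suff H k : (k <= d)%N ->
    `|F (U k) - F u0 - \sum_(i < d | (i < k)%N) (u ord0 i - u0 ord0 i) * c i| <= k%:R * (K * r).
  have := H d (leqnn d); have -> : U d = u by apply/rowP => i; rewrite mxE ltn_ord.
  by under eq_bigl do rewrite ltn_ord.
elim: k => [_|k IH kd].
  have -> : U 0%N = u0 by apply/rowP => i; rewrite mxE.
  by rewrite big1 ?subrr ?subr0 ?normr0 ?mul0r.
pose i := Ordinal kd; pose a := u ord0 i - u0 ord0 i.
have UE : U k.+1 = U k + a *: ebasis R i.
  apply/rowP => j; rewrite !mxE eqxx /= ltnS leq_eqVlt -[(j == k :> nat)]/(j == i).
  have [->|ji] := eqVneq j i; first by rewrite ltnn mulr1 /a addrC subrK.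
  by rewrite mulr0 addr0.
rewrite (bigD1 i) //= (eq_bigl (fun j : 'I_d => (j < k)%N)); last first.
  by move=> j; rewrite ltnS -val_eqE /= ltn_neqAle andbC.
rewrite UE -/a.
have step : `|F (U k + a *: ebasis R i) - F (U k) - a * c i| <= K * r.
  apply: segment_mvt => [||t ta tn]; [exact: (hu i)|exact: K0|apply: hF => j].
  rewrite !mxE eqxx /=; have [->|ji] := eqVneq j i.
    by rewrite ltnn mulr1 addrC addrK (le_trans tn)//; exact: hu.
  rewrite mulr0 addr0; case: ifP => // _; rewrite subrr normr0; exact: r0 i.
rewrite [X in `|X| <= _](_ : _ = (F (U k + a *: ebasis R i) - F (U k) - a * c i) +
  (F (U k) - F u0 - \sum_(j < d | (j < k)%N) (u ord0 j - u0 ord0 j) * c j)); last by ring.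
have -> : k.+1%:R * (K * r) = K * r + k%:R * (K * r) by rewrite -natr1; ring.
rewrite (le_trans (ler_normD _ _))// lerD//.
by apply: IH; exact: ltnW.
Qed.

Lemma nbhs_box d (u0 : 'rV[R]_d) (P : set 'rV[R]_d) : nbhs u0 P ->
  exists2 r : R, 0 < r & forall u : 'rV[R]_d, (forall j, `|u ord0 j - u0 ord0 j| <= r) -> P u.
Proof.
move=> /nbhs_normP[r /= r0 h]; exists (r / 2); first by rewrite divr_gt0.
move=> u hu; apply: h => /=; apply: (@le_lt_trans _ _ (r / 2)); last lra.
rewrite [`|_|]mx_normrE; apply: bigmax_le => [|[i j] _ /=]; first lra.
by rewrite (ord1 i) !mxE distrC.
Qed.

(** Two uses of [path_mvt]: bounded second partials make the first partials vary by O(s), and that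
    variation is the constant K of the second use. *)
Lemma C2_taylor d n (V : set 'rV[R]_d) (phi : 'rV[R]_d -> 'rV[R]_n) u0 :
  open V -> V u0 -> C2_on V phi ->
  exists K r : R, [/\ 0 <= K, 0 < r &
    forall s (u : 'rV[R]_d), 0 <= s -> s <= r -> (forall j, `|u ord0 j - u0 ord0 j| <= s) ->
      V u /\ forall c, `|phi u ord0 c - phi u0 ord0 c - ((u - u0) *m Defs.jacobian phi u0) ord0 c| <= K * s ^+ 2].
Proof.
move=> oV Vu0 [d1 [d2 d3]].
pose H i j := 'D_(ebasis R j) ('D_(ebasis R i) phi).
have cH i j : {for u0, continuous (H i j)}.
  have := d3 i j; rewrite continuous_open_subspace// => h; apply: h.
  by rewrite inE.
have nearH : \forall u \near u0, forall ij : 'I_d * 'I_d, `|H ij.1 ij.2 u| <= `|H ij.1 ij.2 u0| + 1.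
  apply: (filter_forall (f := fun (ij : 'I_d * 'I_d) (u : 'rV[R]_d) => `|H ij.1 ij.2 u| <= `|H ij.1 ij.2 u0| + 1) (nbhs_filter u0)) => -[i j] /=.
  have /cvgrPdist_le/(_ 1 ltr01) := cH i j.
  apply: filterS => u hu.
  move: hu; generalize (H i j u) (H i j u0) => A B hu.
  by rewrite -lerBlDl (le_trans (lerB_dist A B))// distrC.
have [r r0 hr] := nbhs_box (filterI (open_nbhs_nbhs (conj oV Vu0)) nearH).
pose K2 := \sum_(ij : 'I_d * 'I_d) (`|H ij.1 ij.2 u0| + 1).
have K20 : 0 <= K2 by apply: sumr_ge0 => ij _; rewrite addr_ge0.
have HK (u : 'rV[R]_d) i j : (forall j, `|u ord0 j - u0 ord0 j| <= r) -> `|H i j u| <= K2.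
  move=> /hr[_ /(_ (i, j)) /= h]; apply: le_trans h _.
  by rewrite /K2 (bigD1 (i, j))//= lerDl sumr_ge0// => ij _; rewrite addr_ge0.
exists (d%:R * (d%:R * K2)), r; split => //; first by rewrite !mulr_ge0.
move=> s u s0 sr hu; have boxr (v : 'rV[R]_d) : (forall j, `|v ord0 j - u0 ord0 j| <= s) -> (forall j, `|v ord0 j - u0 ord0 j| <= r).
  by move=> h j; apply: le_trans (h j) sr.
split; first by case: (hr u (boxr _ hu)).
move=> c.
have e2 : (d%:R * (d%:R * K2)) * s ^+ 2 = d%:R * ((d%:R * (K2 * s)) * s) by ring.
rewrite e2.
have -> : ((u - u0) *m Defs.jacobian phi u0) ord0 c = \sum_i (u ord0 i - u0 ord0 i) * ('D_(ebasis R i) phi u0) ord0 c.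
  by rewrite mxE; apply: eq_bigr => i _; rewrite !mxE.
apply: (@path_mvt d (fun u => phi u ord0 c)) => //; first by rewrite !mulr_ge0.
move=> v i hv.
have Vv : V v by case: (hr v (boxr _ hv)).
have dv := d1 v i Vv.
split; first by have /derivable_mxP/(_ ord0 c) := dv.
have -> : 'D_(ebasis R i) (fun u => phi u ord0 c) v = ('D_(ebasis R i) phi v) ord0 c.
  by rewrite derive_mx// mxE.
have := @path_mvt d (fun u => 'D_(ebasis R i) phi u ord0 c) u0 v (fun=> 0) K2 s K20.
rewrite big1 => [|j _]; last by rewrite mulr0.
rewrite subr0; apply => // v' j hv'.
have Vv' : V v' by case: (hr v' (boxr _ hv')).
have dv' := d2 v' i j Vv'.
split; first by have /derivable_mxP/(_ ord0 c) := dv'.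
have -> : 'D_(ebasis R j) (fun u => 'D_(ebasis R i) phi u ord0 c) v' = (H i j v') ord0 c.
  by rewrite /H derive_mx// mxE.
rewrite subr0 (le_trans (mxnorm_coord _ _))// HK//; exact: boxr.
Qed.

End Taylor.

(** * Charts and tangent projections *)

Section Charts.
Variable R : realType.

Lemma mulmx_bound n m (B : 'M[R]_(n, m)) :
  exists2 b : R, 0 <= b & forall v : 'rV[R]_n, enorm (v *m B) <= b * enorm v.
Proof.
exists (\sum_i enorm (row i B)); first by apply: sumr_ge0 => i _; exact: enorm_ge0.
move=> v; rewrite mulmx_sum_row (le_trans (enorm_bigsum _ _ _))// mulr_suml.
apply: ler_sum => i _; rewrite enormZ mulrC ler_wpM2l ?enorm_ge0//.
exact: enorm_coord.
Qed.

Lemma enorm_le_coord n (u : 'rV[R]_n) c : (forall i, `|u ord0 i| <= c) -> enorm u <= n%:R * c.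
Proof.
case: n u => [|n] u h; first by rewrite mul0r enormE /dot big_ord0 sqrtr0.
have c0 : 0 <= c := le_trans (normr_ge0 _) (h ord0).
apply: le_trans (enorm_le_mxnorm _) _; rewrite ler_wpM2l//.
rewrite [`|u|]mx_normrE; apply: bigmax_le => // -[i j] _ /=.
by rewrite (ord1 i).
Qed.

Lemma chart_base d n (M : set 'rV[R]_n) p U V phi psi : M p ->
  @chart R d n M p U V phi psi -> V (psi p) /\ phi (psi p) = p.
Proof. by move=> Mp [[oU Up oV C2] [_ h _ _]]; apply: h. Qed.

Lemma dot_jac0 d n (J : 'M[R]_(d, n)) (w : 'rV[R]_n) (z : 'rV[R]_d) :
  J *m w^T = 0 -> dot (z *m J) w = 0.
Proof. by move=> h; rewrite dotE -mulmxA h mulmx0 mxE. Qed.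

(** The Taylor remainder is quadratic in the parameter z. The right inverse of the Jacobian gives
    |z| <= 2 b |x - p|, because [r2] is so small that the remainder contributes at most |z| / 2. *)
Lemma chart_quadratic d n (M : set 'rV[R]_n) p U V phi psi (w : 'rV[R]_n) : M p ->
  @chart R d n M p U V phi psi -> Defs.jacobian phi (psi p) *m w^T = 0 ->
  exists K r : R, [/\ 0 <= K, 0 < r & forall x, M x -> enorm (x - p) < r ->
    dot (x - p) w <= K * enorm (x - p) ^+ 2].
Proof.
move=> Mp hc Jw; have [Vu pu] := chart_base Mp hc.
have [[oU Up oV C2] [h1 h2 cpsi fJ]] := hc.
set u0 := psi p in Jw Vu pu; set J := Defs.jacobian phi u0 in Jw.
have [K1 [r1 [K10 r10 ht]]] := C2_taylor oV Vu C2.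
have JB : J *m pinvmx J = 1%:M by rewrite mulmxVp// fJ.
have [b b0 hb] := mulmx_bound (pinvmx J).
pose r2 := Num.min r1 (1 / (2 * (b * (n%:R * K1) + 1))).
have bK : 0 <= b * (n%:R * K1) by rewrite !mulr_ge0.
have r20 : 0 < r2 by rewrite lt_min r10 divr_gt0// mulr_gt0// ltr_wpDl.
have r2b : b * (n%:R * K1) * r2 <= 1/2.
  have : r2 <= 1 / (2 * (b * (n%:R * K1) + 1)) by rewrite ge_min lexx orbT.
  rewrite ler_pdivlMr ?mulr_gt0 ?ltr_wpDl//; nra.
have [r r0 hr] : exists2 r : R, 0 < r & forall x, M x -> enorm (x - p) < r -> U x /\ `|psi x - u0| < r2.
  have pA : (M `&` U) p by [].
  have : psi @ within (M `&` U) (nbhs p) --> u0 by exact: ((@subspace_continuousP _ (M `&` U) _ psi).1 cpsi p pA).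
  move=> /cvgrPdist_lt/(_ r2 r20) hw.
  have : nbhs p (U `&` [set x | (M `&` U) x -> `|u0 - psi x| < r2]).
    apply: filterI; [exact: open_nbhs_nbhs|exact: hw].
  move=> /nbhs_enormP[r r0 hr]; exists r => // x Mx xr.
  have [Ux hx] : (U `&` [set x | (M `&` U) x -> `|u0 - psi x| < r2]) x by apply: hr; rewrite enormBC.
  by split => //; rewrite distrC; apply: hx.
exists (n%:R * K1 * (2 * b) ^+ 2 * enorm w), r; split => //.
  by rewrite mulr_ge0 ?enorm_ge0// mulr_ge0 ?sqr_ge0// mulr_ge0.
move=> x Mx xr; have [Ux px] := hr x Mx xr.
have [Vx ex] := h2 x (conj Mx Ux).
pose z := psi x - u0; pose s := `|z|.
have s0 : 0 <= s := normr_ge0 z.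
have sr1 : s <= r1 by rewrite (le_trans (ltW px))// ge_min lexx.
have [j|_ he] := ht s (psi x) s0 sr1.
  by have := mxnorm_coord z j; rewrite !mxE.
rewrite ex pu -/J -/z in he.
pose e := (x - p) - z *m J.
have ne : enorm e <= n%:R * (K1 * s ^+ 2) by apply: enorm_le_coord => c; have := he c; rewrite !mxE.
have ezB : z = (x - p) *m pinvmx J - e *m pinvmx J.
  by rewrite -mulmxBl opprB addrC subrK -mulmxA JB mulmx1.
have sb : s <= 2 * b * enorm (x - p).
  have q1 : s <= b * enorm (x - p) + b * enorm e.
    rewrite (le_trans (enorm_mxnorm _))// {1}ezB (le_trans (enormB _ _))// lerD//.
  have q2 : b * enorm e <= b * (n%:R * K1) * s * s.
    by rewrite (le_trans (ler_wpM2l b0 ne))// le_eqVlt; apply/orP; left; apply/eqP; ring.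
  have q3 : b * (n%:R * K1) * s <= 1/2.
    by rewrite (le_trans _ r2b)// ler_wpM2l// ltW.
  have q4 : b * (n%:R * K1) * s * s <= 1/2 * s by rewrite ler_wpM2r.
  lra.
have -> : dot (x - p) w = dot e w by rewrite /e (dotBl (x - p)) (dot_jac0 _ Jw) subr0.
rewrite (le_trans (dot_le _ _))// [leRHS]mulrAC ler_wpM2r ?enorm_ge0//.
have -> : n%:R * K1 * (2 * b) ^+ 2 * enorm (x - p) ^+ 2 = n%:R * (K1 * (2 * b * enorm (x - p)) ^+ 2) by ring.
rewrite (le_trans ne)// !ler_wpM2l//.
by rewrite ler_pXn2r// ?nnegrE ?mulr_ge0 ?enorm_ge0.
Qed.

(** Along the curve phi(u0 + t e_i) the product with w is t a + O(t^2); a lower bound -B t^2 for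
    both signs of t forces a = 0. The bound on M is one-sided because minimality provides just
    that. *)
Lemma quad_orth d n (M : set 'rV[R]_n) p U V phi psi (w : 'rV[R]_n) (K r : R) : M p ->
  @chart R d n M p U V phi psi -> 0 <= K -> 0 < r ->
  (forall x, M x -> enorm (x - p) < r -> - K * enorm (x - p) ^+ 2 <= dot (x - p) w) ->
  Defs.jacobian phi (psi p) *m w^T = 0.
Proof.
move=> Mp hc K0 r0 hw; have [Vu pu] := chart_base Mp hc.
have [[oU Up oV C2] [h1 h2 cpsi fJ]] := hc.
set u0 := psi p in Vu pu *; set J := Defs.jacobian phi u0.
have [K1 [r1 [K10 r10 ht]]] := C2_taylor oV Vu C2.
apply/colP => i; rewrite !mxE -/J.
have -> : \sum_j J i j * w^T j ord0 = dot (row i J) w by apply: eq_bigr => j _; rewrite !mxE.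
set a := dot _ _; pose L := enorm (row i J); have L0 : 0 <= L := enorm_ge0 _.
pose E := n%:R * K1; have E0 : 0 <= E by rewrite mulr_ge0.
pose A := L + E * r1; have A0 : 0 <= A by rewrite addr_ge0// mulr_ge0// ltW.
pose B := K * A ^+ 2 + E * enorm w; have B0 : 0 <= B.
  by rewrite addr_ge0// mulr_ge0 ?sqr_ge0 ?enorm_ge0.
suff key (t : R) : `|t| <= r1 -> `|t| * (A + 1) < r -> - B * t ^+ 2 <= t * a.
  apply/eqP; rewrite -normr_eq0 eq_le normr_ge0 andbT leNgt; apply/negP => a0.
  pose t := Num.min r1 (Num.min (r / (2 * (A + 1))) (`|a| / (2 * (B + 1)))).
  have A1 : 0 < A + 1 by lra. have B1 : 0 < B + 1 by lra.
  have t0 : 0 < t by rewrite !lt_min r10 !divr_gt0// mulr_gt0.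
  have t1 : t <= r1 by rewrite ge_min lexx.
  have t2 : t <= r / (2 * (A + 1)) by rewrite /t !ge_min lexx orTb orbT.
  have t3 : t <= `|a| / (2 * (B + 1)) by rewrite /t !ge_min lexx !orbT.
  rewrite ler_pdivlMr ?mulr_gt0// in t2; rewrite ler_pdivlMr ?mulr_gt0// in t3.
  have tn : `|t| = t by rewrite ger0_norm// ltW.
  have k1 := key t; have k2 := key (- t); rewrite normrN tn sqrrN in k2; rewrite tn in k1.
  have tr : t * (A + 1) < r by lra.
  have := k1 t1 tr; have := k2 t1 tr; rewrite mulNr.
  have [a1|a1] := leP 0 a.
    rewrite ger0_norm// in t3 a0 *; nra.
  rewrite ltr0_norm// in t3 a0 *; nra.
move=> t1 t2; pose u := u0 + t *: ebasis R i.
have hu j : `|u ord0 j - u0 ord0 j| <= `|t|.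
  rewrite !mxE eqxx /= addrC addKr; case: eqP => _; first by rewrite mulr1.
  by rewrite mulr0 normr0.
have [Vx he] := ht `|t| u (normr_ge0 t) t1 hu.
have [[Mx Ux] _] := h1 u Vx.
set x := phi u in Mx Ux he; rewrite pu in he.
have euJ : (u - u0) *m J = t *: row i J.
  by rewrite /u addrC addKr -scalemxAl -rowE.
pose e := (x - p) - t *: row i J.
have ne : enorm e <= E * t ^+ 2.
  rewrite /E -mulrA; apply: enorm_le_coord => c; have := he c; rewrite euJ real_normK ?num_real//.
  by rewrite !mxE.
have exp : x - p = t *: row i J + e by rewrite /e [RHS]addrC subrK.
have nxp : enorm (x - p) <= `|t| * A.
  rewrite exp (le_trans (enormD _ _))// enormZ /A mulrDr lerD//.
  rewrite (le_trans ne)// -[t ^+ 2]real_normK ?num_real// expr2 mulrCA ler_wpM2l//.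
  by rewrite ler_wpM2l.
have xr : enorm (x - p) < r.
  rewrite (le_lt_trans nxp)// (le_lt_trans _ t2)//; rewrite ler_wpM2l//; lra.
have := hw x Mx xr; rewrite {2}exp dotDl dotZl -/a => h.
have h3 : dot e w <= E * enorm w * t ^+ 2.
  by rewrite (le_trans (dot_le _ _))// mulrAC ler_wpM2r ?enorm_ge0.
have h4 : K * enorm (x - p) ^+ 2 <= K * A ^+ 2 * t ^+ 2.
  have -> : K * A ^+ 2 * t ^+ 2 = K * (`|t| * A) ^+ 2 by rewrite exprMn real_normK ?num_real//; ring.
  by rewrite ler_wpM2l// ler_pXn2r// ?nnegrE ?mulr_ge0 ?enorm_ge0.
rewrite /B mulNr; nra.
Qed.

End Charts.

(** * Tangent spaces of a manifold of positive reach *)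

Section Manifold.
Variables (R : realType) (n d : nat) (M : set 'rV[R]_n) (rho : R).
Hypothesis hM : @manifold_class R n d rho M.
Hypothesis rho0 : 0 < rho.
Implicit Types (x p w y : 'rV[R]_n) (Q T : 'M[R]_n).

Definition tproj x Q := exists T, @tangent_space R d n M x T /\ orth_proj T Q.

(** Normality phrased without tangent spaces, by inequalities that are closed in (x, w), as the
    compactness argument of [tproj_transversal] requires. [tproj_normal] and [normal_tproj] identify
    it with orthogonality. *)
Definition normal_at x w :=
  forall z, M z -> `|dot (z - x) w| <= enorm w * enorm (z - x) ^+ 2 / (2 * rho).

Let cM : compact M. Proof. by case: hM. Qed.
Let hr : reach_ge M rho. Proof. by case: hM. Qed.

Lemma tproj_exists x : M x -> exists Q, tproj x Q.
Proof.
move=> Mx; have [_ _ _ hC _] := hM; have [U [V [phi [psi hc]]]] := hC x Mx.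
have [Q hQ] := orth_proj_exists (<<Defs.jacobian phi (psi x)>>%MS).
exists Q, <<Defs.jacobian phi (psi x)>>%MS; split => //; split => //.
by exists U, V, phi, psi; split => //; apply/eqmxP/genmxE.
Qed.

Lemma tproj_rank x Q : tproj x Q -> \rank Q = d.
Proof.
move=> [T [[Mx [U [V [phi [psi [hc /eqmxP eT]]]]]] [_ [_ /eqmxP eQ]]]].
rewrite eQ eT; have [Vx _] := chart_base Mx hc.
have [_ [_ _ _ fJ]] := hc.
exact/eqP/fJ.
Qed.

Lemma tproj_orth x Q w : tproj x Q -> exists U V phi psi,
  @chart R d n M x U V phi psi /\ (Defs.jacobian phi (psi x) *m w^T = 0 <-> w *m Q = 0).
Proof.
move=> [T [[Mx [U [V [phi [psi [hc /eqmxP eT]]]]]] hQ]].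
exists U, V, phi, psi; split => //; set J := Defs.jacobian _ _ in eT *.
have [sQ [QQ /eqmxP eQ]] := hQ.
split=> h.
  have /submxP[X eX] : (Q <= J)%MS by rewrite eQ eT.
  by apply: trmx_inj; rewrite trmx_mul sQ eX trmx0 -mulmxA h mulmx0.
have /submxP[X ->] : (J <= Q)%MS by rewrite eQ eT.
have e : Q *m w^T = 0 by rewrite -[LHS]trmxK trmx_mul trmxK sQ h trmx0.
by rewrite -mulmxA e mulmx0.
Qed.

(** The chart gives a quadratic bound with some local constant K, so a small ball touching M at x in
    direction v contains no point of M inside. Hence x is nearest to x + t0 v, and [reach_normal]
    replaces K by 1 / (2 rho). *)
Lemma tproj_normal x Q w : tproj x Q -> w *m Q = 0 -> normal_at x w.
Proof.
move=> tx wQ z Mz; have Mx : M x by case: tx => T [[]].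
have [U [V [phi [psi [hc hJ]]]]] := tproj_orth w tx.
have [->|w0] := eqVneq w 0; first by rewrite dot0r normr0 enorm0 !mul0r.
have nw := enorm_gt0 w0.
suff H (v : 'rV[R]_n) : Defs.jacobian phi (psi x) *m v^T = 0 -> enorm v = 1 ->
    dot (z - x) v <= enorm (z - x) ^+ 2 / (2 * rho).
  have Jw := hJ.2 wQ.
  have h1 := H ((enorm w)^-1 *: w); have h2 := H (- ((enorm w)^-1 *: w)).
  have nw1 : enorm ((enorm w)^-1 *: w) = 1.
    by rewrite enormZ ger0_norm ?invr_ge0 ?enorm_ge0// mulVf ?gt_eqF.
  rewrite -mulrA mulrC -ler_pdivrMr//.
  rewrite -[X in X / _](_ : `|enorm w * dot (z - x) ((enorm w)^-1 *: w)| = `|dot (z - x) w|); last first.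
    by rewrite dotZr mulrA mulfV ?mul1r// gt_eqF.
  rewrite normrM ger0_norm ?enorm_ge0// mulrAC mulfV ?gt_eqF// mul1r.
  rewrite ler_norml h1 ?andbT//; last by rewrite linearZ /= -scalemxAr Jw scaler0.
  rewrite lerNl -dotNr h2 ?enormN//.
  by rewrite linearN linearZ /= mulmxN -scalemxAr Jw scaler0 oppr0.
move=> Jv nv.
have [K [r [K0 r0 hq]]] := chart_quadratic Mx hc Jv.
pose t0 := Num.min (1 / (2 * (K + 1))) (r / 2).
have K1 : 0 < K + 1 by lra.
have t00 : 0 < t0 by rewrite lt_min !divr_gt0// mulr_gt0.
have t0K : t0 <= 1 / (2 * (K + 1)) by rewrite ge_min lexx.
have t0r : t0 <= r / 2 by rewrite ge_min lexx orbT.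
rewrite ler_pdivlMr ?mulr_gt0// in t0K.
apply: (reach_normal cM rho0 hr Mx nv t00) => //.
have ex : enorm (x - (x + t0 *: v)) = t0.
  by rewrite opprD addrA subrr add0r enormN enormZ nv mulr1 ger0_norm// ltW.
have d1 := eucl_dist_le (x + t0 *: v) Mx; rewrite ex in d1.
split => //; rewrite ex; apply/eqP; rewrite eq_le d1 andbT.
apply: eucl_dist_ge; first by exists x.
move=> q Mq; rewrite -(ler_pXn2r (n := 2)) ?nnegrE ?enorm_ge0 ?(ltW t00)//.
rewrite opprD addrA enorm_sq dot_sqB !dotZr dotZl -!enorm_sq nv.
have nq := enorm_ge0 (q - x).
suff : 2 * t0 * dot (q - x) v <= enorm (q - x) ^+ 2 by lra.
have [qr|qr] := ltP (enorm (q - x)) r.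
  have := hq q Mq qr; have := sqr_ge0 (enorm (q - x)); nra.
have := dot_le (q - x) v; rewrite nv mulr1; nra.
Qed.

Lemma tproj_quad x Q w K r : tproj x Q -> 0 <= K -> 0 < r ->
  (forall z, M z -> enorm (z - x) < r -> - K * enorm (z - x) ^+ 2 <= dot (z - x) w) ->
  w *m Q = 0.
Proof.
move=> tx K0 r0 h; have Mx : M x by case: tx => T [[]].
have [U [V [phi [psi [hc hJ]]]]] := tproj_orth w tx.
by apply/hJ; exact: quad_orth hc K0 r0 h.
Qed.

Lemma normal_tproj x Q w : tproj x Q -> normal_at x w -> w *m Q = 0.
Proof.
move=> tx hw; have h0 : 0 <= enorm w / (2 * rho) by rewrite divr_ge0 ?enorm_ge0 ?mulr_ge0 ?(ltW rho0).
apply: (tproj_quad tx h0 ltr01) => z Mz _.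
by have := hw z Mz; rewrite mulrAC ler_norml mulNr => /andP[].
Qed.

Lemma tproj_dist x Q z : tproj x Q -> M z ->
  enorm ((z - x) - (z - x) *m Q) <= enorm (z - x) ^+ 2 / (2 * rho).
Proof.
move=> tx Mz; have [T [_ hQ]] := tx; set w := _ - (_ *m Q).
have [->|w0] := eqVneq w 0; first by rewrite enorm0 divr_ge0 ?sqr_ge0// mulr_ge0// ltW.
have nw := enorm_gt0 w0.
have := tproj_normal tx (orth_compl_proj (z - x) hQ) Mz.
rewrite (orth_compl_sq _ hQ) -/w ger0_norm ?sqr_ge0// expr2 -mulrA.
by rewrite ler_pM2l.
Qed.

(** Minimise |(x - p) Q - y| over M in the closed r-ball. As r <= rho / 2, the normal part of x - p
    is at most a quarter of its length, so 3/4 |x - p| <= 2 |y| <= 2 r / 3 and the minimiser is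
    interior. Its residual g is then normal at x and lies in T_p, so transversality gives g = 0. *)
Lemma tproj_surj_aux p Q r y : tproj p Q -> 0 < r -> r <= rho / 2 ->
  (forall x w, M x -> enorm (x - p) < r -> w *m Q = w -> normal_at x w -> w = 0) ->
  y *m Q = y -> enorm y <= r / 3 -> exists x, [/\ M x, enorm (x - p) < r & (x - p) *m Q = y].
Proof.
move=> tp r0 rr htr yQ yr; have Mp : M p by case: tp => T [[]].
have [T [_ hQ]] := tp.
pose F x := enorm ((x - p) *m Q - y).
have cF : continuous F.
  apply: (@enorm_lip_continuous _ _ _ 1) => a b; rewrite mul1r.
  rewrite (le_trans (enorm_Lip _ _))// opprB addrA subrK -mulmxBl opprB addrA subrK.
  exact: orth_proj_le hQ.
pose B := M `&` [set x | enorm (x - p) <= r].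
have B0 : B !=set0 by exists p; split => //=; rewrite subrr enorm0 ltW.
have cB : compact B by apply: compact_closedI => //; exact: closed_eball.
have [|x xB hx] := @EVT_min_rV R n F B B0 cB; first exact: continuous_subspaceT.
rewrite inE in xB; have [Mx xr] := xB; rewrite /= in xr.
have Fp : F x <= enorm y.
  have := hx p; rewrite inE => /(_ _)/(le_trans _); rewrite /F subrr mul0mx sub0r enormN.
  by apply => //; split => //=; rewrite subrr enorm0 ltW.
have xQ : enorm ((x - p) *m Q) <= 2 * enorm y.
  have := enormD ((x - p) *m Q - y) y; rewrite subrK; move: Fp; rewrite /F; lra.
have xr' : enorm (x - p) < r.
  have h1 := tproj_dist tp Mx.
  have h2 := enormD ((x - p) *m Q) ((x - p) - (x - p) *m Q).
  rewrite addrC subrK in h2.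
  have nx := enorm_ge0 (x - p).
  have h3 : enorm (x - p) ^+ 2 / (2 * rho) <= enorm (x - p) / 4.
    rewrite ler_pdivrMr ?mulr_gt0//; nra.
  lra.
pose g := (x - p) *m Q - y.
have gQ : g *m Q = g by rewrite mulmxBl yQ (orth_proj_idem _ hQ).
have [Q' tx] := tproj_exists Mx.
suff g0 : g = 0 by exists x; split => //; apply/eqP; rewrite -subr_eq0 -/g g0.
apply: (htr x g Mx xr' gQ); apply: (tproj_normal tx).
have h12 : 0 <= 1/2 :> R by lra.
apply: (@tproj_quad x Q' g (1/2) (r - enorm (x - p)) tx) => //; first by rewrite subr_gt0.
move=> z Mz zr.
have : F x <= F z.
  apply: hx; rewrite inE; split => //=.
  by rewrite (le_trans (enorm_triB z x p))//; lra.
rewrite /F -/g.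
have -> : (z - p) *m Q - y = g + (z - x) *m Q.
  by rewrite /g [RHS]addrAC -mulmxDl; congr (_ *m _ - _); rewrite [RHS]addrC addrA subrK.
move=> Fz; have : enorm g ^+ 2 <= enorm (g + (z - x) *m Q) ^+ 2.
  by rewrite ler_pXn2r// ?nnegrE ?enorm_ge0.
rewrite (enorm_sq (g + _)) dot_sqD -!enorm_sq (dotC g) (orth_proj_dot _ _ hQ) gQ.
have : enorm ((z - x) *m Q) ^+ 2 <= enorm (z - x) ^+ 2.
  by rewrite ler_pXn2r// ?nnegrE ?enorm_ge0// (orth_proj_le _ hQ).
lra.
Qed.

Lemma closed_normal : closed [set z : 'rV[R]_n * 'rV[R]_n | normal_at z.1 z.2].
Proof.
have -> : [set z : 'rV[R]_n * 'rV[R]_n | normal_at z.1 z.2] =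
  \bigcap_(x in M) [set z : 'rV[R]_n * 'rV[R]_n |
     `|dot (x - z.1) z.2| - enorm z.2 * enorm (x - z.1) ^+ 2 / (2 * rho) <= 0].
  apply/seteqP; split => [z hz x Mx /=|z hz x Mx]; first by rewrite subr_le0; exact: hz.
  by have := hz x Mx; rewrite /= subr_le0.
apply: closed_bigI => x _.
apply: closed_comp (@closed_le _ 0) => z _.
have c1 : continuous (fun z : 'rV[R]_n * 'rV[R]_n => enorm z.2).
  move=> t; apply: (@continuous_comp _ _ _ snd (@enorm R n)); first exact: cvg_snd.
  by have := @enormB_continuous R n 0 t.2; rewrite (_ : (fun x => enorm (x - 0)) = @enorm R n)//; apply/funext => ?; rewrite subr0.
have c2 : continuous (fun z : 'rV[R]_n * 'rV[R]_n => enorm (x - z.1)).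
  move=> t; apply: (@continuous_comp _ _ _ fst (fun u : 'rV[R]_n => enorm (x - u))); first exact: cvg_fst.
  have := @enormB_continuous R n x t.1; rewrite (_ : (fun u => enorm (u - x)) = (fun u => enorm (x - u)))//.
  by apply/funext => ?; rewrite enormBC.
have c3 : continuous (fun z : 'rV[R]_n * 'rV[R]_n => dot (x - z.1) z.2).
  move=> t; apply: cvg_big => [|i _]; [exact: add_continuous|apply: cvgM].
    rewrite [X in X @ _](_ : _ = (fun z : 'rV[R]_n * 'rV[R]_n => x ord0 i - z.1 ord0 i)); last first.
      by apply/funext => u; rewrite !mxE.
    rewrite !mxE; apply: cvgB; first exact: cvg_cst.
    by apply: (@continuous_comp _ _ _ fst (fun u : 'rV[R]_n => u ord0 i)); [exact: cvg_fst|exact: coord_continuous].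
  by apply: (@continuous_comp _ _ _ snd (fun u : 'rV[R]_n => u ord0 i)); [exact: cvg_snd|exact: coord_continuous].
apply: cvgB; first by apply: cvg_norm; exact: c3.
apply: cvgMr_tmp; apply: cvgM; first exact: c1.
by rewrite expr2; apply: cvgM; exact: c2.
Qed.


(* Among the bad pairs (x, w), with w tangent at p and normal at x, take one with x closest to p. Up to that radius r the projection to T_p covers a ball, which gives two points of M that differ by 2r/3 along w, while normality of w at x bounds this by 4 r^2/rho. *)
Lemma tproj_transversal p Q x w : tproj p Q -> M x -> enorm (x - p) < rho / 6 ->
  w *m Q = w -> normal_at x w -> w = 0.
Proof.
move=> tp Mx xp wQ nxw; apply: contrapT => /eqP w0.
have [T [_ hQ]] := tp; have Mp : M p by case: tp => T' [[]].
pose K : set ('rV[R]_n * 'rV[R]_n) := (M `*` [set v | enorm (v - 0) <= 1]) `&`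
  ([set z | 1 <= enorm (z.2 - 0)] `&` ([set z | enorm (z.2 *m Q - z.2) <= 0] `&` [set z | normal_at z.1 z.2])).
have c2 (f : 'rV[R]_n -> R) : continuous f -> continuous (fun z : 'rV[R]_n * 'rV[R]_n => f z.2).
  by move=> cf t; apply: (@continuous_comp _ _ _ snd f); [exact: cvg_snd|exact: cf].
have cK : compact K.
  apply: compact_closedI; first by apply: compact_setX => //; exact: compact_eball.
  apply: closedI.
    apply: (@closed_comp _ _ (fun z : 'rV[R]_n * 'rV[R]_n => enorm (z.2 - 0)) [set y | 1 <= y]); last exact: closed_ge.
    by move=> z _; apply: (c2 (fun v => enorm (v - 0))); exact: enormB_continuous.
  apply: closedI; last exact: closed_normal.
  apply: closed_comp (@closed_le _ 0) => z _; apply: (c2 (fun v => enorm (v *m Q - v))).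
  apply: (@enorm_lip_continuous _ _ _ 1) => a b; rewrite mul1r.
  rewrite (le_trans (enorm_Lip _ _))//.
  have -> : a *m Q - a - (b *m Q - b) = - ((a - b) - (a - b) *m Q).
    by rewrite mulmxBl; apply/rowP => i; rewrite !mxE; ring.
  by rewrite enormN; exact: orth_compl_le hQ.
have KP y v : M y -> v != 0 -> v *m Q = v -> normal_at y v -> K (y, (enorm v)^-1 *: v).
  move=> My v0 vQ hv; have nv := enorm_gt0 v0.
  have n1 : enorm ((enorm v)^-1 *: v) = 1.
    by rewrite enormZ ger0_norm ?invr_ge0 ?enorm_ge0// mulVf ?gt_eqF.
  split; first by split => //=; rewrite subr0 n1.
  split; first by rewrite /= subr0 n1.
  split; first by rewrite /= -scalemxAl vQ subrr enorm0.
  move=> z Mz /=; rewrite n1 dotZr normrM ger0_norm ?invr_ge0 ?enorm_ge0//.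
  by rewrite mul1r ler_pdivrMl// mulrA; exact: hv.
have K0 : K !=set0 by exists (x, (enorm w)^-1 *: w); exact: KP.
have [|[a v] aK hmin] := @compact_EVT_min _ R (fun z : 'rV[R]_n * 'rV[R]_n => enorm (z.1 - p)) K K0 cK.
  apply: continuous_subspaceT => t.
  by apply: (@continuous_comp _ _ _ fst (fun u : 'rV[R]_n => enorm (u - p))); [exact: cvg_fst|exact: enormB_continuous].
rewrite inE in aK; case: aK => [[/= Ma v1] [v2 [vQ nv]]]; rewrite /= subr0 in v1 v2.
have {v1 v2} v1 : enorm v = 1 by apply/eqP; rewrite eq_le v1 v2.
have {}vQ : v *m Q = v.
  by apply/eqP; rewrite -subr_eq0; apply/eqP/enorm_eq0/eqP; rewrite eq_le vQ enorm_ge0.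
set r := enorm (a - p) in hmin.
have r6 : r < rho / 6.
  apply: le_lt_trans xp; have := hmin (x, (enorm w)^-1 *: w).
  by rewrite inE => /(_ (KP _ _ Mx w0 wQ nxw)).
have r0 : 0 < r.
  rewrite lt_def enorm_ge0 andbT; apply/eqP => /enorm_eq0/eqP; rewrite subr_eq0 => /eqP ap.
  move: nv; rewrite /= ap => nv; have := normal_tproj tp nv; rewrite vQ => v0.
  by move: v1; rewrite v0 enorm0 => /esym/eqP; rewrite oner_eq0.
have htr y u : M y -> enorm (y - p) < r -> u *m Q = u -> normal_at y u -> u = 0.
  move=> My yr uQ nyu; apply: contrapT => /eqP u0.
  have := hmin (y, (enorm u)^-1 *: u); rewrite inE => /(_ (KP _ _ My u0 uQ nyu)) /=.
  by rewrite leNgt yr.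
have rr : r <= rho / 2 by lra.
have surj (s : R) : `|s| = r / 3 -> exists y, [/\ M y, enorm (y - p) < r & (y - p) *m Q = s *: v].
  move=> hs; apply: tproj_surj_aux htr _ _ => //; first by rewrite -scalemxAl vQ.
  by rewrite enormZ v1 mulr1 hs.
have [|y1 [My1 y1r e1]] := surj (r / 3); first by rewrite ger0_norm//; lra.
have [|y2 [My2 y2r e2]] := surj (- (r / 3)); first by rewrite normrN ger0_norm//; lra.
have n1 := nv y1 My1; have n2 := nv y2 My2; rewrite /= v1 !mul1r in n1 n2.
have bd y : enorm (y - p) < r -> enorm (y - a) ^+ 2 / (2 * rho) <= 2 * r ^+ 2 / rho.
  move=> yr; have : enorm (y - a) <= 2 * r.
    by rewrite (le_trans (enorm_triB y p a))// (enormBC p a) -/r; lra.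
  have := enorm_ge0 (y - a) => h1 h2.
  rewrite ler_pdivrMr ?mulr_gt0// [leRHS](_ : _ = 4 * r ^+ 2); last by field; rewrite gt_eqF.
  nra.
have m1 := le_trans n1 (bd _ y1r); have m2 := le_trans n2 (bd _ y2r).
have e12 : dot (y1 - a) v - dot (y2 - a) v = 2 * (r / 3).
  rewrite -dotBl opprB addrA subrK -[y1 - y2](_ : (y1 - p) - (y2 - p) = _); last by rewrite opprB addrA subrK.
  by rewrite -vQ -(orth_proj_dot _ _ hQ) mulmxBl e1 e2 dotBl !dotZl -enorm_sq v1; ring.
move: m1 m2; rewrite !ler_norml => /andP[_ m1] /andP[m2 _].
have : 2 * (r / 3) <= 4 * r ^+ 2 / rho by rewrite -e12; lra.
rewrite ler_pdivlMr//; nra.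
Qed.

Lemma tproj_surj p Q r y : tproj p Q -> 0 < r -> r <= rho / 6 ->
  y *m Q = y -> enorm y <= r / 3 -> exists x, [/\ M x, enorm (x - p) < r & (x - p) *m Q = y].
Proof.
move=> tp r0 r6; apply: tproj_surj_aux => //; first lra.
by move=> x w Mx xr; apply: (tproj_transversal tp Mx); exact: lt_le_trans r6.
Qed.

(** Two points y1, y2 of M have displacements from x with tangential parts c u and -c u. Their
    difference is 2 c u up to s^2 / rho and lies in T_p up to 4 s^2 / rho; dividing 5 s^2 / rho by 2
    c = 2 s / (3 |u|) gives 15/2. *)
Lemma tproj_angle p Qp x Qx s u : tproj p Qp -> tproj x Qx -> 0 < s -> s <= rho / 6 ->
  enorm (x - p) <= s -> u *m Qx = u -> enorm (u - u *m Qp) <= 15/2 * (s / rho) * enorm u.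
Proof.
move=> tp tx s0 s6 xs uQ.
have [T [_ hQ]] := tx; have [T' [_ hP]] := tp.
have [->|u0] := eqVneq u 0; first by rewrite mul0mx subr0 enorm0 mulr0.
have nu := enorm_gt0 u0; pose c := s / 3 / enorm u.
have c0 : 0 < c by rewrite !divr_gt0.
have surj (b : R) : `|b| = c -> exists y, [/\ M y, enorm (y - x) < s & (y - x) *m Qx = b *: u].
  move=> hb; apply: tproj_surj tx s0 s6 _ _; first by rewrite -scalemxAl uQ.
  by rewrite enormZ hb divfK ?gt_eqF.
have [|y1 [My1 y1r e1]] := surj c; first by rewrite gtr0_norm.
have [|y2 [My2 y2r e2]] := surj (- c); first by rewrite normrN gtr0_norm.
have q1 := tproj_dist tx My1; have q2 := tproj_dist tx My2.
have q3 := tproj_dist tp My1; have q4 := tproj_dist tp My2.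
have bd y (t : R) : 0 <= t -> enorm y <= t * s -> enorm y ^+ 2 / (2 * rho) <= t ^+ 2 / 2 * (s ^+ 2 / rho).
  move=> t0 h; rewrite [leRHS](_ : _ = (t * s) ^+ 2 / (2 * rho)); last by field; rewrite gt_eqF.
  rewrite ler_wpM2r ?invr_ge0 ?mulr_ge0 ?(ltW rho0)//.
  by rewrite ler_pXn2r// ?nnegrE ?enorm_ge0// mulr_ge0// ltW.
have b1 := le_trans q1 (bd (y1 - x) 1 ler01 ltac:(by rewrite mul1r ltW)).
have b2 := le_trans q2 (bd (y2 - x) 1 ler01 ltac:(by rewrite mul1r ltW)).
have b3 : enorm (y1 - p - (y1 - p) *m Qp) <= 2 * (s ^+ 2 / rho).
  apply: le_trans q3 _; have := bd (y1 - p) 2 (ler0n _ 2) ltac:(by have := enorm_triB y1 x p; lra); lra.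
have b4 : enorm (y2 - p - (y2 - p) *m Qp) <= 2 * (s ^+ 2 / rho).
  apply: le_trans q4 _; have := bd (y2 - p) 2 (ler0n _ 2) ltac:(by have := enorm_triB y2 x p; lra); lra.
set f1 := _ - _ *m Qx in b1; set f2 := _ - _ *m Qx in b2.
set g1 := _ - _ *m Qp in b3; set g2 := _ - _ *m Qp in b4.
have key : (2 * c) *: (u - u *m Qp) = (g1 - g2) - ((f1 - f2) - (f1 - f2) *m Qp).
  have ef : f1 - f2 = (y1 - y2) - (2 * c) *: u.
    rewrite /f1 /f2 e1 e2; apply/rowP => i; rewrite !mxE; ring.
  have eg : g1 - g2 = (y1 - y2) - (y1 - y2) *m Qp.
    rewrite /g1 /g2 !mulmxBl; generalize (y1 *m Qp) (y2 *m Qp) (p *m Qp) => A B C.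
    by apply/rowP => i; rewrite !mxE; ring.
  rewrite ef eg (mulmxBl (y1 - y2) ((2 * c) *: u) Qp) -scalemxAl scalerBr; generalize (y1 - y2) => D.
  by apply/rowP => i; rewrite !mxE; ring.
have : enorm ((2 * c) *: (u - u *m Qp)) <= 5 * (s ^+ 2 / rho).
  rewrite key (le_trans (enormB _ _))//.
  have h1 := enormB g1 g2; have h2 := orth_compl_le (f1 - f2) hP; have h3 := enormB f1 f2; lra.
have c2 : 0 < 2 * c by rewrite mulr_gt0.
rewrite enormZ (gtr0_norm c2) -ler_pdivlMl// => h; apply: (le_trans h).
rewrite le_eqVlt; apply/orP; left; apply/eqP; rewrite /c; field; rewrite !gt_eqF//.
Qed.

(** The chord leaves T_x by at most s / rho of its length and T_x is tilted against T_p by 15/2 * s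
    / rho; the total 17/2 * 1/20 is below 1/2. *)
Lemma tproj_bilip p Q s x x' : tproj p Q -> 0 < s -> s <= rho / 20 ->
  M x -> M x' -> enorm (x - p) <= s -> enorm (x' - p) <= s ->
  enorm (x' - x) <= 2 * enorm ((x' - x) *m Q).
Proof.
move=> tp s0 s20 Mx Mx' xs xs'; have [Qx tx] := tproj_exists Mx.
have [T [_ hQ]] := tx; have [T' [_ hP]] := tp.
set v := x' - x; have nv := enorm_ge0 v.
have v2 : enorm v <= 2 * s.
  by rewrite /v (le_trans (enorm_triB x' p x))// (enormBC p x); lra.
have h1 : enorm (v - v *m Qx) <= s / rho * enorm v.
  rewrite (le_trans (tproj_dist tx Mx'))// -/v ler_pdivrMr ?mulr_gt0//.
  rewrite [leRHS](_ : _ = 2 * s * enorm v); last by field; rewrite gt_eqF.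
  by rewrite expr2 ler_wpM2r.
have h2 : enorm (v *m Qx - v *m Qx *m Q) <= 15/2 * (s / rho) * enorm (v *m Qx).
  apply: (tproj_angle tp tx) => //; [lra|exact: orth_proj_idem hQ].
have h3 := orth_proj_le v hQ.
have sr : s / rho <= 1/20 by rewrite ler_pdivrMr//; lra.
have sr0 : 0 <= s / rho by rewrite divr_ge0// ltW.
have e : v - v *m Q = (v - v *m Qx - (v - v *m Qx) *m Q) + (v *m Qx - v *m Qx *m Q).
  rewrite (mulmxBl v (v *m Qx) Q); generalize (v *m Qx *m Q) (v *m Q) (v *m Qx) v => A B C D.
  by apply/rowP => i; rewrite !mxE; ring.
have h4 := orth_compl_le (v - v *m Qx) hP.
have h5 : enorm (v - v *m Q) <= 17/2 * (s / rho) * enorm v.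
  rewrite e (le_trans (enormD _ _))//.
  have : 15/2 * (s / rho) * enorm (v *m Qx) <= 15/2 * (s / rho) * enorm v.
    by rewrite ler_wpM2l// mulr_ge0.
  lra.
have h6 : enorm v <= enorm (v *m Q) + enorm (v - v *m Q).
  by rewrite (le_trans _ (enormD _ _))// addrC subrK.
have : 17/2 * (s / rho) * enorm v <= 1/2 * enorm v by rewrite ler_wpM2r//; lra.
lra.
Qed.

End Manifold.

(** * Hausdorff measure *)

Section Hausdorff.
Variable R : realType.

Lemma omega_gt0 d : 0 < omega R d.
Proof.
suff : 0 < omega R d /\ 0 < omega R d.+1 by case.
elim: d => [|d [h1 h2]]; first by split; rewrite /= ?ltr01 ?ltr0n.
by split => //; rewrite [omega R d.+2]/= mulr_gt0// divr_gt0// mulr_gt0// pi_gt0.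
Qed.

Lemma diam_ge0 n (C : set 'rV[R]_n) : 0 <= diam C.
Proof.
rewrite /diam; set S := [set _ | _ in _ & _ in _].
have [->|/set0P[e [x Cx [y Cy exy]]]] := eqVneq S set0; first by rewrite sup0.
have [hs|hs] := pselect (has_sup S); last by rewrite sup_out.
apply: le_trans (enorm_ge0 (x - y)) _; apply: sup_upper_bound => //.
by exists x => //; exists y.
Qed.

Lemma diam_ub n (C : set 'rV[R]_n) r x y : bounded_by C r -> C x -> C y ->
  enorm (x - y) <= diam C.
Proof.
move=> hb Cx Cy; apply: sup_upper_bound; last by exists x => //; exists y.
split; first by exists (enorm (x - y)), x => //; exists y.
by exists r => _ [a Ca [b Cb <-]]; exact: hb.
Qed.

Lemma diam_le n (C : set 'rV[R]_n) r : 0 <= r -> bounded_by C r -> diam C <= r.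
Proof.
move=> r0 hb; rewrite /diam; set S := [set _ | _ in _ & _ in _].
have [->|/set0P S0] := eqVneq S set0; first by rewrite sup0.
by apply: ge_sup => // _ [a Ca [b Cb <-]]; exact: hb.
Qed.

Lemma hausdorff_lip n m d (A : set 'rV[R]_m) (B : set 'rV[R]_n) (F : 'rV[R]_n -> 'rV[R]_m) L :
  0 < L -> A `<=` F @` B ->
  (forall b b', B b -> B b' -> enorm (F b - F b') <= L * enorm (b - b')) ->
  (hausdorff d A <= (L ^+ d)%:E * hausdorff d B)%E.
Proof.
move=> L0 AB hF; have Ld : 0 < L ^+ d by rewrite exprn_gt0.
apply: ge_ereal_sup => _ [delta /= d0 <-].
apply: (@le_trans _ _ ((L ^+ d)%:E * hausdorff_delta d (delta / L) B)%E); last first.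
  rewrite lee_pmul2l ?fin_numE// ?lte_fin//; apply: ereal_sup_ubound.
  by exists (delta / L) => //=; rewrite divr_gt0.
rewrite -lee_pdivrMl//; apply: le_ereal_inf_tmp => _ [Cs [BC hC ->]].
rewrite lee_pdivrMl//.
pose Cs' i := F @` (Cs i `&` B).
apply: (@le_trans _ _ (\sum_(0 <= i <oo) (omega R d * (diam (Cs' i) / 2) ^+ d)%:E)%E).
  apply: ereal_inf_lbound; exists Cs'; split => //.
    move=> a /AB[b Bb <-]; have [i _ Ci] := BC b Bb; exists i => //.
    by exists b.
  move=> i; have [r rd hb] := hC i; exists (L * r).
    by rewrite mulrC -ltr_pdivlMr.
  move=> _ _ [b [Cb Bb] <-] [b' [Cb' Bb'] <-].
  by rewrite (le_trans (hF _ _ Bb Bb'))// ler_pM2l//; exact: hb.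
rewrite -nneseriesZl; last first.
  move=> i _; rewrite lee_fin mulr_ge0 ?exprn_ge0 ?divr_ge0 ?diam_ge0//.
  exact: ltW (omega_gt0 d).
apply: lee_nneseries => [i _ _|i _].
  by rewrite lee_fin mulr_ge0 ?exprn_ge0 ?divr_ge0 ?diam_ge0 ?(ltW (omega_gt0 d)).
rewrite -EFinM lee_fin mulrCA ler_pM2l ?omega_gt0// -exprMn.
rewrite lerXn2r ?nnegrE ?mulr_ge0 ?divr_ge0 ?diam_ge0 ?(ltW L0)//.
rewrite mulrA ler_wpM2r//; apply: diam_le; first by rewrite mulr_ge0 ?diam_ge0// ltW.
have [r rd hb] := hC i.
move=> _ _ [b [Cb Bb] <-] [b' [Cb' Bb'] <-].
rewrite (le_trans (hF _ _ Bb Bb'))// ler_pM2l//; exact: diam_ub hb _ _.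
Qed.

Lemma hausdorff_mono n d (A B : set 'rV[R]_n) : A `<=` B -> (hausdorff d A <= hausdorff d B)%E.
Proof.
move=> AB; have := @hausdorff_lip n n d A B id 1 ltr01; rewrite expr1n mul1e; apply.
  by move=> a /AB Ba; exists a.
by move=> b b' _ _; rewrite mul1r.
Qed.

(** Finite-difference form of the fact that t / (1 + |t|) has derivative (1 + |t|)^-2; the factor 2
    pays for steps up to 1. *)
Lemma slope_le (s t : R) : 0 < s -> s <= 1 ->
  (1 + `|t|) ^- 2 <= 2 / s * ((t + s) / (1 + `|t + s|) - t / (1 + `|t|)).
Proof.
move=> s0 s1; rewrite mulrAC ler_pdivlMr//.
have [t0|t0] := leP 0 t.
  rewrite !ger0_norm ?addr_ge0 ?(ltW s0)//.
  have a0 : 0 < 1 + t by lra.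
  have b0 : 0 < 1 + (t + s) by lra.
  rewrite [leRHS](_ : _ = (1 + t) ^- 2 * (2 * s * ((1 + t) / (1 + (t + s))))); last first.
    by field; rewrite ?gt_eqF.
  rewrite ler_wpM2l ?invr_ge0 ?sqr_ge0// -ler_pdivrMl ?mulr_gt0//.
  rewrite [leLHS](_ : _ = 1/2); last by field; rewrite gt_eqF.
  by rewrite ler_pdivlMr//; lra.
rewrite ltr0_norm//.
have a0 : 0 < 1 - t by lra.
have [t1|t1] := leP (t + s) 0.
  rewrite ler0_norm//.
  have b0 : 0 < 1 - (t + s) by lra.
  rewrite [leRHS](_ : _ = (1 - t) ^- 2 * (s * (2 * ((1 - t) / (1 - (t + s)))))); last first.
    by field; rewrite ?gt_eqF.
  rewrite ler_wpM2l ?invr_ge0 ?sqr_ge0// ler_peMr ?(ltW s0)//.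
  by rewrite mulrA ler_pdivlMr//; lra.
rewrite gtr0_norm//.
have b0 : 0 < 1 + (t + s) by lra.
have h1 : (1 - t) ^- 2 <= 1.
  by rewrite invf_le1 ?exprn_gt0// expr_ge1//; lra.
have h2 : (t + s) / 2 <= (t + s) / (1 + (t + s)).
  by rewrite ler_wpM2l ?lef_pV2 ?posrE//; lra.
have h3 : - t / 2 <= - t / (1 - t).
  by rewrite ler_wpM2l ?lef_pV2 ?posrE//; lra.
rewrite mulNr in h3.
have : (1 - t) ^- 2 * s <= s by rewrite ler_piMl// ltW.
rewrite mulNr in h3; lra.
Qed.

(** By telescoping, since t / (1 + |t|) stays in [-1, 1]; hence the uniformity in the shift a and
    the number q of points. *)
Lemma weight_sum_le (s a : R) q : 0 < s -> s <= 1 ->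
  \sum_(j < q) (1 + `|a + s * j%:R|) ^- 2 <= 4 / s.
Proof.
move=> s0 s1; pose Phi (t : R) := t / (1 + `|t|).
have Phi1 t : -1 <= Phi t <= 1.
  have h : 0 < 1 + `|t| by rewrite ltr_wpDr.
  have : `|Phi t| <= 1 by rewrite /Phi normrM normfV (gtr0_norm h) ler_pdivrMr// mul1r; lra.
  by rewrite ler_norml.
suff H : \sum_(j < q) (1 + `|a + s * j%:R|) ^- 2 <= 2 / s * (Phi (a + s * q%:R) - Phi a).
  apply: le_trans H _; have /andP[h1 h2] := Phi1 (a + s * q%:R); have /andP[h3 h4] := Phi1 a.
  have : 2 / s * (Phi (a + s * q%:R) - Phi a) <= 2 / s * 2 by rewrite ler_wpM2l ?divr_ge0 ?(ltW s0)//; lra.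
  have -> : 2 / s * 2 = 4 / s by field; rewrite gt_eqF.
  by [].
elim: q => [|q IH]; first by rewrite big_ord0 mulr0 addr0 subrr mulr0.
rewrite big_ord_recr /=; have := slope_le (a + s * q%:R) s0 s1.
have -> : a + s * q.+1%:R = a + s * q%:R + s by rewrite -natr1; ring.
move: IH; rewrite /Phi; lra.
Qed.

(** A volume bound by counting grid points, with a product weight in place of the indicator of a
    ball. For a grid point in the i-th ball the rescaled coordinates satisfy sum |t_k| <= d by
    Cauchy-Schwarz, so (1 + |t|)^-2 >= e^(-2|t|) gives e^(2d) prod w >= 1. Summed over the grid, the
    product splits into d one-dimensional sums, each at most 2 q r_i. *)
Lemma cover_cube d K (z : 'I_K -> 'rV[R]_d) (r : 'I_K -> R) : (0 < d)%N ->
  (forall i, 0 < r i) ->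
  (forall u : 'rV[R]_d, (forall k, `|u ord0 k| <= (Num.sqrt d%:R)^-1) -> exists i, enorm (u - z i) < r i) ->
  1 <= (2 * expR 2) ^+ d * \sum_i r i ^+ d.
Proof.
move=> d0 r0 hc; have d0' : 0 < d%:R :> R by rewrite ltr0n.
set D := Num.sqrt d%:R in hc; have D0 : 0 < D by rewrite sqrtr_gt0.
(* The grid is fine against every radius, so that the rescaled step is at most 1 as [weight_sum_le]
   asks. *)
have [q [q0 hq]] : exists q, (0 < q)%N /\ forall i, 2 / (q%:R * r i) <= 1.
  pose q := (\max_i (Num.truncn (2 / r i))).+1.
  exists q; split => // i; rewrite ler_pdivrMr ?mulr_gt0// mul1r -ler_pdivrMr//.
  have : (Num.truncn (2 / r i) < q)%N by rewrite ltnS (leq_bigmax i).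
  rewrite -(ler_nat R) => h; apply: le_trans h; apply: ltW.
  by rewrite truncnS_gt.
have q0' : 0 < q%:R :> R by rewrite ltr0n.
pose x (j : 'I_q) : R := (2 * j%:R / q%:R - 1) / D.
pose pt (g : {ffun 'I_d -> 'I_q}) : 'rV[R]_d := \row_k x (g k).
pose w i k j := (1 + `|D * (x j - z i ord0 k) / r i|) ^- 2.
have xD j : `|x j| <= D^-1.
  rewrite /x normrM (gtr0_norm (_ : 0 < D^-1)) ?invr_gt0// ler_piMl ?invr_ge0 ?(ltW D0)//.
  have : 2 * j%:R / q%:R <= 2 :> R.
    by rewrite ler_pdivrMr// ler_pM2l// ler_nat ltnW.
  have : 0 <= 2 * j%:R / q%:R :> R by rewrite divr_ge0// mulr_ge0.
  by rewrite ler_norml => *; apply/andP; split; lra.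
have cov (g : {ffun 'I_d -> 'I_q}) : 1 <= \sum_i expR 2 ^+ d * \prod_k w i k (g k).
  have w0 i : 0 <= expR 2 ^+ d * \prod_k w i k (g k).
    by rewrite mulr_ge0 ?exprn_ge0 ?expR_ge0//; apply: prodr_ge0 => k _; rewrite invr_ge0 sqr_ge0.
  have [|i hi] := hc (pt g); first by move=> k; rewrite mxE.
  rewrite (bigD1 i)//= -[leLHS]addr0 lerD//; last by apply: sumr_ge0.
  pose t k := D * (x (g k) - z i ord0 k) / r i.
  have ht : \sum_k `|t k| <= d%:R.
    pose v : 'rV[R]_d := \row_k `|x (g k) - z i ord0 k|.
    have nv : enorm v = enorm (pt g - z i).
      by congr Num.sqrt; apply: eq_bigr => k _; rewrite !mxE real_normK ?num_real.
    have n1 : enorm (const_mx 1 : 'rV[R]_d) = D.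
      rewrite /enorm (eq_bigr (fun=> 1)); last by move=> k _; rewrite mxE expr1n.
      by rewrite sumr_const card_ord.
    have -> : \sum_k `|t k| = D / r i * dot v (const_mx 1).
      rewrite mulr_sumr; apply: eq_bigr => k _; rewrite !mxE mulr1 /t !normrM.
      by rewrite normfV (gtr0_norm D0) (gtr0_norm (r0 i)) mulrAC.
    have h1 := dot_le v (const_mx 1); rewrite nv n1 in h1.
    have DD : D * D = d%:R by rewrite -expr2 sqr_sqrtr.
    have h2 : dot v (const_mx 1) <= r i * D.
      by rewrite (le_trans h1)// ler_pM2r// ltW.
    rewrite (le_trans (ler_wpM2l _ h2)) ?divr_ge0 ?(ltW D0) ?(ltW (r0 i))//.
    by rewrite mulrA divfK ?gt_eqF// DD.
  apply: (@le_trans _ _ (expR 2 ^+ d * \prod_k expR (- (2 * `|t k|)))); last first.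
    rewrite ler_wpM2l ?exprn_ge0 ?expR_ge0//; apply: ler_prod => k _; rewrite expR_ge0/=.
    rewrite expRN /w -/(t k) lef_pV2 ?posrE ?expR_gt0 ?exprn_gt0 ?ltr_wpDr//.
    have := expR_ge1Dx `|t k|; rewrite mulr2n mulrDl mul1r expRD -expr2 => h.
    by rewrite ler_pXn2r// ?nnegrE ?expR_ge0// addr_ge0.
  rewrite -expR_sum -expRM_natl -expRD -[leLHS]expR0 ler_expR sumrN -mulr_sumr.
  lra.
have sum1 i k : \sum_j w i k j <= 2 * q%:R * r i.
  have := @weight_sum_le (2 / (q%:R * r i)) ((- 1 - D * z i ord0 k) / r i) q.
  rewrite divr_gt0 ?mulr_gt0// => /(_ isT (hq i)).
  rewrite [X in _ -> _ <= X](_ : _ = 4 / (2 / (q%:R * r i))); last by field; rewrite !gt_eqF.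
  move=> h; apply: le_trans h; apply: ler_sum => j _; rewrite /w /x.
  rewrite [X in `|X|](_ : _ = (- 1 - D * z i ord0 k) / r i + 2 / (q%:R * r i) * j%:R)//.
  by field; rewrite !gt_eqF.
have : \sum_(g : {ffun 'I_d -> 'I_q}) (1 : R) <= \sum_(g : {ffun 'I_d -> 'I_q}) \sum_i expR 2 ^+ d * \prod_k w i k (g k).
  by apply: ler_sum => g _; exact: cov.
rewrite sumr_const card_ffun !card_ord exchange_big /=.
under eq_bigr do rewrite -mulr_sumr -(bigA_distr_bigA (fun k j => w _ k j)).
move=> h; have {}h : (q ^ d)%N%:R <= \sum_i expR 2 ^+ d * (2 * q%:R * r i) ^+ d.
  apply: le_trans h _; apply: ler_sum => i _; rewrite ler_wpM2l ?exprn_ge0 ?expR_ge0//.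
  rewrite -[d in leRHS]card_ord -prodr_const; apply: ler_prod => k _; rewrite sum1 andbT.
  by apply: sumr_ge0 => j _; rewrite invr_ge0 sqr_ge0.
have qd : 0 < q%:R ^+ d :> R by rewrite exprn_gt0.
rewrite -(ler_pM2l qd) mulr1 -natrX (le_trans h)// natrX mulrA mulr_sumr.
by apply: ler_sum => i _; rewrite !exprMn le_eqVlt; apply/orP; left; apply/eqP; ring.
Qed.


Lemma geometric_half_le (e : R) K : 0 <= e -> \sum_(i < K) e / 2 ^+ i.+1 <= e.
Proof.
move=> e0; suff -> : \sum_(i < K) e / 2 ^+ i.+1 = e - e / 2 ^+ K.
  by rewrite gerBl divr_ge0// exprn_ge0.
elim: K => [|K IH]; first by rewrite big_ord0 expr0 divr1 subrr.
rewrite big_ord_recr /= IH exprS; have : (2 : R) ^+ K != 0 by rewrite expf_neq0.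
by move=> h; field.
Qed.

Definition unit_ball d : set 'rV[R]_d := [set u | enorm u <= 1].

(** Compactness extracts finitely many open balls centred in the covering sets; the radii exceed the
    diameters by e / 2^(i+1), as a diameter can be zero. The unit ball contains the cube of half
    side 1 / sqrt d, where [cover_cube] applies. In 8 e^2, 2 e^2 comes from the cube, 2 from the
    enlarged radii and 2 from diameter against radius. *)
Lemma ball_hausdorff_ge d : (0 < d)%N ->
  ((omega R d * (8 * expR 2) ^- d)%:E <= hausdorff d (@unit_ball d))%E.
Proof.
move=> d0; have C0 : 0 < (2 * expR 2 : R) by rewrite mulr_gt0// expR_gt0.
apply: (@le_trans _ _ (hausdorff_delta d 1 (@unit_ball d))); last first.
  by apply: ereal_sup_ubound; exists 1 => //; exact: ltr01.
apply: le_ereal_inf_tmp => _ [Cs [BC hC ->]].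
have term0 i : 0 <= omega R d * (diam (Cs i) / 2) ^+ d.
  by rewrite mulr_ge0 ?exprn_ge0 ?divr_ge0 ?diam_ge0// ltW// omega_gt0.
pose k : R := omega R d / 2 ^+ d.
have k0 : 0 < k by rewrite divr_gt0 ?omega_gt0// exprn_gt0.
apply/lee_addgt0Pr => eps eps0.
pose e := Num.min 1 (eps / k).
have e0 : 0 < e by rewrite lt_min ltr01 divr_gt0.
have e1 : e <= 1 by rewrite ge_min lexx.
have ek : k * e <= eps by rewrite mulrC -ler_pdivlMr// ge_min lexx orbT.
pose t i : R := e / 2 ^+ i.+1.
have t0 i : 0 < t i by rewrite divr_gt0// exprn_gt0.
have t1 i : t i <= 1.
  rewrite ler_pdivrMr ?exprn_gt0// mul1r (le_trans e1)// exprn_ege1//; lra.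
pose z i : 'rV[R]_d := xget 0 (Cs i).
have [K hK] : exists K, forall u : 'rV[R]_d, (forall k, `|u ord0 k| <= (Num.sqrt d%:R)^-1) ->
    exists i : 'I_K, enorm (u - z i) < diam (Cs i) + t i.
  move: (@compact_eball R d 0 1); rewrite compact_cover => /(_ nat setT (fun i => [set u | enorm (u - z i) < diam (Cs i) + t i])).
  case.
  - by move=> i _; exact: open_eball.
  - move=> u Au; have [|i _ Ci] := BC u; first by move: Au; rewrite /= subr0.
    exists i => //=; have [r _ hr] := hC i.
    rewrite (@le_lt_trans _ _ (diam (Cs i)))//; last by rewrite ltrDl.
    by apply: (diam_ub hr) => //; apply: (@xgetPex _ 0 (Cs i)); exists u.
  move=> D' _ hD'; exists (\max_(i <- finmap.enum_fset D') i).+1 => u hu.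
  have [|i iD' hi] := hD' u.
    rewrite /= subr0; apply: enorm_le => //; rewrite -enorm_sq enorm_sum_sq expr1n.
    apply: (@le_trans _ _ (\sum_(i < d) d%:R^-1)); last first.
      by rewrite sumr_const card_ord -[_ *+ d]mulr_natr mulVf// pnatr_eq0 -lt0n.
    apply: ler_sum => i _.
    have : `|u ord0 i| ^+ 2 <= (Num.sqrt d%:R)^-1 ^+ 2.
      by rewrite ler_pXn2r ?nnegrE ?invr_ge0 ?sqrtr_ge0// hu.
    by rewrite exprVn sqr_sqrtr// real_normK ?num_real.
  have iK : (i < (\max_(i <- finmap.enum_fset D') i).+1)%N.
    by rewrite ltnS; exact: (@leq_bigmax_seq _ _ xpredT (fun i => i) i iD').
  by exists (Ordinal iK).
have := cover_cube (z := fun i : 'I_K => z i) (r := fun i : 'I_K => diam (Cs i) + t i) d0.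
move=> /(_ _ hK) hcc.
have {}hcc : 1 <= (2 * expR 2) ^+ d * \sum_(i < K) (diam (Cs i) + t i) ^+ d.
  by apply: hcc => i; rewrite ltr_wpDl// diam_ge0.
pose S := \sum_(i < K) diam (Cs i) ^+ d.
have hS : \sum_(i < K) (diam (Cs i) + t i) ^+ d <= 2 ^+ d * (S + e).
  apply: (@le_trans _ _ (\sum_(i < K) 2 ^+ d * (diam (Cs i) ^+ d + t i))).
    apply: ler_sum => i _; have h0 := diam_ge0 (Cs i); have h1 := t0 i.
    have td : t i ^+ d <= t i by rewrite -[leRHS]expr1 ler_wiXn2l// ltW.
    have [dt|dt] := leP (diam (Cs i)) (t i).
      apply: (@le_trans _ _ ((2 * t i) ^+ d)).
        by rewrite lerXn2r// ?nnegrE; lra.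
      rewrite exprMn ler_wpM2l ?exprn_ge0// (le_trans td)// lerDr exprn_ge0//.
    apply: (@le_trans _ _ ((2 * diam (Cs i)) ^+ d)).
      by rewrite lerXn2r// ?nnegrE; lra.
    by rewrite exprMn ler_wpM2l ?exprn_ge0// lerDl ltW.
  rewrite -mulr_sumr ler_wpM2l ?exprn_ge0// big_split /= lerD2l.
  by apply: geometric_half_le; exact: ltW.
have hS2 : (4 * expR 2) ^- d <= S + e.
  have p : 0 < (4 * expR 2 : R) ^+ d by rewrite exprn_gt0// mulr_gt0// expR_gt0.
  rewrite -[leLHS]mulr1 ler_pdivrMl// (le_trans hcc)//.
  rewrite (le_trans (ler_wpM2l _ hS)) ?exprn_ge0 ?(ltW C0)//.
  rewrite mulrA -exprMn (_ : 2 * expR 2 * 2 = 4 * expR 2 :> R)//; ring.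
have hk : omega R d * (8 * expR 2) ^- d <= k * S + eps.
  have -> : omega R d * (8 * expR 2) ^- d = k * (4 * expR 2) ^- d.
    rewrite /k -mulrA -invfM -exprMn (_ : 2 * (4 * expR 2) = 8 * expR 2 :> R)//; ring.
  apply: (@le_trans _ _ (k * (S + e))); first by rewrite ler_pM2l.
  by rewrite mulrDr lerD2l.
apply: (@le_trans _ _ ((k * S)%:E + eps%:E)%E); first by rewrite -EFinD lee_fin.
rewrite leeD2r//.
apply: (@le_trans _ _ (\sum_(0 <= i < K) (omega R d * (diam (Cs i) / 2) ^+ d)%:E)%E).
  rewrite big_mkord sumEFin lee_fin /S mulr_sumr; apply: ler_sum => i _.
  by rewrite /k expr_div_n mulrAC mulrA.
by apply: nneseries_lim_ge => i _; rewrite lee_fin.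
Qed.

End Hausdorff.

(** * Mass of small balls and caps *)

Section BallMass.
Variable R : realType.

Lemma closed_measurable n (A : set 'rV[R]_n) : closed A -> measurable (A : set (BorelRn R n)).
Proof.
move=> cA; rewrite -[A]setCK; apply: measurableC; apply: sub_sigma_algebra.
exact: closed_openC.
Qed.

Lemma open_measurable n (A : set 'rV[R]_n) : open A -> measurable (A : set (BorelRn R n)).
Proof. by move=> oA; apply: sub_sigma_algebra. Qed.

(** The lower bound on distances makes F injective on A, so choosing preimages yields an inverse
    that is Lipschitz on the image. *)
Lemma hausdorff_inv_lip n m d (A : set 'rV[R]_m) (B : set 'rV[R]_n) (F : 'rV[R]_m -> 'rV[R]_n) L :
  0 < L -> (forall a, A a -> B (F a)) ->
  (forall a a', A a -> A a' -> enorm (a - a') <= L * enorm (F a - F a')) ->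
  (hausdorff d A <= (L ^+ d)%:E * hausdorff d B)%E.
Proof.
move=> L0 AB hF; pose G b := xget 0 [set a | A a /\ F a = b].
have GF a : A a -> G (F a) = a.
  move=> Aa; rewrite /G; case: xgetP => [a' _ [Aa' eF]|/(_ a)]; last by case.
  apply/eqP; rewrite -subr_eq0; apply/eqP/enorm_eq0/eqP; rewrite eq_le enorm_ge0 andbT.
  by apply: (le_trans (hF _ _ Aa' Aa)); rewrite eF subrr enorm0 mulr0.
apply: (@le_trans _ _ ((L ^+ d)%:E * hausdorff d (F @` A))%E).
  apply: (@hausdorff_lip _ _ _ _ _ _ G) => //.
    by move=> a Aa; exists (F a); [exists a|exact: GF].
  by move=> _ _ [a Aa <-] [a' Aa' <-]; rewrite !GF//; exact: hF.
apply: lee_wpmul2l; first by rewrite lee_fin exprn_ge0// ltW.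
by apply: hausdorff_mono => _ [a Aa <-]; exact: AB.
Qed.


Variables (n d : nat) (M : set 'rV[R]_n) (rho : R).
Hypothesis hM : @manifold_class R n d rho M.
Hypothesis rho0 : 0 < rho.
Let tproj := @tproj R n d M.

Lemma tproj_basis p Q : tproj p Q ->
  exists U : 'M[R]_(d, n), U *m U^T = 1%:M /\ U^T *m U = Q.
Proof.
move=> tp; have rQ := tproj_rank tp; have [T [_ hQ]] := tp.
have [U [UU eU]] := orthobasis Q; move: U UU eU; rewrite rQ => U UU eU.
exists U; split => //; apply: (orth_proj_uniq _ hQ).
by apply: orthobasis_proj => //; apply: (eqmx_trans eU); have [_ [_ /eqmxP]] := hQ.
Qed.

(** Projection to T_p, rescaled by 1 / s, sends this piece of M into the unit ball, and by
    [tproj_bilip] its inverse has Lipschitz constant 2 s. *)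
Lemma ball_hausdorff_le p Q s : tproj p Q -> 0 < s -> s <= rho / 20 ->
  (hausdorff d (M `&` [set x | (enorm (x - p) <= s)%R]) <=
   ((2 * s) ^+ d)%:E * hausdorff d (@unit_ball R d))%E.
Proof.
move=> tp s0 s20; have [U [UU UQ]] := tproj_basis tp.
have nU v : enorm (v *m U^T) = enorm (v *m Q) by rewrite -(orthobasis_norm _ UU) -mulmxA UQ.
have [T [_ hQ]] := tp.
apply: (@hausdorff_inv_lip _ _ _ _ _ (fun x => s^-1 *: ((x - p) *m U^T))).
- by rewrite mulr_gt0.
- move=> x [_ xs]; rewrite /unit_ball /= enormZ nU ger0_norm ?invr_ge0 ?(ltW s0)//.
  rewrite mulrC ler_pdivrMr// mul1r; apply: le_trans xs; exact: orth_proj_le hQ.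
- move=> x x' [Mx xs] [Mx' xs'].
  rewrite -scalerBr -mulmxBl enormZ nU ger0_norm ?invr_ge0 ?(ltW s0)// mulrA mulfK ?gt_eqF//.
  have -> : x - p - (x' - p) = x - x' by rewrite opprB addrA subrK.
  exact: (tproj_bilip hM rho0 tp s0 s20).
Qed.

(** The projection of M covers the ball of radius h / 16 about (h / 4) w in T_p, whose points have
    norm at most 5/16 h, a third of 15/16 h. Lifted points satisfy <x - x0, w> >= (1/4 - 1/16 -
    1/100) h >= h / 8 and |x - x0| <= (15/16 + 1/100) h. *)
Lemma cap_hausdorff_ge p Q x0 h w : tproj p Q -> 0 < h -> h <= rho / 6 ->
  enorm (p - x0) <= h / 100 -> w *m Q = w -> enorm w = 1 ->
  (hausdorff d (@unit_ball R d) <= ((16 / h) ^+ d)%:E *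
   hausdorff d ([set x | (enorm (x - x0) <= h)%R] `&` [set x | (h / 8 <= dot (x - x0) w)%R] `&` M))%E.
Proof.
move=> tp h0 h6 px wQ w1; have [U [UU UQ]] := tproj_basis tp.
have [T [_ hQ]] := tp.
have nU v : enorm (v *m U^T) = enorm (v *m Q) by rewrite -(orthobasis_norm _ UU) -mulmxA UQ.
pose y0 := (h / 4) *: w.
apply: (@hausdorff_lip _ _ _ _ _ _ (fun x => (16 / h) *: ((x - p) *m U^T - y0 *m U^T))).
- by rewrite divr_gt0.
- move=> v v1; pose y := y0 + (h / 16) *: (v *m U).
  have ny : enorm y <= 5 / 16 * h.
    apply: (le_trans (enormD _ _)); rewrite !enormZ w1 orthobasis_norm//.
    rewrite !ger0_norm ?divr_ge0 ?(ltW h0)//.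
    have : h / 16 * enorm v <= h / 16 * 1 by rewrite ler_wpM2l// divr_ge0// ltW.
    by lra.
  have yQ : y *m Q = y.
    by rewrite mulmxDl -!scalemxAl wQ -UQ mulmxA -(mulmxA v) UU mulmx1.
  have r0 : 0 < 15 / 16 * h by lra.
  have r6 : 15 / 16 * h <= rho / 6 by lra.
  have yr : enorm y <= 15 / 16 * h / 3 by lra.
  have [x [Mx xp xy]] := tproj_surj hM rho0 tp r0 r6 yQ yr.
  exists x; last first.
    rewrite -mulmxBl.
    have -> : (x - p - y0) *m U^T = (x - p - y0) *m Q *m U^T.
      by rewrite -UQ -!mulmxA UU mulmx1.
    rewrite mulmxBl xy -[y0 *m Q]scalemxAl wQ -/y0 addrC addKr -scalemxAl -mulmxA UU mulmx1.
    by rewrite scalerA -[RHS]scale1r; congr (_ *: _); field; rewrite gt_eqF.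
  split; last by [].
  split.
    rewrite /=; have -> : x - x0 = (x - p) + (p - x0) by rewrite addrA subrK.
    by apply: (le_trans (enormD _ _)); lra.
  rewrite /=; have -> : x - x0 = (x - p) + (p - x0) by rewrite addrA subrK.
  rewrite dotDl.
  have -> : dot (x - p) w = dot y w by rewrite -xy (orth_proj_dot _ _ hQ) wQ.
  have h1 : `|dot (p - x0) w| <= h / 100.
    by apply: (le_trans (dot_norm_le _ _)); rewrite w1 mulr1.
  have h2 : `|dot ((h / 16) *: (v *m U)) w| <= h / 16.
    apply: (le_trans (dot_norm_le _ _)); rewrite w1 mulr1 enormZ orthobasis_norm//.
    by rewrite ger0_norm ?divr_ge0 ?(ltW h0)// ler_piMr// divr_ge0// ltW.
  rewrite [dot y w]dotDl; have -> : dot y0 w = h / 4 by rewrite dotZl -enorm_sq w1 expr1n mulr1.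
  by move: h1 h2; rewrite !ler_norml => /andP[h1 h1'] /andP[h2 h2']; lra.
- move=> x x' _ _.
  rewrite -scalerBr enormZ ger0_norm ?divr_ge0 ?(ltW h0)// ler_wpM2l ?divr_ge0 ?(ltW h0)//.
  rewrite -!mulmxBl nU; have -> : x - p - y0 - (x' - p - y0) = x - x'.
    by rewrite opprB addrA subrK opprB addrA subrK.
  exact: orth_proj_le hQ.
Qed.

Section Mass.
Variables (fmin fmax L : R) (D : probability (BorelRn R n) R).
Variables (mu : {measure set (BorelRn R n) -> \bar R}) (f : 'rV[R]_n -> R).
Hypothesis hmod : model d rho fmin fmax L D M mu f.
Hypothesis fmin0 : 0 < fmin.

Let mM : measurable (M : set (BorelRn R n)).
Proof.
apply: closed_measurable; apply: compact_closed; first exact: norm_hausdorff.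
by case: hM.
Qed.

Lemma mass_support (A : set (BorelRn R n)) : measurable A -> D A = D (A `&` M).
Proof.
move=> mA; have [_ [hD _ _]] := hmod.
rewrite !hD ?measurableI//; last exact: measurableI.
by congr integral; rewrite -setIA setIid.
Qed.

Lemma mass_le (A : set (BorelRn R n)) : measurable A ->
  (D A <= fmax%:E * hausdorff d (A `&` M))%E.
Proof.
move=> mA; have [[_ hmu mf] [hD hf _]] := hmod.
have mAM : measurable (A `&` M) by exact: measurableI.
rewrite hD// -hmu// -(integral_cst mu mAM).
apply: ge0_le_integral => //.
- by move=> x [_ /hf /andP[h _]]; rewrite lee_fin; apply: le_trans h; exact: ltW.
- by apply/measurable_EFinP; apply: (measurable_funS mM _ mf) => x [].
- by move=> x [_ /hf /andP[_ h]]; rewrite lee_fin.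
Qed.

Lemma mass_ge (A : set (BorelRn R n)) : measurable A ->
  (fmin%:E * hausdorff d (A `&` M) <= D A)%E.
Proof.
move=> mA; have [[_ hmu mf] [hD hf _]] := hmod.
have mAM : measurable (A `&` M) by exact: measurableI.
rewrite hD// -hmu// -(integral_cst mu mAM).
apply: ge0_le_integral => //.
- by move=> x _; rewrite lee_fin ltW.
- by apply/measurable_EFinP; apply: (measurable_funS mM _ mf) => x [].
- by move=> x [_ /hf /andP[h _]]; rewrite lee_fin.
Qed.

(** The model supplies finiteness: fmin times the measure of M is at most 1, and the unit ball is
    covered by a Lipschitz image of a piece of M. *)
Lemma unit_ball_fin p Q : (0 < d)%N -> tproj p Q ->
  hausdorff d (@unit_ball R d) \is a fin_num.
Proof.
move=> d0 tp; have [U [UU UQ]] := tproj_basis tp.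
rewrite ge0_fin_numE; last first.
  by apply: le_trans (ball_hausdorff_ge _ d0); rewrite lee_fin mulr_ge0 ?(ltW (omega_gt0 _ _))// invr_ge0 exprn_ge0// mulr_ge0// expR_ge0.
pose w := ebasis R (Ordinal d0) *m U.
have w1 : enorm w = 1.
  rewrite orthobasis_norm// enormE dotE /ebasis trmx_delta mul_delta_mx mxE !eqxx/=.
  by rewrite sqrtr1.
have wQ : w *m Q = w by rewrite -UQ mulmxA -(mulmxA _ U) UU mulmx1.
have h0 : 0 < rho / 6 by rewrite divr_gt0.
have h1 : enorm (p - p) <= rho / 6 / 100 by rewrite subrr enorm0 !divr_ge0// ltW.
apply: (le_lt_trans (cap_hausdorff_ge tp h0 (lexx _) h1 wQ w1)).
apply: (@le_lt_trans _ _ (((16 / (rho / 6)) ^+ d)%:E * hausdorff d M)%E).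
  apply: lee_wpmul2l; first by rewrite lee_fin exprn_ge0// divr_ge0// ltW.
  by apply: hausdorff_mono => x [].
have hD1 : (fmin%:E * hausdorff d M <= 1)%E.
  by rewrite -[M]setTI; apply: (le_trans (mass_ge measurableT)); rewrite probability_setT.
have hfin : (hausdorff d M < +oo)%E.
  rewrite ltey; apply/eqP => e; move: hD1; by rewrite e gt0_muley ?lte_fin.
apply: lte_mul_pinfty => //; rewrite ?lee_fin ?exprn_ge0 ?divr_ge0 ?(ltW h0) ?(ltW rho0)//.
Qed.

End Mass.
End BallMass.

(** * Rounding to cells and step-function queries *)

Section Cells.
Variable R : realType.

Lemma ball_net n (e : R) : 0 < e -> exists K (g : 'I_K -> 'rV[R]_n),
  (forall k, enorm (g k) <= 1) /\ (forall u, enorm u <= 1 -> exists k, enorm (u - g k) < e).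
Proof.
move=> e0; move: (@compact_eball R n 0 1); rewrite compact_cover.
move=> /(_ _ [set u | enorm u <= 1] (fun v => [set u | enorm (u - v) < e])) [].
- by move=> v _; exact: open_eball.
- by move=> u /= u1; exists u; rewrite /= ?subrr ?enorm0//; move: u1; rewrite subr0.
move=> D' hD hc; pose s := finmap.enum_fset D'.
exists (size s), (fun i => nth 0 s i); split.
  by move=> k; have := hD _ (mem_nth 0 (ltn_ord k)); rewrite inE.
move=> u u1; have [|v vD hv] := hc u; first by rewrite /= subr0.
have vs : (index v s < size s)%N by rewrite index_mem.
by exists (Ordinal vs); rewrite /= nth_index.
Qed.

Variables (n K : nat) (g : 'I_K -> 'rV[R]_n) (x0 : 'rV[R]_n) (h e : R).

Let near k : set 'rV[R]_n := [set x | enorm (x - (x0 + h *: g k)) < h * e].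


(** Removing the earlier balls makes the cells disjoint, so that a query built on them is bounded by
    its largest coefficient. *)
Definition cell k : set 'rV[R]_n :=
  [set x | enorm (x - x0) <= h] `&` near k `\` \bigcup_(j in [set j : 'I_K | (j < k)%N]) near j.

Definition cell_query (a : 'I_K -> R) (x : BorelRn R n) : R := \sum_k a k * \1_(cell k) x.

Lemma cell_measurable k : measurable (cell k : set (BorelRn R n)).
Proof.
apply: (@measurableD _ (BorelRn R n)).
  apply: (@measurableI _ (BorelRn R n)); first exact: closed_measurable (@closed_eball _ _ _ _).
  exact: open_measurable (@open_eball _ _ _ _).
apply: (@fin_bigcup_measurable _ (BorelRn R n)); first exact: finite_finset.
by move=> j _; exact: open_measurable (@open_eball _ _ _ _).
Qed.

Lemma cell_inj i j x : cell i x -> cell j x -> i = j.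
Proof.
move=> [[_ hi] ni] [[_ hj] nj]; apply/val_inj/eqP; case: ltngtP => // ij.
  by case: nj; exists i.
by case: ni; exists j.
Qed.

Lemma cell_cover x : (forall u, enorm u <= 1 -> exists k, enorm (u - g k) < e) -> 0 < h ->
  enorm (x - x0) <= h -> exists k, cell k x.
Proof.
move=> hg h0 xh; have [|k hk] := hg (h^-1 *: (x - x0)).
  by rewrite enormZ gtr0_norm ?invr_gt0// mulrC ler_pdivrMr ?mul1r.
have nk : `[< near k x >].
  apply/asboolP; rewrite /near /=; have -> : x - (x0 + h *: g k) = h *: (h^-1 *: (x - x0) - g k).
    by rewrite scalerBr scalerA divff ?gt_eqF// scale1r opprD addrA.
  by rewrite enormZ gtr0_norm// ltr_pM2l.
case: (@arg_minnP _ k (fun j => `[< near j x >]) (fun j : 'I_K => val j) nk) => i /asboolP ni imin; exists i; split => //.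
by move=> [j /= ji /asboolP/imin]; rewrite leqNgt ji.
Qed.

Lemma cell_near k x : 0 < h -> cell k x -> enorm (h^-1 *: (x - x0) - g k) < e.
Proof.
move=> h0 [[_]]; rewrite /near /=; have -> : x - (x0 + h *: g k) = h *: (h^-1 *: (x - x0) - g k).
  by rewrite scalerBr scalerA divff ?gt_eqF// scale1r opprD addrA.
by rewrite enormZ gtr0_norm// ltr_pM2l.
Qed.

Lemma cell_query_le a c x : 0 <= c -> (forall k, `|a k| <= c) -> `|cell_query a x| <= c.
Proof.
move=> c0 ha; rewrite /cell_query.
have [[k hk]|nk] := pselect (exists k, cell k x); last first.
  rewrite big1 ?normr0// => k _; rewrite indicE memNset ?mulr0// => hk.
  by apply: nk; exists k.
rewrite (bigD1 k)//= big1 ?addr0.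
  by rewrite indicE mem_set// mulr1.
move=> j jk; rewrite indicE memNset ?mulr0// => hj; move/eqP: jk; apply.
exact: cell_inj hj hk.
Qed.

Lemma cell_query_measurable a : measurable_fun setT (cell_query a).
Proof.
apply: measurable_sum => k; apply: measurable_funM => //.
by apply: measurable_indic; exact: cell_measurable.
Qed.

Variable D : probability (BorelRn R n) R.

Definition cell_mass k : R := fine (D (cell k)).

Lemma cell_massE k : D (cell k) = (cell_mass k)%:E.
Proof. by rewrite /cell_mass fineK//; apply: fin_num_measure; exact: cell_measurable. Qed.

Lemma cell_mass_ge0 k : 0 <= cell_mass k.
Proof. exact: fine_ge0. Qed.

Lemma cell_massU (P : pred 'I_K) :
  D (\bigcup_(k in [set k | P k]) cell k) = (\sum_(k | P k) cell_mass k)%:E.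
Proof.
rewrite -sumEFin.
have -> : \bigcup_(k in [set k | P k]) cell k = \big[setU/set0]_(k < K | P k) cell k.
  rewrite -bigcup_seq_cond; apply: eq_bigcupl; split => k /=; rewrite mem_index_enum//.
rewrite measure_bigsetU_ord_cond.
- by apply: eq_bigr => k _; rewrite -cell_massE.
- by move=> k _; exact: cell_measurable.
- by move=> i j _ _ [x [hi hj]]; exact: cell_inj hi hj.
Qed.

Lemma cell_query_integral a : (\int[D]_x (cell_query a x)%:E = (\sum_k a k * cell_mass k)%:E)%E.
Proof.
have hi k : D.-integrable setT (fun x : BorelRn R n => ((a k)%:E * (\1_(cell k) x)%:E)%E).
  by apply: integrableZl => //; apply: integrable_indic; exact: cell_measurable.
rewrite -sumEFin; under eq_integral do rewrite /cell_query -sumEFin.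
under eq_integral do under eq_bigr do rewrite EFinM.
rewrite integral_sum//; apply: eq_bigr => k _.
rewrite integralZl//; last by apply: integrable_indic; exact: cell_measurable.
by rewrite integral_indic// ?setIT ?EFinM -?cell_massE//; exact: cell_measurable.
Qed.

Lemma cell_mass_sum_le1 : \sum_k cell_mass k <= 1.
Proof.
rewrite -lee_fin -(cell_massU xpredT); apply: probability_le1.
by apply: fin_bigcup_measurable => [|k _]; [exact: finite_finset|exact: cell_measurable].
Qed.

End Cells.

(** * Cell masses near x0: total, normal deviation and tangential spread *)

Section LocalMass.
Variables (R : realType) (n d : nat) (M : set 'rV[R]_n) (rho : R).
Hypothesis hM : @manifold_class R n d rho M.
Hypothesis rho0 : 0 < rho.
Variables (x0 p : 'rV[R]_n) (h e : R).
Hypothesis h0 : 0 < h.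
Hypothesis hh : h <= rho / 40.
Hypothesis px : enorm (p - x0) <= h / 100.

Let h20 : 2 * h <= rho / 20. Proof. by move: hh => ?; lra. Qed.
Let h6 : h <= rho / 6. Proof. by move: hh rho0 => ? ?; lra. Qed.
Let ball_p x : enorm (x - x0) <= h -> enorm (x - p) <= 2 * h.
Proof.
move=> xh; have -> : x - p = (x - x0) - (p - x0) by rewrite opprB addrA subrK.
by apply: (le_trans (enormB _ _)); move: h0 px => ? ?; lra.
Qed.
Let cap_le (a b : R) : e <= 1 / 16 -> 1 / 8 <= a -> b <= e -> 1 / 16 <= a - b.
Proof. by move=> *; lra. Qed.
Let sq16 : 256^-1 = (1 / 16) ^+ 2 :> R. Proof. by field. Qed.

Variables (fmin fmax L : R) (D : probability (BorelRn R n) R).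
Variables (mu : {measure set (BorelRn R n) -> \bar R}) (f : 'rV[R]_n -> R).
Hypothesis hmod : model d rho fmin fmax L D M mu f.
Hypothesis fmin0 : 0 < fmin.
Hypothesis d0 : (0 < d)%N.
Variables (K : nat) (g : 'I_K -> 'rV[R]_n) (Q : 'M[R]_n).
Hypothesis tp : @tproj R n d M p Q.
Hypothesis gnet : forall u, enorm u <= 1 -> exists k, enorm (u - g k) < e.

Let kap : R := fine (hausdorff d (@unit_ball R d)).
Let P k := cell_mass g x0 h e D k.

Let kapE : hausdorff d (@unit_ball R d) = kap%:E.
Proof. by rewrite /kap fineK// (unit_ball_fin hM rho0 hmod fmin0 d0 tp). Qed.

Lemma cell_mass_sum_le : 0 <= fmax -> \sum_k P k <= fmax * ((4 * h) ^+ d * kap).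
Proof.
move=> fmax0; rewrite -lee_fin -(cell_massU _ _ _ _ _ xpredT).
set A := \bigcup_(k in _) _.
have mA : measurable (A : set (BorelRn R n)).
  by apply: fin_bigcup_measurable => [|k _]; [exact: finite_finset|exact: cell_measurable].
apply: (le_trans (mass_le hM hmod fmin0 mA)).
rewrite EFinM; apply: lee_wpmul2l; first by rewrite lee_fin.
rewrite EFinM -kapE (_ : 4 * h = 2 * (2 * h)); last by ring.
apply: le_trans (ball_hausdorff_le hM rho0 tp _ _); last first.
- exact: h20.
- by rewrite mulr_gt0.
apply: hausdorff_mono => x [[k _ [[/= xh _] _]] Mx]; split => //=; exact: ball_p.
Qed.

(** A cell with mass contains a point x of M. The three terms are the rounding of x to the centre,
    its distance to the tangent plane, at most (2 h)^2 / (2 rho), and the offset of p from x0, the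
    last two divided by h. *)
Lemma cell_mass_normal k : P k != 0 ->
  enorm (g k - g k *m Q) <= e + 2 * (h / rho) + enorm (p - x0) / h.
Proof.
move=> Pk; have mk : measurable (cell g x0 h e k : set (BorelRn R n)) by exact: cell_measurable.
have [x [ck Mx]] : exists x, cell g x0 h e k x /\ M x.
  apply: contrapT => hn; move/eqP: Pk; apply; rewrite /P /cell_mass.
  rewrite (mass_support hM hmod mk) (_ : _ `&` _ = set0) ?measure0//.
  by rewrite -subset0 => x [ck Mx]; apply: hn; exists x.
have [T [_ hQ]] := tp.
pose N (v : 'rV[R]_n) := v - v *m Q.
have ND u v : N (u + v) = N u + N v by rewrite /N mulmxDl opprD addrACA.
have NZ (c : R) v : N (c *: v) = c *: N v by rewrite /N -scalemxAl scalerBr.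
have Nle v : enorm (N v) <= enorm v by exact: orth_compl_le hQ.
have hg : g k = (g k - h^-1 *: (x - x0)) + (h^-1 *: (x - p) + h^-1 *: (p - x0)).
  by rewrite -scalerDr addrA subrK subrK.
rewrite -/(N (g k)) hg ND (le_trans (enormD _ _))// -addrA lerD//.
  apply: (le_trans (Nle _)); rewrite enormBC; apply: ltW; exact: (cell_near h0 ck).
rewrite ND (le_trans (enormD _ _))// lerD//; last first.
  by rewrite (le_trans (Nle _))// enormZ gtr0_norm ?invr_gt0// mulrC.
rewrite NZ enormZ gtr0_norm ?invr_gt0//.
have xp : enorm (x - p) <= 2 * h.
  by apply: ball_p; case: ck => [[]].
have := tproj_dist hM rho0 tp Mx; rewrite -/(N _) => hN.
rewrite mulrC ler_pdivrMr// (le_trans hN)// ler_pdivrMr ?mulr_gt0//.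
have -> : 2 * (h / rho) * h * (2 * rho) = (2 * h) ^+ 2 by field; rewrite gt_eqF.
by rewrite ler_pXn2r ?nnegrE ?enorm_ge0// mulr_ge0// ltW.
Qed.

(** Cells meeting the cap have <g_k, w> >= 1/8 - e >= 1/16 and together carry at least the mass of
    the cap; 256 is 16^2. *)
Lemma cell_mass_spread w : e <= 1 / 16 -> w *m Q = w -> enorm w = 1 ->
  fmin * ((h / 16) ^+ d * kap) / 256 <= \sum_k P k * dot (g k) w ^+ 2.
Proof.
move=> e16 wQ w1.
pose A := [set x | enorm (x - x0) <= h] `&` [set x | h / 8 <= dot (x - x0) w].
have mA : measurable (A : set (BorelRn R n)).
  apply: closed_measurable; apply: closedI; first exact: closed_eball.
  rewrite (_ : [set x | _] = [set x | h / 8 <= dot w (x - x0)]); last first.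
    by apply/seteqP; split => x /=; rewrite dotC.
  by apply: closed_comp (@closed_ge _ (h / 8)) => x _; exact: dot_continuous.
pose S := [pred k | 1 / 16 <= dot (g k) w].
have hk : (((h / 16) ^+ d * kap)%:E <= hausdorff d (A `&` M))%E.
  have := cap_hausdorff_ge hM rho0 tp h0 h6 px wQ w1; rewrite kapE -/A => hc.
  have hp : 0 < (h / 16) ^+ d by rewrite exprn_gt0// divr_gt0.
  have := lee_wpmul2l (x := ((h / 16) ^+ d)%:E) _ hc.
  rewrite lee_fin ltW// => /(_ isT); rewrite -EFinM muleA -EFinM -exprMn.
  by rewrite (_ : h / 16 * (16 / h) = 1) ?expr1n ?mul1e//; field; rewrite gt_eqF.
have hS : fmin * ((h / 16) ^+ d * kap) <= \sum_(k | S k) P k.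
  rewrite -lee_fin -(cell_massU _ _ _ _ _ S).
  apply: (@le_trans _ _ (D A)).
    apply: le_trans (mass_ge hM hmod fmin0 mA); rewrite EFinM.
    by apply: lee_wpmul2l => //; rewrite lee_fin ltW.
  apply: le_measure; rewrite ?inE//.
    by apply: fin_bigcup_measurable => [|k _]; [exact: finite_finset|exact: cell_measurable].
  move=> x [/= xh xw]; have [k ck] := cell_cover gnet h0 xh; exists k => //=.
  have hn := cell_near h0 ck.
  have -> : g k = h^-1 *: (x - x0) - (h^-1 *: (x - x0) - g k) by rewrite opprB addrC subrK.
  rewrite dotBl dotZl.
  have h1 : `|dot (h^-1 *: (x - x0) - g k) w| <= e.
    by apply: (le_trans (dot_norm_le _ _)); rewrite w1 mulr1 ltW.
  have h2 : 1 / 8 <= h^-1 * dot (x - x0) w.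
    by rewrite ler_pdivlMl// mulrA mulr1.
  by move: h1; rewrite ler_norml => /andP[_ h1]; exact: cap_le.
apply: (le_trans (ler_wpM2r _ hS)) => //; rewrite mulr_suml.
rewrite [leRHS](bigID S) /= -[leLHS]addr0 lerD//; last first.
  by apply: sumr_ge0 => k _; rewrite mulr_ge0 ?sqr_ge0// cell_mass_ge0.
apply: ler_sum => k /= hk'; rewrite ler_wpM2l ?cell_mass_ge0// sq16.
by rewrite ler_pXn2r ?nnegrE// (le_trans _ hk').
Qed.

End LocalMass.

(** * Recovery of the second moment matrix *)

Section Decode.
Variable R : realType.

Lemma fnorm_outer n (u v : 'rV[R]_n) : fnorm (u^T *m v) = enorm u * enorm v.
Proof.
apply/eqP; rewrite -(@eqrXn2 _ 2)// ?mulr_ge0 ?enorm_ge0 ?fnorm_ge0//; apply/eqP.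
rewrite fnorm_sq exprMn !enorm_sum_sq mulr_suml; apply: eq_bigr => i _.
rewrite mulr_sumr; apply: eq_bigr => j _.
by rewrite mxE big_ord1 mxE exprMn.
Qed.

Lemma rank_outer n (u v : 'rV[R]_n) : (\rank (u^T *m v) <= 1)%N.
Proof. by apply: (leq_trans (mulmx_max_rank _ _)). Qed.

Variables (n d m : nat) (S : 'I_m -> 'rV[R]_(n * n)) (e1 C0 : R).
Hypothesis e10 : 0 < e1.
Hypothesis C00 : 0 < C0.
Hypothesis m0 : (0 < m)%N.
Hypothesis rip : forall X : 'M[R]_n, (\rank X <= 2 * d)%N ->
  e1 * m%:R * fnorm X ^+ 2 <= \sum_j dot (S j) (mxvec X) ^+ 2 /\
  \sum_j dot (S j) (mxvec X) ^+ 2 <= C0 * m%:R * fnorm X ^+ 2.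

(** The scaling makes the upper isometry constant 1: sensing is a contraction up to rank 2 d, the
    rank of a difference of two candidates. *)
Definition sense (X : 'M[R]_n) : 'rV[R]_m :=
  \row_j ((Num.sqrt (C0 * m%:R))^-1 * dot (S j) (mxvec X)).

Lemma senseD X Y : sense (X + Y) = sense X + sense Y.
Proof. by apply/rowP => j; rewrite !mxE linearD /= dotC dotDl mulrDr !(dotC _ (S j)). Qed.

Lemma senseZ c X : sense (c *: X) = c *: sense X.
Proof. by apply/rowP => j; rewrite !mxE linearZ /= dotC dotZl mulrCA dotC. Qed.

Lemma senseB X Y : sense (X - Y) = sense X - sense Y.
Proof. by rewrite senseD -scaleN1r senseZ scaleN1r. Qed.

Lemma sense_sum I (r : seq I) (F : I -> 'M[R]_n) :
  sense (\sum_(i <- r) F i) = \sum_(i <- r) sense (F i).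
Proof.
elim: r => [|i r IH]; last by rewrite !big_cons senseD IH.
by rewrite !big_nil -[X in sense X](scale0r 0) senseZ scale0r.
Qed.

Let Cm0 : 0 < C0 * m%:R. Proof. by rewrite mulr_gt0// ltr0n. Qed.

Lemma sense_sq X : enorm (sense X) ^+ 2 = (\sum_j dot (S j) (mxvec X) ^+ 2) / (C0 * m%:R).
Proof.
rewrite enorm_sum_sq mulr_suml; apply: eq_bigr => j _.
by rewrite mxE exprMn exprVn sqr_sqrtr ?(ltW Cm0)// mulrC.
Qed.

Lemma sense_le X : (\rank X <= 2 * d)%N -> enorm (sense X) <= fnorm X.
Proof.
move=> /rip[_ h]; rewrite -(@ler_pXn2r _ 2)// ?nnegrE ?enorm_ge0//.
by rewrite sense_sq ler_pdivrMr// mulrC.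
Qed.

Lemma sense_ge X : (\rank X <= 2 * d)%N -> fnorm X <= Num.sqrt (C0 / e1) * enorm (sense X).
Proof.
move=> /rip[h _]; have Ce : 0 <= C0 / e1 by rewrite divr_ge0 ?ltW.
rewrite -(@ler_pXn2r _ 2)// ?nnegrE ?mulr_ge0 ?enorm_ge0 ?sqrtr_ge0//.
rewrite exprMn (sqr_sqrtr Ce) sense_sq.
have -> : C0 / e1 * ((\sum_j dot (S j) (mxvec X) ^+ 2) / (C0 * m%:R)) =
    (\sum_j dot (S j) (mxvec X) ^+ 2) / (e1 * m%:R).
  by field; rewrite !gt_eqF// ltr0n.
by rewrite ler_pdivlMr ?mulr_gt0 ?ltr0n// mulrC.
Qed.

(** The feasible set of the decoder: T carries a matrix X, not necessarily symmetric, that explains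
    the data b within D and is bounded below on T. Any two feasible T are close, so an arbitrary one
    may be output. *)
Definition decodes (b : 'rV[R]_m) (D lam : R) (T : 'M[R]_n) := \rank T = d /\
  exists P X, [/\ orth_proj T P, P *m X = X, enorm (b - sense X) <= D &
    forall u, lam * enorm (u *m P) <= enorm (u *m P *m X)].

(** X - Y has rank at most 2 d, so agreement of the measurements within 2 D passes to the Frobenius
    norm; [davis_kahan] in both directions and [proj_diff_le] double it to 4. *)
Lemma decodes_close b D lam T T' P Q : 0 < lam -> decodes b D lam T -> decodes b D lam T' ->
  orth_proj T P -> orth_proj T' Q ->
  opnorm (P - Q) <= 4 * Num.sqrt (C0 / e1) * D / lam.
Proof.
move=> lam0 [rT [P' [X [hP' PX bX lX]]]] [rT' [Q' [Y [hQ' QY bY lY]]]] hP hQ.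
have eP := orth_proj_uniq hP hP'; have eQ := orth_proj_uniq hQ hQ'; subst P' Q'.
have rP : \rank P = d by rewrite -rT; case: hP => _ [_ /eqmxP ->].
have rQ : \rank Q = d by rewrite -rT'; case: hQ => _ [_ /eqmxP ->].
have rX : (\rank X <= d)%N by rewrite -rP -PX mulmxE mxrankM_maxl.
have rY : (\rank Y <= d)%N by rewrite -rQ -QY mulmxE mxrankM_maxl.
have D0 : 0 <= D by apply: le_trans bX; exact: enorm_ge0.
pose E := Num.sqrt (C0 / e1) * (2 * D).
have E0 : 0 <= E by rewrite !mulr_ge0 ?sqrtr_ge0.
have hE : fnorm (X - Y) <= E.
  apply: (le_trans (sense_ge _)).
    rewrite mul2n -addnn (leq_trans (mxrank_add _ _))// leq_add//.
    by rewrite mxrank_opp.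
  apply: ler_wpM2l; first exact: sqrtr_ge0.
  have -> : sense (X - Y) = (b - sense Y) - (b - sense X).
    by rewrite senseB opprB [RHS]addrC addrA subrK.
  by apply: (le_trans (enormB _ _)); lra.
have hXY u : enorm (u *m (X - Y)) <= E * enorm u.
  by apply: (le_trans (fnorm_mulr _ _)); rewrite ler_wpM2r ?enorm_ge0.
have hYX u : enorm (u *m (Y - X)) <= E * enorm u.
  by rewrite -opprB mulmxN enormN; exact: hXY.
have h1 := davis_kahan lam0 E0 hP hQ PX QY lX hXY.
have h2 := davis_kahan lam0 E0 hQ hP QY PX lY hYX.
have := proj_diff_le (divr_ge0 E0 (ltW lam0)) hP hQ h1 h2.
move=> h; apply: (le_trans h); rewrite le_eqVlt; apply/orP; left; apply/eqP.
by rewrite /E; ring.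
Qed.

(** The witness is the moment matrix of the projected centres g_k Q. Its difference from the true
    moment may have large rank, so [sense_le] is applied termwise: with v = g - g Q, g^T g - (g Q)^T
    (g Q) = v^T g + (g Q)^T v is a sum of two rank-one matrices. *)
Lemma decodes_moment K (g : 'I_K -> 'rV[R]_n) (p : 'I_K -> R) b D0 D1 lam T Q :
  (0 < d)%N -> (forall k, enorm (g k) <= 1) -> (forall k, 0 <= p k) ->
  orth_proj T Q -> \rank T = d ->
  enorm (b - \sum_k p k *: sense ((g k)^T *m g k)) <= D1 ->
  \sum_k p k * enorm (g k - g k *m Q) <= D0 ->
  (forall w, w *m Q = w -> enorm w = 1 -> lam <= \sum_k p k * dot (g k) w ^+ 2) ->
  decodes b (2 * D0 + D1) lam T.
Proof.
move=> d0 g1 p0 hQ rT hb hD0 hl; split => //.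
pose Y := \sum_k p k *: ((g k *m Q)^T *m (g k *m Q)).
have [sQ [QQ _]] := hQ.
exists Q, Y; split => //.
- rewrite mulmx_sumr; apply: eq_bigr => k _.
  by rewrite -scalemxAr trmx_mul !mulmxA sQ QQ.
- have -> : b - sense Y = (b - \sum_k p k *: sense ((g k)^T *m g k)) +
      \sum_k p k *: (sense ((g k)^T *m g k) - sense ((g k *m Q)^T *m (g k *m Q))).
    rewrite (eq_bigr _ (fun k _ => scalerBr _ _ _)) sumrB addrA subrK sense_sum.
    by congr (_ - _); apply: eq_bigr => k _; rewrite senseZ.
  rewrite (le_trans (enormD _ _))// addrC lerD//.
  apply: (le_trans (enorm_bigsum _ _ _)); apply: le_trans (ler_wpM2l _ hD0) => //.
  rewrite mulr_sumr; apply: ler_sum => k _.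
  rewrite enormZ ger0_norm// mulrCA ler_wpM2l//.
  set v := g k - g k *m Q.
  have -> : sense ((g k)^T *m g k) - sense ((g k *m Q)^T *m (g k *m Q)) =
      sense (v^T *m g k) + sense ((g k *m Q)^T *m v).
    rewrite -senseB -senseD; congr sense.
    by rewrite /v mulmxBr linearB /= mulmxBl addrA subrK.
  have r1 (u w : 'rV[R]_n) : (\rank (u^T *m w) <= 2 * d)%N.
    by apply: (leq_trans (rank_outer _ _)); rewrite muln_gt0.
  rewrite (le_trans (enormD _ _))// (_ : 2 * enorm v = enorm v + enorm v); last by ring.
  rewrite lerD// (le_trans (sense_le (r1 _ _)))// fnorm_outer.
    by rewrite -[leRHS]mulr1 ler_wpM2l ?enorm_ge0.
  rewrite -[leRHS]mul1r ler_wpM2r ?enorm_ge0// (le_trans _ (g1 k))//.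
  exact: orth_proj_le hQ.
- move=> u; set w := u *m Q.
  have [w0|w0] := eqVneq w 0; first by rewrite w0 enorm0 mulr0 enorm_ge0.
  have nw : 0 < enorm w by exact: enorm_gt0.
  have wQ : w *m Q = w by rewrite /w -mulmxA QQ.
  have hq : lam * enorm w ^+ 2 <= dot (w *m Y) w.
    have := hl ((enorm w)^-1 *: w); rewrite -scalemxAl wQ enormZ ger0_norm ?invr_ge0 ?enorm_ge0//.
    rewrite mulVf ?gt_eqF// => /(_ erefl erefl) h.
    rewrite -ler_pdivlMr ?exprn_gt0//; apply: (le_trans h).
    rewrite mulmx_sumr dot_suml mulr_suml; apply: ler_sum => k _.
    rewrite -scalemxAr dotZl -mulrA ler_wpM2l//.
    have -> : dot (w *m ((g k *m Q)^T *m (g k *m Q))) w = dot (g k) w ^+ 2.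
      rewrite mulmxA [w *m _]mx11_scalar -dotE mul_scalar_mx dotZl.
      by rewrite (dotC w) (orth_proj_dot _ _ hQ) wQ expr2.
    by rewrite dotC dotZl exprMn exprVn mulrC dotC.
  have := le_trans hq (le_trans (ler_norm _) (dot_norm_le _ _)).
  by rewrite expr2 mulrA ler_pM2r.
Qed.

End Decode.

(** * The statistical query algorithm and its query count *)

Section Recovery.
Variable R : realType.

(** From 2^(l-1) < n follows l ln 2 <= 2 ln n. The construction costs only l^2; the remaining power
    ln(n)^4 is at least ln(2)^4. *)
Lemma up_log_sq_le n : (1 < n)%N -> (up_log 2 n)%:R ^+ 2 * ln (2 : R) ^+ 6 <= 4 * ln (n%:R : R) ^+ 6.
Proof.
move=> n1; have /andP[hl _] := up_log_bounds (isT : (1 < 2)%N) n1.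
set l := up_log 2 n in hl *.
have l0 : (0 < l)%N by rewrite /l up_log_gt0.
have L0 : 0 < ln (2 : R) by rewrite ln_gt0// ltr1n.
have L1 : ln (2 : R) <= ln (n%:R : R) by rewrite ler_ln ?posrE ?ltr0n ?ler_nat// (ltn_trans _ n1).
have h1 : l.-1%:R * ln (2 : R) <= ln (n%:R : R).
  rewrite mulr_natl -lnXn// ler_ln ?posrE ?exprn_gt0 ?ltr0n ?(ltn_trans _ n1)//.
  by rewrite -natrX ler_nat ltnW.
have h2 : l%:R * ln (2 : R) <= 2 * ln (n%:R : R).
  by rewrite -(prednK l0) -natr1 mulrDl mul1r mulr2n mulrDl mul1r lerD.
have h3 : (l%:R * ln (2 : R)) ^+ 2 <= (2 * ln (n%:R : R)) ^+ 2.
  by rewrite ler_pXn2r ?nnegrE ?mulr_ge0 ?(ltW L0) ?(le_trans (ltW L0) L1).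
have h4 : ln (2 : R) ^+ 4 <= ln (n%:R : R) ^+ 4.
  by rewrite ler_pXn2r ?nnegrE ?(ltW L0) ?(le_trans (ltW L0) L1).
have -> : (l%:R : R) ^+ 2 * ln (2 : R) ^+ 6 = (l%:R * ln (2 : R)) ^+ 2 * ln (2 : R) ^+ 4 by ring.
have -> : 4 * ln (n%:R : R) ^+ 6 = (2 * ln (n%:R : R)) ^+ 2 * ln (n%:R : R) ^+ 4 by ring.
by apply: ler_pM => //; rewrite ?sqr_ge0 ?exprn_ge0 ?(ltW L0).
Qed.

Lemma query_count (K1 K2 : nat) : (0 < K1)%N -> (0 < K2)%N -> exists C : R, 0 < C /\
  forall n d, (0 < d)%N -> (d < n)%N -> exists l l', [/\ (0 < l)%N, (n <= 2 ^ l)%N, (0 < l')%N,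
    (K1 * (n * (2 * d)) * l <= 2 ^ l')%N &
    (K2 * (K1 * (n * (2 * d)) * l) * l')%:R <= C * d%:R * n%:R * ln (n%:R) ^+ 6].
Proof.
move=> K10 K20; have L0 : 0 < ln (2 : R) by rewrite ln_gt0// ltr1n.
pose B := (K2 * K1 * 2 * (2 * K1 + 3))%N.
have B0 : (0 < B)%N by rewrite /B !muln_gt0 K10 K20 addn_gt0 orbT.
exists (B%:R * 4 / ln 2 ^+ 6); split.
  by rewrite divr_gt0 ?exprn_gt0// mulr_gt0// ltr0n.
move=> n d d0 dn; have n1 : (1 < n)%N by apply: leq_ltn_trans dn.
have hln := up_log_sq_le n1.
have /andP[_ hl] := up_log_bounds (isT : (1 < 2)%N) n1.
set l := up_log 2 n in hl hln *.
have l0 : (0 < l)%N by rewrite /l up_log_gt0.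
(* The frame lives in dimension 2 K1 (n d l): 2 K1 is at most 2^(2 K1), and n, d, l are each at most
   2^l. *)
exists l, (2 * K1 + 3 * l)%N; split => //.
- by rewrite addn_gt0 muln_gt0 K10.
- have -> : (K1 * (n * (2 * d)) * l = 2 * K1 * (n * d * l))%N by ring.
  rewrite expnD leq_mul ?(ltnW (ltn_expl _ _))// (mulnC 3) expnM.
  rewrite (_ : ((2 ^ l) ^ 3 = 2 ^ l * 2 ^ l * 2 ^ l)%N); last by ring.
  by rewrite !leq_mul ?(ltnW (ltn_expl _ _))// (leq_trans (ltnW dn)).
have h : (K2 * (K1 * (n * (2 * d)) * l) * (2 * K1 + 3 * l) <= B * (d * n * l ^ 2))%N.
  have -> : (K2 * (K1 * (n * (2 * d)) * l) * (2 * K1 + 3 * l) =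
    K2 * K1 * 2 * (d * n * l) * (2 * K1 + 3 * l))%N by ring.
  have -> : (B * (d * n * l ^ 2) = K2 * K1 * 2 * (d * n * l) * ((2 * K1 + 3) * l))%N.
    by rewrite /B; ring.
  by rewrite leq_mul// mulnDl leq_add2r leq_pmulr.
rewrite -(ler_nat R) in h; apply: (le_trans h).
rewrite natrM [(d * n * _)%:R]natrM natrX (natrM _ d).
have -> : B%:R * 4 / ln 2 ^+ 6 * d%:R * n%:R * ln (n%:R) ^+ 6 =
    B%:R * (d%:R * n%:R * (4 * ln (n%:R) ^+ 6 / ln 2 ^+ 6)) :> R by ring.
do 2 (apply: ler_wpM2l; first by rewrite ?mulr_ge0).
by rewrite ler_pdivlMr ?exprn_gt0.
Qed.

(** [D0] and [lam] come before the algorithm because its decoder tests feasibility with them. On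
    cell k the j-th query is the j-th Kashin coefficient of the sensed g_k^T g_k, divided by its
    bound Ka to land in [-1, 1]. Errors tau in the answers become sqrt C2 * Ka * tau after
    synthesis; the + 1 in C3 is the accuracy tau of the expansions. *)
Lemma sq_moment_recovery : exists C C4 : R, [/\ 0 < C, 0 < C4 &
  forall (n d K : nat) (g : 'I_K -> 'rV[R]_n) (x0 : 'rV[R]_n) (h e tau D0 lam : R),
    (0 < d)%N -> (d < n)%N -> (forall k, enorm (g k) <= 1) -> 0 < tau ->
    exists A : SQalg R n, [/\ SQvalid A, (nq A)%:R <= C * d%:R * n%:R * ln (n%:R) ^+ 6 &
    forall (D : probability (BorelRn R n) R) a, STAT_transcript D tau A a ->
      \rank (output A a) = d /\
      forall T P Q, orth_proj (output A a) P -> orth_proj T Q -> \rank T = d -> 0 < lam ->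
        \sum_k cell_mass g x0 h e D k * enorm (g k - g k *m Q) <= D0 ->
        (forall w, w *m Q = w -> enorm w = 1 ->
           lam <= \sum_k cell_mass g x0 h e D k * dot (g k) w ^+ 2) ->
        opnorm (P - Q) <= C4 * (D0 + tau) / lam]].
Proof.
have [e1 [C0 [K1 [e10 C00 K10 hrip]]]] := rip_exists R.
have [e2 [C2 [K2 [e20 C20 K20 hframe]]]] := frame_exists R.
have [C [Cgt0 hC]] := query_count K10 K20.
pose Ka := 2 / e2; have Ka0 : 0 < Ka by rewrite divr_gt0.
pose C3 := Num.sqrt C2 * Ka + 1.
have C30 : 0 < C3 by rewrite /C3 ltr_wpDl// mulr_ge0 ?sqrtr_ge0// ltW.
exists C, (4 * Num.sqrt (C0 / e1) * (2 + C3)); split => //.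
  by rewrite !mulr_gt0 ?sqrtr_gt0 ?divr_gt0// addr_gt0.
move=> n d K g x0 h e tau D0 lam d0 dn g1 tau0.
have [l [l' [l0 nl l'0 ml' hcount]]] := hC n d d0 dn.
have n0 : (0 < n)%N by apply: leq_ltn_trans dn.
have r0 : (0 < 2 * d)%N by rewrite muln_gt0.
have r2 : (2 * d <= 2 * n)%N by rewrite leq_mul// ltnW.
have [S hS] := hrip n (2 * d)%N l n0 r0 r2 l0 nl.
set m := (K1 * (n * (2 * d)) * l)%N in ml' hcount S hS.
have m0 : (0 < m)%N by rewrite /m !muln_gt0 K10 n0 d0 l0.
clearbody m.
have [S' [_ hS']] := hframe m l' m0 l'0 ml'.
set N := (K2 * m * l')%N in hcount S' hS'.
have N0 : (0 < N)%N by rewrite /N !muln_gt0 K20 m0 l'0.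
clearbody N.
pose y k := sense S C0 ((g k)^T *m g k).
have y1 k : enorm (y k) <= 1.
  rewrite (le_trans (@sense_le _ n d m S e1 C0 C00 m0 hS _ _))//.
    by apply: (leq_trans (rank_outer _ _)); rewrite muln_gt0.
  by rewrite fnorm_outer -[leRHS]mul1r ler_pM ?enorm_ge0.
have /choice[a ha] : forall k, exists a : 'I_N -> R,
    (forall j, `|a j| <= Ka) /\ enorm (y k - N%:R^-1 *: \sum_j a j *: S' j) <= tau.
  by move=> k; exact: kashin e20 C20 N0 hS' _ _ (y1 k) tau0.
(* The length of the history is the index of the query; lengths from N on give the zero query, so
   that validity holds for every history. *)
pose coef i k : R := oapp (fun j : 'I_N => a k j / Ka) 0 (insub i).
pose dec (s : seq R) : 'rV[R]_m := N%:R^-1 *: \sum_(j < N) (Ka * nth 0 s j) *: S' j.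
pose Dl := 2 * D0 + C3 * tau.
(* The default [pid_mx d] keeps the rank equal to d when nothing is feasible; under the moment
   hypotheses the true T is feasible, by [decodes_moment]. *)
pose out s : 'M[R]_n := xget (pid_mx d) [set T | decodes d S C0 (dec s) Dl lam T].
have rout s : \rank (out s) = d.
  by rewrite /out; case: xgetP => [T _ []//|_]; rewrite rank_pid_mx// ltnW.
exists {| nq := N; query := fun s => cell_query g x0 h e (coef (size s)); output := out |}.
split => //=.
- move=> s; split => [|x]; first exact: cell_query_measurable.
  rewrite -ler_norml; apply: cell_query_le => // k.
  rewrite /coef; case: insubP => [j _ _|_] /=; last by rewrite normr0.
  by rewrite normrM normfV (gtr0_norm Ka0) ler_pdivrMr// mul1r; case: (ha k).
move=> D s [sN hs]; split => // T P Q hP hQ rT lam0 hD0 hlam.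
pose p k := cell_mass g x0 h e D k.
have p0 k : 0 <= p k by exact: cell_mass_ge0.
have p1 : \sum_k p k <= 1 by exact: cell_mass_sum_le1.
pose q (j : 'I_N) := \sum_k a k j / Ka * p k.
have hq (j : 'I_N) : `|nth 0 s j - q j| <= tau.
  have := hs j (ltn_ord j); rewrite /= size_take sN ltn_ord cell_query_integral.
  rewrite !lee_fin /coef valK /= -/(q j) => /andP[h1 h2].
  by rewrite ler_norml; apply/andP; split; lra.
have hb : enorm (dec s - \sum_k p k *: y k) <= C3 * tau.
  have -> : dec s - \sum_k p k *: y k =
      N%:R^-1 *: \sum_(j < N) (Ka * (nth 0 s j - q j)) *: S' j -
      \sum_k p k *: (y k - N%:R^-1 *: \sum_j a k j *: S' j).
    have -> : \sum_k p k *: (y k - N%:R^-1 *: \sum_j a k j *: S' j) =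
        \sum_k p k *: y k - \sum_k p k *: (N%:R^-1 *: \sum_j a k j *: S' j).
      by rewrite -sumrB; apply: eq_bigr => k _; rewrite scalerBr.
    rewrite opprB addrA.
    congr (_ - _); rewrite /dec.
    have -> : \sum_k p k *: (N%:R^-1 *: \sum_j a k j *: S' j) =
        N%:R^-1 *: \sum_(j < N) (Ka * q j) *: S' j.
      under eq_bigr do rewrite scalerA mulrC -scalerA scaler_sumr.
      rewrite -scaler_sumr exchange_big /=; congr (_ *: _); apply: eq_bigr => j _.
      rewrite /q mulr_sumr scaler_suml; apply: eq_bigr => k _.
      by rewrite scalerA; congr (_ *: _); field; rewrite gt_eqF.
    rewrite -scalerDr -big_split /=; congr (_ *: _); apply: eq_bigr => j _.
    by rewrite -scalerDl -mulrDr subrK.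
  rewrite (le_trans (enormB _ _))// mulrDl mul1r lerD//.
    rewrite -(@ler_pXn2r _ 2)// ?nnegrE ?enorm_ge0 ?mulr_ge0 ?sqrtr_ge0 ?invr_ge0 ?(ltW e20) ?(ltW tau0)//.
    rewrite -mulrA exprMn (sqr_sqrtr (ltW C20)).
    apply: frame_sum_le => //; first by apply: mulr_ge0; apply: ltW.
      by move=> z; case: (hS' z).
    by move=> j; rewrite normrM (gtr0_norm Ka0) ler_wpM2l ?(ltW Ka0).
  apply: (le_trans (enorm_bigsum _ _ _)).
  apply: (@le_trans _ _ (\sum_k p k * tau)).
    by apply: ler_sum => k _; rewrite enormZ ger0_norm// ler_wpM2l//; case: (ha k).
  by rewrite -mulr_suml ler_piMl// ltW.
have hT : decodes d S C0 (dec s) Dl lam T.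
  exact: (@decodes_moment _ n d m S e1 C0 C00 m0 hS _ g p _ _ _ _ _ _ d0 g1 p0 hQ rT hb hD0 hlam).
have hO : decodes d S C0 (dec s) Dl lam (out s).
  by rewrite /out; case: xgetP => [T' _ //|/(_ T)].
apply: (le_trans (@decodes_close _ n d m S e1 C0 e10 C00 m0 hS _ _ _ _ _ _ _ lam0 hO hT hP hQ)).
rewrite ler_wpM2r ?invr_ge0 ?(ltW lam0)// -[leRHS]mulrA ler_wpM2l ?mulr_ge0 ?sqrtr_ge0//.
have D00 : 0 <= D0.
  by apply: le_trans hD0; apply: sumr_ge0 => k _; rewrite mulr_ge0 ?enorm_ge0// cell_mass_ge0.
have := mulr_ge0 (ltW C30) D00; rewrite /Dl; lra.
Qed.

End Recovery.

(** * Constants of the final bound and trivial algorithms *)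

Section Rate.
Variable R : realType.

(** With W = (rho dl)^d kap, the mass bound and the eigenvalue bound are multiples of W, and
    [om <= kap * E ^+ d] bounds tau by one too, so W cancels. The factor 1280 is 5 * 256. *)
Lemma rate_le d (C4 E dl fmax fmin rho kap om tau : R) : (0 < d)%N -> 0 < C4 -> 4 <= E -> 0 < dl ->
  0 < fmin -> 0 < fmax -> 0 < rho -> 0 < kap -> om <= kap * E ^+ d ->
  tau <= dl ^+ d.+1 * (om * fmax * rho ^+ d) ->
  C4 * (4 * dl * (fmax * ((4 * (rho * dl)) ^+ d * kap)) + tau) /
    (fmin * ((rho * dl / 16) ^+ d * kap) / 256) <=
  ((1280 * C4 + 200) * (16 * E)) ^+ d * (fmax / fmin) * dl.
Proof.
move=> d0 C40 E4 dl0 fmin0 fmax0 rho0 kap0 hom htau.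
pose W := (rho * dl) ^+ d * kap.
have W0 : 0 < W by rewrite mulr_gt0// exprn_gt0// mulr_gt0.
have E0 : 0 < E by lra.
have h1 : tau <= dl * fmax * W * E ^+ d.
  apply: (le_trans htau).
  have -> : dl ^+ d.+1 * (om * fmax * rho ^+ d) = (dl * fmax * (rho * dl) ^+ d) * om.
    by rewrite exprS exprMn; ring.
  have -> : dl * fmax * W * E ^+ d = (dl * fmax * (rho * dl) ^+ d) * (kap * E ^+ d).
    by rewrite /W; ring.
  by rewrite ler_wpM2l// !mulr_ge0 ?exprn_ge0 ?mulr_ge0 ?(ltW dl0) ?(ltW fmax0) ?(ltW rho0).
have h2 : 4 * dl * (fmax * ((4 * (rho * dl)) ^+ d * kap)) <= 4 * (dl * fmax * W * E ^+ d).
  have -> : 4 * dl * (fmax * ((4 * (rho * dl)) ^+ d * kap)) = 4 * (dl * fmax * W) * 4 ^+ d.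
    by rewrite /W (exprMn _ 4); ring.
  rewrite [leRHS]mulrA ler_wpM2l ?lerXn2r ?nnegrE//; last exact: ltW.
  by apply: mulr_ge0 => //; apply: mulr_ge0 (ltW W0); apply: mulr_ge0; exact: ltW.
have -> : fmin * ((rho * dl / 16) ^+ d * kap) / 256 = fmin * W / (16 ^+ d * 256).
  by rewrite /W expr_div_n; field; rewrite !gt_eqF// exprn_gt0.
have lam0 : 0 < fmin * W / (16 ^+ d * 256) by apply: divr_gt0; [exact: mulr_gt0|rewrite mulr_gt0// exprn_gt0].
apply: (@le_trans _ _ (1280 * C4 * (16 * E) ^+ d * (fmax / fmin) * dl)).
  rewrite ler_pdivrMr//.
  have -> : 1280 * C4 * (16 * E) ^+ d * (fmax / fmin) * dl * (fmin * W / (16 ^+ d * 256)) =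
      C4 * (5 * (dl * fmax * W * E ^+ d)).
    by rewrite exprMn; field; rewrite !gt_eqF// exprn_gt0.
  by rewrite ler_wpM2l ?(ltW C40)//; lra.
rewrite (exprMn _ (1280 * C4 + 200)) !ler_wpM2r ?(ltW dl0) ?divr_ge0 ?exprn_ge0 ?mulr_ge0 ?(ltW fmin0) ?(ltW fmax0) ?(ltW E0)//.
have B1 : 1 <= 1280 * C4 + 200 by lra.
apply: (@le_trans _ _ (1280 * C4 + 200)); first by lra.
by rewrite -[leLHS]expr1 ler_weXn2l.
Qed.

Lemma opnorm_proj_le2 n (S T P Q : 'M[R]_n) : orth_proj S P -> orth_proj T Q -> opnorm (P - Q) <= 2.
Proof.
move=> hP hQ; apply: opnorm_le => v v1; rewrite mulmxBr (le_trans (enormB _ _))//.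
have := orth_proj_le v hP; have := orth_proj_le v hQ; lra.
Qed.

Definition const_alg n (T : 'M[R]_n) : SQalg R n :=
  {| nq := 0; query := fun _ _ => 0; output := fun _ => T |}.

Lemma const_alg_valid n (T : 'M[R]_n) : SQvalid (const_alg T).
Proof. by move=> s; split => [|x] /=; [exact: measurable_cst|rewrite lerN10 ler01]. Qed.

End Rate.

(** * The tangent space estimator *)

Theorem theorem4p2 (R : realType) :
  exists (C Ct : R), 0 < C /\ 0 < Ct /\
  forall (n d : nat) (rchmin fmin fmax L tau eta : R) (x0 : 'rV[R]_n),
    (0 < d)%N -> 0 < rchmin -> 0 < fmin -> fmin <= fmax -> 0 <= L ->
    0 < tau -> 0 <= eta ->
    tau / (omega R d * fmax * rchmin ^+ d)
      <= (1 / (8 * Num.sqrt (d%:R))) ^+ d.+1 ->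
    eta <= rchmin / (64 * d%:R) ->
    exists A : SQalg R n,
      SQvalid A /\
      (nq A)%:R <= C * d%:R * n%:R * (ln (n%:R)) ^+ 6 /\
      forall (D : probability (BorelRn R n) R) (M : set 'rV[R]_n)
             (mu : {measure set (BorelRn R n) -> \bar R}) (f : 'rV[R]_n -> R),
        model d rchmin fmin fmax L D M mu f ->
        eucl_dist x0 M <= eta ->
        forall a : seq R, STAT_transcript D tau A a ->
          \rank (output A a) = d /\
          forall (p : 'rV[R]_n) (T P Q : 'M[R]_n),
            nearest_point M x0 p -> tangent_space d M p T ->
            orth_proj (output A a) P -> orth_proj T Q ->
            opnorm (P - Q) <=
              Ct ^+ d * (fmax / fmin) *
              Num.max (Num.sqrt (eta / rchmin))
                      ((tau / (omega R d * fmax * rchmin ^+ d)) `^ (1 / (d.+1)%:R)).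
Proof.
have [C [C4 [C0 C40 hrec]]] := sq_moment_recovery R.
pose E : R := 8 * expR 2.
have E4 : 4 <= E by have := expR_ge1Dx (2 : R); rewrite /E; lra.
pose Ct := (1280 * C4 + 200) * (16 * E).
have Ct200 : 200 <= Ct.
  rewrite /Ct -[leLHS]mulr1 ler_pM//; lra.
exists C, Ct; split => //; split; first by rewrite (lt_le_trans _ Ct200).
move=> n d rho fmin fmax L tau eta x0 d0 rho0 fmin0 fminmax L0 tau0 eta0 _ _.
have fmax0 : 0 < fmax := lt_le_trans fmin0 fminmax.
have om0 := omega_gt0 R d.
set X := tau / _; set dl := Num.max _ _.
have X0 : 0 < X by rewrite divr_gt0// !mulr_gt0 ?exprn_gt0.
have dl0 : 0 < dl by rewrite lt_max powR_gt0 ?orbT.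
have eta_le : eta <= dl * (rho * dl).
  have h : Num.sqrt (eta / rho) <= dl by rewrite le_max lexx.
  have : Num.sqrt (eta / rho) ^+ 2 <= dl ^+ 2.
    by rewrite ler_pXn2r ?nnegrE ?sqrtr_ge0// ltW.
  rewrite sqr_sqrtr ?divr_ge0 ?(ltW rho0)// ler_pdivrMr// => h'.
  by rewrite mulrCA mulrC -expr2.
have tau_le : tau <= dl ^+ d.+1 * (omega R d * fmax * rho ^+ d).
  rewrite -ler_pdivrMr ?mulr_gt0 ?exprn_gt0//.
  have h : X `^ (1 / d.+1%:R) <= dl by rewrite le_max lexx orbT.
  have : (X `^ (1 / d.+1%:R)) ^+ d.+1 <= dl ^+ d.+1.
    by rewrite ler_pXn2r ?nnegrE ?powR_ge0// ltW.
  by rewrite -powR_mulrn ?powR_ge0// -powRrM mul1r mulVf ?pnatr_eq0// powRr1 ?(ltW X0).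
clearbody dl.
have rhs0 : 0 <= Ct ^+ d * (fmax / fmin) * dl.
  by rewrite !mulr_ge0 ?exprn_ge0 ?invr_ge0 ?(ltW fmin0) ?(ltW fmax0) ?(ltW dl0)// (le_trans _ Ct200).
have count0 : 0 <= C * d%:R * n%:R * ln (n%:R) ^+ 6.
  by apply: mulr_ge0; [rewrite !mulr_ge0// ltW|exact: exprn_even_ge0].
(* For n = 1 the count allows no query, as ln 1 = 0. A d-dimensional M with n <= d forces n = d, and
   the tangent space is the whole space. *)
have [nd|dn] := leqP n d.
  exists (const_alg 1%:M); split; first exact: const_alg_valid.
  split => // D M mu f [[hM _ _] _] _ a _ /=.
  have [p Mp] : M !=set0 by case: hM.
  have [Q0 tQ0] := tproj_exists hM Mp.
  have en : n = d.
    by apply/eqP; rewrite eqn_leq nd -(tproj_rank tQ0) rank_leq_col.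
  rewrite mxrank1; split => // q T P Q np hT hP hQ.
  have tQ : tproj d M q Q by exists T.
  have -> : P = 1%:M by rewrite -[P]mul1mx (orth_proj_sub hP).
  have -> : Q = 1%:M.
    rewrite -[Q]mul1mx (orth_proj_sub hQ)// submx_full// /row_full.
    by rewrite [X in _ == X]en -(tproj_rank tQ); case: hQ => _ [_ /eqmxP ->].
  rewrite subrr; apply: (le_trans _ rhs0); apply: opnorm_le => v _.
  by rewrite mulmx0 enorm0.
have [big|small] := leP 2 (Ct ^+ d * (fmax / fmin) * dl).
  exists (const_alg (pid_mx d)); split; first exact: const_alg_valid.
  split => // D M mu f _ _ a _ /=.
  rewrite rank_pid_mx ?(ltnW dn)//; split => // p T P Q _ _ hP hQ.
  exact: le_trans (opnorm_proj_le2 hP hQ) big.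
(* Since d >= 1 and fmin <= fmax, the claimed bound is at least 200 dl; being below 2, it makes h
   small enough against rho for the local estimates. *)
have dl100 : dl <= 1 / 100.
  have h1 : 200 <= Ct ^+ d * (fmax / fmin).
    rewrite -[leLHS]mulr1 ler_pM//; last by rewrite ler_pdivlMr// mul1r.
    by rewrite (le_trans Ct200)// -[leLHS]expr1 ler_weXn2l// (le_trans _ Ct200)// ler1n.
  have : 200 * dl <= Ct ^+ d * (fmax / fmin) * dl by rewrite ler_wpM2r// ltW.
  lra.
pose h := rho * dl; have h0 : 0 < h by rewrite mulr_gt0.
have hdl : h <= rho * (1 / 100) by rewrite ler_wpM2l// ltW.
have h40 : h <= rho / 40 by lra.
have eta_h : eta <= dl * h := eta_le.
have eta100 : eta <= h / 100.
  by apply: (le_trans eta_h); rewrite mulrC ler_wpM2l ?(ltW h0)//; lra.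
(* Mesh dl in units of h makes rounding cost dl, next to 2 dl from curvature and dl from the offset:
   the factor 4 dl in [D0]. The number K of cells does not enter the query count. *)
have [K [g [g1 gnet]]] := @ball_net R n dl dl0.
pose kap := fine (hausdorff d (@unit_ball R d)).
pose D0 := 4 * dl * (fmax * ((4 * h) ^+ d * kap)).
pose lam := fmin * ((h / 16) ^+ d * kap) / 256.
have [A [vA cA hA]] := hrec n d K g x0 h dl tau D0 lam d0 dn g1 tau0.
exists A; split => //; split => // D M mu f hmod hx0 a ha.
have [[hM _ _] _] := hmod.
have [rA {}hA] := hA D a ha; split => // p T P Q [Mp np] hT hP hQ.
have tQ : tproj d M p Q by exists T.
have px : enorm (p - x0) <= eta by rewrite np.
have px100 := le_trans px eta100.
have kE : hausdorff d (@unit_ball R d) = kap%:E.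
  by rewrite /kap fineK// (unit_ball_fin hM rho0 hmod fmin0 d0 tQ).
have hk : omega R d / E ^+ d <= kap.
  by rewrite -lee_fin -kE; exact: ball_hausdorff_ge.
have Ed0 : 0 < E ^+ d by rewrite exprn_gt0//; lra.
have kap0 : 0 < kap by apply: lt_le_trans hk; rewrite divr_gt0.
have rT : \rank T = d by rewrite -(tproj_rank tQ); case: hQ => _ [_ /eqmxP ->].
have lam0 : 0 < lam.
  by rewrite divr_gt0// mulr_gt0// mulr_gt0// exprn_gt0// divr_gt0.
apply: (le_trans (hA T P Q hP hQ rT lam0 _ _)).
- apply: (@le_trans _ _ (\sum_k cell_mass g x0 h dl D k * (4 * dl))).
    apply: ler_sum => k _.
    have [->|mk] := eqVneq (cell_mass g x0 h dl D k) 0; first by rewrite !mul0r.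
    rewrite ler_wpM2l ?cell_mass_ge0//.
    apply: (le_trans (cell_mass_normal hM rho0 h0 px100 hmod tQ mk)).
    have -> : h / rho = dl by rewrite /h mulrC mulKf// gt_eqF.
    have : enorm (p - x0) / h <= dl by rewrite ler_pdivrMr// (le_trans px).
    lra.
  rewrite -mulr_suml mulrC ler_wpM2l ?mulr_ge0 ?(ltW dl0)//.
  exact: (cell_mass_sum_le hM rho0 dl h0 h40 px100 hmod fmin0 d0 g tQ (ltW fmax0)).
- move=> w wQ w1; apply: (cell_mass_spread hM rho0 h0 h40 px100 hmod fmin0 d0 tQ gnet) => //; lra.
apply: (rate_le d0 C40 E4 dl0 fmin0 fmax0 rho0 kap0 _ tau_le).
by rewrite -ler_pdivrMr.
Qed.
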